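(* Let $\Sigma_M$ be a control system on a regular manifold $M\subset\mathbb{R}^n$, with extension $\tilde\Sigma_{\mathbb{R}^n}:\ \dot x=\tilde X_e(x,u),\ y=h(x)$ to $\mathbb{R}^n$, and let $(x_0(t),u_0(t))$, $t\ge0$, be a bounded reference trajectory on $M$ with its control signal, with linearization matrices $A(t),B(t),C(t)$ (all as described in the context). Let $\hat x\in\mathbb{R}^n$ be the state of the observer $$\dot{\hat x}=\tilde X_e(\hat x,u)-L(t)(h(\hat x)-y),\qquad L(t)=P(t)C^T(t)R^{-1}(t),$$ where $P(t)$ is the solution to $$\dot P=PA^T(t)+A(t)P-PC^T(t)R^{-1}(t)C(t)P+Q(t),$$ with $R(t)=R^T(t)>0$ and $Q(t)=Q^T(t)\ge0$, and let the control be $u=u_0(t)-K(t)(\hat x-x_0(t))$. Put $e_{\rm o}=x-\hat x$; the tracking error and observation error dynamics are together written as $$\begin{bmatrix}\Delta\dot x\\ \dot e_{\rm o}\end{bmatrix}=\begin{bmatrix}A(t)-B(t)K(t)&B(t)K(t)\\0&A(t)-L(t)C(t)\end{bmatrix}\begin{bmatrix}\Delta x\\ e_{\rm o}\end{bmatrix}+O(\|\Delta x\|^2,\|e_{\rm o}\|^2).\quad( * )$$ Suppose that: (i) $K(t)$ is chosen such that the linear time-varying system $\dot z=(A(t)-B(t)K(t))z$ is exponentially stable; (ii) $B(t)K(t)$ is bounded; (iii) the pair $(A(t),C(t))$ is uniformly completely observable; (iv) for some matrices $D(t)$ and $\tilde Q(t)=\tilde Q^T(t)$ such that $Q(t)=D(t)\tilde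 Q(t)D^T(t)$, the pair $(A(t),D(t))$ is uniformly completely controllable and there are positive numbers $\gamma_1,\gamma_2$ with $\gamma_1I\le\tilde Q(t)\le\gamma_2I$ for all $t$; (v) there are positive numbers $\gamma_3,\gamma_4$ with $\gamma_3I\le R(t)\le\gamma_4I$ for all $t$. Then $(\Delta x,e_{\rm o})=(0,0)$ is an exponentially stable equilibrium point for $( * )$. In consequence, the trajectory $x(t)$ of the system $\Sigma_M$ on $M$ exponentially tracks the reference $x_0(t)$ with this observer-based controller.
   Context: Setting. $M\subset\mathbb{R}^n$ is a regular manifold; $\Sigma_M$ is the control system $\dot x=X(x,u)$, $y=h(x)\in\mathbb{R}^p$, $x\in M$, $u\in\mathbb{R}^k$, with $X(x,u)\in T_xM$, and $h$ is defined on $\mathbb{R}^n$. $X_e:\mathbb{R}^n\times\mathbb{R}^k\to\mathbb{R}^n$ satisfies $X_e=X$ on $M\times\mathbb{R}^k$. $\tilde V$ is a non-negative function on $\mathbb{R}^n$ with $M=\tilde V^{-1}(0)$ and $\nabla\tilde V(x)\cdot X_e(x,u)=0$ for all $(x,u)\in\mathbb{R}^n\times\mathbb{R}^k$. Put $\tilde X_e(x,u)=X_e(x,u)-\nabla\tilde V(x)$; this coincides with $X$ on $M$, so $\tilde\Sigma_{\mathbb{R}^n}$ restricts to $\Sigma_M$ on $M$. Reference. $x_0:[0,\infty)\to M$ and $u_0:[0,\infty)\to\mathbb{R}^k$ are bounded and $\dot x_0(t)=X(x_0(t),u_0(t))$ for all $t\ge0$. Write $\Delta x=x-x_0(t)$,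 where $x$ and $y$ are the state and output of $\tilde\Sigma_{\mathbb{R}^n}$, and $$A(t)=\frac{\partial\tilde X_e}{\partial x}(x_0(t),u_0(t)),\quad B(t)=\frac{\partial\tilde X_e}{\partial u}(x_0(t),u_0(t)),\quad C(t)=\frac{\partial h}{\partial x}(x_0(t)),$$ which are continuous in $t$. The term $O(\cdot)$ in $( * )$ is the second-order remainder of the linearization; it is understood that it also depends explicitly on $t$. Uniform complete controllability/observability. Let $\Phi(t,\tau)$ be the transition matrix of $\dot x=A(t)x$: $\partial_t\Phi(t,\tau)=A(t)\Phi(t,\tau)$, $\Phi(\tau,\tau)=I$. The pair $(A(t),B(t))$ is uniformly completely controllable if there are $\sigma>0$ and $\alpha_1,\dots,\alpha_4>0$ depending on $\sigma$ such that for all $t$: $\alpha_1I\le W(t,t+\sigma)\le\alpha_2I$ and $\alpha_3I\le\Phi(t+\sigma,t)W(t,t+\sigma)\Phi^T(t+\sigma,t)\le\alpha_4I$, where $W(t,\bar t)=\int_t^{\bar t}\Phi(t,\tau)B(\tau)B^T(\tau)\Phi^T(t,\tau)\,d\tau$ (for $(A,D)$, replace $B$ by $D$). The pair $(A(t),C(t))$ is uniformly completely observable if there are $\sigma>0$ and $\alpha_1,\dots,\alpha_4>0$ depending on $\sigma$ such that for all $t$: $\alpha_1I\le V(t,t+\sigma)\le\alpha_2I$ and $\alpha_3I\le\Phi^T(t,t+\sigma)V(t,t+\sigma)\Phi(t,t+\sigma)\le\alpha_4I$, where $V(t,\bar t)=\int_t^{\bar t}\Phi^T(\tau,t)C^T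(\tau)C(\tau)\Phi(\tau,t)\,d\tau$.
   Formalization: The formal theorem takes P(0) symmetric and positive semidefinite, reads the O-term in ( * ) as a bound uniform in t≥0 near the origin, and takes K(t), Q(t), R(t) continuous; without the first two the claim fails. *)

(* Defs.v *)
From HB Require Import structures.
From mathcomp Require Import all_boot all_order all_algebra.
From mathcomp Require Import all_classical all_reals all_analysis.

Set Implicit Arguments.
Unset Strict Implicit.
Unset Printing Implicit Defensive.

Import Order.TTheory GRing.Theory Num.Theory.
Import numFieldNormedType.Exports.

Local Open Scope classical_set_scope.
Local Open Scope ring_scope.

(* R^n is 'cV[R]_n. The norm `|_| on matrices is the library's sup norm; every
   notion below (boundedness, O(.), exponential stability) is unchanged when
   it is replaced by the Euclidean norm. *)

Section differential_calculus.
Context {R : realType}.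

(* Meant for an open set U of a finite-dimensional space V, where continuity
   of all directional derivatives is continuity of the differential. *)
Definition C1_on {V W : normedModType R} (U : set V) (f : V -> W) : Prop :=
  (forall x, U x -> differentiable f x) /\
  (forall v x, U x -> {for x, continuous (fun y => 'D_v f y)}).

Definition partial_mx {n m} (f : 'cV[R]_n -> 'cV[R]_m) (a : 'cV[R]_n) :
  'M[R]_(m, n) := \matrix_(i, j) ('D_(delta_mx j 0) f a) i 0.

Definition grad {n} (f : 'cV[R]_n -> R) (a : 'cV[R]_n) : 'cV[R]_n :=
  \col_i 'D_(delta_mx i 0) f a.

End differential_calculus.

Section manifolds.
Context {R : realType} {n : nat}.

(* Regular (embedded) submanifolds of R^n, by slice charts phi : U -> W with
   inverse psi. Only class C^1 is required, so C^r and smooth ones are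
   included. *)
Definition regular_manifold (M : set 'cV[R]_n) : Prop :=
  exists2 m : nat, (m <= n)%N &
  forall a, M a ->
  exists (U W : set 'cV[R]_n) (phi psi : 'cV[R]_n -> 'cV[R]_n),
    [/\ open U, U a & open W] /\
    [/\ C1_on U phi, C1_on W psi,
        forall x, U x -> W (phi x) /\ psi (phi x) = x &
        forall y, W y -> U (psi y) /\ phi (psi y) = y] /\
    forall x, U x -> (M x <-> forall i : 'I_n, (m <= i)%N -> phi x i 0 = 0).

Definition tangent_space (M : set 'cV[R]_n) (x : 'cV[R]_n) : set 'cV[R]_n :=
  [set v | exists gamma : R -> 'cV[R]_n,
    [/\ gamma 0 = x, \forall s \near (0 : R), M (gamma s) &
        is_derive (0 : R) (1 : R) gamma v]].

End manifolds.

Section differential_equations.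
Context {R : realType}.

(* z is continuous on the interval i and satisfies dz/dt = F(t, z) in its
   interior. *)
Definition is_sol {V : normedModType R} (F : R -> V -> V) (i : interval R)
    (z : R -> V) : Prop :=
  {within [set` i], continuous z} /\
  forall t, [set` i]° t -> is_derive t (1 : R) z (F t (z t)).

(* The origin is an equilibrium of dz/dt = F(t, z), t >= 0, exponentially
   stable uniformly in the initial time. As in textbook definitions, existence
   of solutions is a matter for the regularity of F. The bound concerns every
   solution on every interval [t0, T[: it covers solutions on [t0, +oo[ and
   rules out finite escape times. *)
Definition exp_stable {n} (F : R -> 'cV[R]_n -> 'cV[R]_n) : Prop :=
  (forall t, 0 <= t -> F t 0 = 0) /\
  exists delta kappa lambda : R,
    [/\ 0 < delta, 0 < kappa & 0 < lambda] /\
    forall (t0 T : R) (z : R -> 'cV[R]_n),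
      0 <= t0 -> is_sol F `[t0, T[ z -> `|z t0| < delta ->
      forall t, t0 <= t < T ->
        `|z t| <= kappa * `|z t0| * expR (- lambda * (t - t0)).

Definition transition_matrix {n} (A : R -> 'M[R]_n) (Phi : R -> R -> 'M[R]_n) :
    Prop :=
  forall tau, 0 <= tau ->
    is_sol (fun t (Z : 'M[R]_n) => A t *m Z) `[0, +oo[ (Phi ^~ tau) /\
    Phi tau tau = 1%:M.

End differential_equations.

Section quadratic_forms.
Context {R : realType}.

Definition qform {n} (S : 'M[R]_n) (v : 'cV[R]_n) : R := (v^T *m S *m v) 0 0.

Definition sym {n} (S : 'M[R]_n) : Prop := S^T = S.

Definition posdef {n} (S : 'M[R]_n) : Prop := forall v, v != 0 -> 0 < qform S v.

(* S <= S' as quadratic forms; for symmetric matrices, the Loewner order. *)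
Definition mx_le {n} (S S' : 'M[R]_n) : Prop :=
  forall v, qform S v <= qform S' v.

End quadratic_forms.

Section complete_controllability_observability.
Context {R : realType}.

Let mu := @lebesgue_measure R.

Definition mx_integrable {m n} (a b : R) (G : R -> 'M[R]_(m, n)) : Prop :=
  forall i j, mu.-integrable `[a, b] (fun s => (G s i j)%:E).

Definition mx_integral {m n} (a b : R) (G : R -> 'M[R]_(m, n)) : 'M[R]_(m, n) :=
  \matrix_(i, j) \int[mu]_(s in `[a, b]) G s i j.

Definition ctrl_integrand {n k} (Phi : R -> R -> 'M[R]_n)
    (B : R -> 'M[R]_(n, k)) (t tau : R) : 'M[R]_n :=
  Phi t tau *m B tau *m (B tau)^T *m (Phi t tau)^T.

Definition obs_integrand {n p} (Phi : R -> R -> 'M[R]_n)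
    (C : R -> 'M[R]_(p, n)) (t tau : R) : 'M[R]_n :=
  (Phi tau t)^T *m (C tau)^T *m C tau *m Phi tau t.

(* In the next two definitions the existence of the integral defining the
   Gramian is part of the property; no regularity of B is otherwise assumed. *)
Definition uniformly_completely_controllable {n k} (A : R -> 'M[R]_n)
    (B : R -> 'M[R]_(n, k)) : Prop :=
  exists2 Phi, transition_matrix A Phi &
  exists sigma a1 a2 a3 a4 : R,
    [/\ 0 < sigma, 0 < a1, 0 < a2, 0 < a3 & 0 < a4] /\
    forall t, 0 <= t ->
      let W := mx_integral t (t + sigma) (ctrl_integrand Phi B t) in
      let W' := Phi (t + sigma) t *m W *m (Phi (t + sigma) t)^T in
      [/\ mx_integrable t (t + sigma) (ctrl_integrand Phi B t),
          mx_le a1%:M W, mx_le W a2%:M, mx_le a3%:M W' & mx_le W' a4%:M].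

Definition uniformly_completely_observable {n p} (A : R -> 'M[R]_n)
    (C : R -> 'M[R]_(p, n)) : Prop :=
  exists2 Phi, transition_matrix A Phi &
  exists sigma a1 a2 a3 a4 : R,
    [/\ 0 < sigma, 0 < a1, 0 < a2, 0 < a3 & 0 < a4] /\
    forall t, 0 <= t ->
      let V := mx_integral t (t + sigma) (obs_integrand Phi C t) in
      let V' := (Phi t (t + sigma))^T *m V *m Phi t (t + sigma) in
      [/\ mx_integrable t (t + sigma) (obs_integrand Phi C t),
          mx_le a1%:M V, mx_le V a2%:M, mx_le a3%:M V' & mx_le V' a4%:M].

End complete_controllability_observability.

Section closed_loop.
Context {R : realType} {n k p : nat}.

Definition transversal_ext (Xe : 'cV[R]_n -> 'cV[R]_k -> 'cV[R]_n)
    (Vt : 'cV[R]_n -> R) (x : 'cV[R]_n) (u : 'cV[R]_k) : 'cV[R]_n :=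
  Xe x u - grad Vt x.

Variables (X tXe : 'cV[R]_n -> 'cV[R]_k -> 'cV[R]_n) (h : 'cV[R]_n -> 'cV[R]_p).
Variables (x0 : R -> 'cV[R]_n) (u0 : R -> 'cV[R]_k).
Variables (K : R -> 'M[R]_(k, n)) (L : R -> 'M[R]_(n, p)).

Definition feedback (t : R) (xh : 'cV[R]_n) : 'cV[R]_k :=
  u0 t - K t *m (xh - x0 t).

Definition observer (t : R) (xh : 'cV[R]_n) (u : 'cV[R]_k) (y : 'cV[R]_p) :
    'cV[R]_n :=
  tXe xh u - L t *m (h xh - y).

(* The vector field of (Dx, eo) = (x - x0(t), x - xh), where x is the state of
   dx/dt = tXe(x, u), xh that of the observer, u = feedback and y = h(x). *)
Definition error_field (t : R) (z : 'cV[R]_(n + n)) : 'cV[R]_(n + n) :=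
  let x := x0 t + usubmx z in
  let xh := x - dsubmx z in
  let u := feedback t xh in
  col_mx (tXe x u - X (x0 t) (u0 t)) (tXe x u - observer t xh u (h x)).

Definition error_linear_part (A : R -> 'M[R]_n) (B : R -> 'M[R]_(n, k))
    (C : R -> 'M[R]_(p, n)) (t : R) : 'M[R]_(n + n) :=
  block_mx (A t - B t *m K t) (B t *m K t) 0 (A t - L t *m C t).

(* F(t, z) = S(t) z + O(|Dx|^2, |eo|^2), uniformly in t >= 0. *)
Definition second_order_remainder (F : R -> 'cV[R]_(n + n) -> 'cV[R]_(n + n))
    (S : R -> 'M[R]_(n + n)) : Prop :=
  exists c delta : R, 0 < delta /\
    forall t (Dx eo : 'cV[R]_n), 0 <= t -> `|Dx| < delta -> `|eo| < delta ->
      `|F t (col_mx Dx eo) - S t *m col_mx Dx eo|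
        <= c * (`|Dx| ^+ 2 + `|eo| ^+ 2).

(* Trajectories x on M of the system dx/dt = X(x, u), y = h(x), in closed loop
   with the observer-based controller, track x0 exponentially. *)
Definition exp_tracks_on (M : set 'cV[R]_n) : Prop :=
  exists delta kappa lambda : R,
    [/\ 0 < delta, 0 < kappa & 0 < lambda] /\
    forall (t0 T : R) (x xh : R -> 'cV[R]_n),
      let u t := feedback t (xh t) in
      0 <= t0 ->
      (forall t, t0 <= t < T -> M (x t)) ->
      is_sol (fun t w => X w (u t)) `[t0, T[ x ->
      is_sol (fun t w => observer t w (u t) (h (x t))) `[t0, T[ xh ->
      `|x t0 - x0 t0| < delta -> `|x t0 - xh t0| < delta ->
      forall t, t0 <= t < T ->
        `|x t - x0 t| <=
          kappa * (`|x t0 - x0 t0| + `|x t0 - xh t0|)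
                * expR (- lambda * (t - t0)).

End closed_loop.

(* Main.v *)
Require Import Defs.
From HB Require Import structures.
From mathcomp Require Import all_boot all_order all_algebra.
From mathcomp Require Import all_classical all_reals all_analysis.
From mathcomp Require Import ring lra.

Set Implicit Arguments.
Unset Strict Implicit.
Unset Printing Implicit Defensive.

Import Order.TTheory GRing.Theory Num.Theory.
Import numFieldNormedType.Exports.

Local Open Scope classical_set_scope.
Local Open Scope ring_scope.

(* The observer error obeys e' = (A - L C) e up to second order. Its adjoint
   l' = - (A - L C)^T l is the optimal closed loop of the regulator dual to the
   filter, and l^T P l is the corresponding energy: it is nondecreasing, over a window
   it gains at least c |l|^2 (controllability), and it is at most p |l|^2
   (observability, by a trial control). Hence it decays geometrically backward in
   time, and since the pairing of l with e is constant, e decays forward in time.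
   No inverse of P is needed, so P(0) may be singular. Over a long window the
   linearized cascade (e, then x - x0 driven by B K e) contracts a weighted squared
   norm, and Gronwall's inequality shows that the second-order remainder does not
   destroy this contraction near the origin; iterating over windows gives exponential
   decay. Trajectories on M are covered because the gradient of Vt vanishes there. *)

(** The textbook Lyapunov function of the filter error is e^T P^-1 e, which calls for a positive
    lower bound on P from the start; the adjoint equation puts P itself in its place. The obstacle
    there is that neither Q nor D is bounded pointwise: only the Gramian of (A, D) is controlled, so
    Q is bounded merely in the mean, along solutions of l' = - A^T l issued from a fixed basis.
    Other test functions are expanded in that basis with bounded coefficients. A and C, in contrast,
    are bounded pointwise, since the reference stays in a compact set. Contraction of a linear
    equation is expressed so that every factor k is reached over all sufficiently long windows; one
    window then serves both blocks of the cascade, and a weight absorbs the coupling. The lower and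
    the upper bound on P need one window each, so the error is known to contract only from a
    positive time on; the stretch before it is covered by the growth bound of the nonlinear
    equation, which keeps the constants uniform in the initial time. *)

Section matrix_limits.
Context {R : realType}.

Lemma mx_norm_le {m n} (M : 'M[R]_(m, n)) (e : R) :
  0 <= e -> (`|M| <= e) = [forall i, forall j, `|M i j| <= e].
Proof.
move=> e0; rewrite {1}/Num.Def.normr/= mx_normrE.
apply/idP/idP => [/bigmax_leP[_ h]|h].
  by apply/forallP => i; apply/forallP => j; exact: (h (i, j)).
by apply/bigmax_leP; split => // -[i j] _ /=; move/forallP : h => /(_ i) /forallP.
Qed.

Lemma mx_norm_entry {m n} (M : 'M[R]_(m, n)) i j : `|M i j| <= `|M|.
Proof.
by have := lexx `|M|; rewrite {1}mx_norm_le// => /forallP /(_ i) /forallP.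
Qed.

Lemma cvg_mxP {T : Type} (F : set_system T) {FF : Filter F} {m n}
  (M : T -> 'M[R]_(m, n)) (N : 'M[R]_(m, n)) :
  M x @[x --> F] --> N <-> forall i j, M x i j @[x --> F] --> N i j.
Proof.
split=> [/cvgrPdist_le h i j|h].
  apply/cvgrPdist_le => e e0; have := h e e0; apply: filterS => x.
  by apply: le_trans; have := mx_norm_entry (N - M x) i j; rewrite !mxE.
apply/cvgrPdist_le => e e0.
have : \forall x \near F, forall i j, `|N i j - M x i j| <= e.
  apply: filter_forall => i; apply: filter_forall => j.
  by move/cvgrPdist_le : (h i j) => /(_ e e0).
apply: filterS => x hx; rewrite mx_norm_le ?ltW//.
by apply/forallP => i; apply/forallP => j; rewrite !mxE.
Qed.

Lemma cvg_sum_ord {T : Type} (F : set_system T) {FF : Filter F} n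
  (f : 'I_n -> T -> R) (l : 'I_n -> R) :
  (forall i, f i x @[x --> F] --> l i) ->
  \sum_i f i x @[x --> F] --> \sum_i l i.
Proof.
move=> h; have -> : (fun x => \sum_i f i x) = \sum_i f i.
  by apply/funext => x; rewrite fct_sumE.
elim/big_ind2 : _ => // [|f1 l1 f2 l2 h1 h2]; first exact: cvg_cst.
exact: cvgD.
Qed.

Lemma cvg_mulmx {T : Type} (F : set_system T) {FF : Filter F} {m n p}
  (M : T -> 'M[R]_(m, n)) (N : T -> 'M[R]_(n, p)) (M0 : 'M[R]_(m, n)) (N0 : 'M[R]_(n, p)) :
  M x @[x --> F] --> M0 -> N x @[x --> F] --> N0 ->
  M x *m N x @[x --> F] --> M0 *m N0.
Proof.
move=> /cvg_mxP hM /cvg_mxP hN; apply/cvg_mxP => i j; rewrite mxE.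
under eq_fun do rewrite mxE.
by apply: cvg_sum_ord => k; apply: cvgM; [exact: hM|exact: hN].
Qed.

Lemma cvg_trmx {T : Type} (F : set_system T) {FF : Filter F} {m n}
  (M : T -> 'M[R]_(m, n)) (M0 : 'M[R]_(m, n)) :
  M x @[x --> F] --> M0 -> (M x)^T @[x --> F] --> M0^T.
Proof.
move=> /cvg_mxP hM; apply/cvg_mxP => i j; rewrite mxE.
by under eq_fun do rewrite mxE; exact: hM.
Qed.

Lemma is_derive_mxP {m n} (M : R -> 'M[R]_(m, n)) (t : R) (dM : 'M[R]_(m, n)) :
  is_derive t (1 : R) M dM <-> forall i j, is_derive t (1 : R) (fun s => M s i j) (dM i j).
Proof.
split=> [[/[dup] hd /derivable_mxP h <-] i j|h].
  by apply: DeriveDef => //; rewrite derive_mx// mxE.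
have hd : derivable M t 1 by apply/derivable_mxP => i j; have [] := h i j.
apply: DeriveDef => //; rewrite derive_mx//; apply/matrixP => i j; rewrite mxE.
by have [_ ->] := h i j.
Qed.

Lemma is_derive_sum_ord n (h : 'I_n -> R -> R) (t : R) (dh : 'I_n -> R) :
  (forall i, is_derive t (1 : R) (h i) (dh i)) ->
  is_derive t (1 : R) (fun s => \sum_i h i s) (\sum_i dh i).
Proof.
move=> hd; have := is_derive_sum hd.
by congr is_derive; apply/funext => s; rewrite fct_sumE.
Qed.

Lemma is_derive_mulmx {m n p} (M : R -> 'M[R]_(m, n)) (N : R -> 'M[R]_(n, p))
    (t : R) (dM : 'M[R]_(m, n)) (dN : 'M[R]_(n, p)) :
  is_derive t (1 : R) M dM -> is_derive t (1 : R) N dN ->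
  is_derive t (1 : R) (fun s => M s *m N s) (dM *m N t + M t *m dN).
Proof.
move=> /is_derive_mxP hM /is_derive_mxP hN; apply/is_derive_mxP => i j.
under eq_fun do rewrite mxE.
rewrite !mxE -big_split/=; apply: is_derive_sum_ord => k.
apply: (is_derive_eq (is_deriveM (hM i k) (hN k j))).
by rewrite /GRing.scale/=; ring.
Qed.

Lemma is_derive_trmx {m n} (M : R -> 'M[R]_(m, n)) (t : R) (dM : 'M[R]_(m, n)) :
  is_derive t (1 : R) M dM -> is_derive t (1 : R) (fun s => (M s)^T) dM^T.
Proof.
move=> /is_derive_mxP hM; apply/is_derive_mxP => i j.
under eq_fun do rewrite mxE.
by rewrite !mxE.
Qed.

End matrix_limits.

(** * Euclidean inner product and operator bounds *)

Section dot_product.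
Context {R : realType}.

Definition dot {n} (u v : 'cV[R]_n) : R := (u^T *m v) 0 0.
Definition sqn {n} (v : 'cV[R]_n) : R := dot v v.

Lemma dotE n (u v : 'cV[R]_n) : dot u v = \sum_i u i 0 * v i 0.
Proof. by rewrite /dot mxE; apply: eq_bigr => i _; rewrite mxE. Qed.

Lemma dotC n (u v : 'cV[R]_n) : dot u v = dot v u.
Proof. by rewrite !dotE; apply: eq_bigr => i _; rewrite mulrC. Qed.

Lemma dotDl n (u v w : 'cV[R]_n) : dot (u + v) w = dot u w + dot v w.
Proof. by rewrite /dot linearD/= mulmxDl mxE. Qed.

Lemma dotDr n (u v w : 'cV[R]_n) : dot u (v + w) = dot u v + dot u w.
Proof. by rewrite /dot mulmxDr mxE. Qed.

Lemma dotNl n (u v : 'cV[R]_n) : dot (- u) v = - dot u v.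
Proof. by rewrite /dot linearN/= mulNmx mxE. Qed.

Lemma dotNr n (u v : 'cV[R]_n) : dot u (- v) = - dot u v.
Proof. by rewrite /dot mulmxN mxE. Qed.

Lemma dotZl n a (u v : 'cV[R]_n) : dot (a *: u) v = a * dot u v.
Proof. by rewrite /dot linearZ/= -scalemxAl mxE. Qed.

Lemma dotZr n a (u v : 'cV[R]_n) : dot u (a *: v) = a * dot u v.
Proof. by rewrite /dot -scalemxAr mxE. Qed.

Lemma dot0r n (u : 'cV[R]_n) : dot u 0 = 0.
Proof. by rewrite /dot mulmx0 mxE. Qed.

Lemma dot_trmx m n (M : 'M[R]_(m, n)) (u : 'cV[R]_m) (v : 'cV[R]_n) :
  dot u (M *m v) = dot (M^T *m u) v.
Proof. by rewrite /dot trmx_mul trmxK mulmxA. Qed.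

Lemma qformE n (S : 'M[R]_n) v : qform S v = dot v (S *m v).
Proof. by rewrite /qform /dot mulmxA. Qed.

Lemma sqnE n (v : 'cV[R]_n) : sqn v = \sum_i v i 0 ^+ 2.
Proof. by rewrite /sqn dotE. Qed.

Lemma sqn_ge0 n (v : 'cV[R]_n) : 0 <= sqn v.
Proof. by rewrite sqnE; apply: sumr_ge0 => i _; exact: sqr_ge0. Qed.

Lemma sqn0 n : sqn (0 : 'cV[R]_n) = 0.
Proof. exact: dot0r. Qed.

Lemma sqn_eq0 n (v : 'cV[R]_n) : sqn v = 0 -> v = 0.
Proof.
rewrite sqnE => /eqP; rewrite psumr_eq0 => [|i _]; last exact: sqr_ge0.
move=> /allP h; apply/colP => i; rewrite mxE; apply/eqP.
by rewrite -sqrf_eq0; apply: h; rewrite mem_index_enum.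
Qed.

Lemma sqnN n (v : 'cV[R]_n) : sqn (- v) = sqn v.
Proof. by rewrite /sqn dotNl dotNr opprK. Qed.

Lemma sqnZ n a (v : 'cV[R]_n) : sqn (a *: v) = a ^+ 2 * sqn v.
Proof. by rewrite /sqn dotZl dotZr mulrA. Qed.

Lemma sqnD_dot n (u v : 'cV[R]_n) : sqn (u + v) = sqn u + 2 * dot u v + sqn v.
Proof. by rewrite /sqn !dotDl !dotDr (dotC v u); ring. Qed.

Lemma dot_young n (u v : 'cV[R]_n) : 2 * dot u v <= sqn u + sqn v.
Proof.
have := sqn_ge0 (u - v); rewrite sqnD_dot dotNr sqnN; lra.
Qed.

Lemma dot_youngN n (u v : 'cV[R]_n) : - (sqn u + sqn v) <= 2 * dot u v.
Proof. by have := dot_young (- u) v; rewrite dotNl sqnN; lra. Qed.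

Lemma sqnD_le n (u v : 'cV[R]_n) : sqn (u + v) <= 2 * sqn u + 2 * sqn v.
Proof. by rewrite sqnD_dot; have := dot_young u v; lra. Qed.

Lemma norm_le_sqn n (v : 'cV[R]_n) : `|v| ^+ 2 <= sqn v.
Proof.
rewrite -(@ler_sqrt _ _ (sqn v))//; last exact: sqn_ge0.
rewrite sqrtr_sqr normr_id mx_norm_le ?sqrtr_ge0//.
apply/forallP => i; apply/forallP => j; rewrite (ord1 j) -sqrtr_sqr ler_sqrt ?sqn_ge0//.
by rewrite sqnE (bigD1 i)//= lerDl; apply: sumr_ge0 => k _; exact: sqr_ge0.
Qed.

Lemma sqn_le_norm n (v : 'cV[R]_n) : sqn v <= n%:R * `|v| ^+ 2.
Proof.
rewrite sqnE; apply: (@le_trans _ _ (\sum_(i < n) `|v| ^+ 2)).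
  apply: ler_sum => i _; rewrite -real_normK ?num_real// ler_pXn2r ?nnegrE//.
  exact: mx_norm_entry.
by rewrite sumr_const card_ord mulr_natl.
Qed.

Lemma sqn_col_mx m n (u : 'cV[R]_m) (v : 'cV[R]_n) :
  sqn (col_mx u v) = sqn u + sqn v.
Proof. by rewrite /sqn /dot tr_col_mx mul_row_col mxE. Qed.

(* Operator norm at most the square root of [c]: comparing squared Euclidean norms
   avoids square roots throughout. *)
Definition opb {m n} (c : R) (M : 'M[R]_(m, n)) : Prop :=
  forall v, sqn (M *m v) <= c * sqn v.

Lemma opbM m n p c d (M : 'M[R]_(m, n)) (N : 'M[R]_(n, p)) :
  0 <= c -> opb c M -> opb d N -> opb (c * d) (M *m N).
Proof.
move=> c0 hM hN v; rewrite -mulmxA (le_trans (hM _))// -mulrA ler_wpM2l//.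
Qed.

Lemma opbD m n c d (M N : 'M[R]_(m, n)) :
  opb c M -> opb d N -> opb (2 * (c + d)) (M + N).
Proof.
move=> hM hN v; rewrite mulmxDl (le_trans (sqnD_le _ _))//.
by have := hM v; have := hN v; lra.
Qed.

Lemma opbN m n c (M : 'M[R]_(m, n)) : opb c M -> opb c (- M).
Proof. by move=> hM v; rewrite mulNmx sqnN. Qed.

Lemma opb_le m n c d (M : 'M[R]_(m, n)) : c <= d -> opb c M -> opb d M.
Proof.
by move=> cd hM v; rewrite (le_trans (hM v))// ler_wpM2r// sqn_ge0.
Qed.

(** With w = M^T v one has |w|^2 = <v, M w>; Young's inequality for [c v] and [M w] then gives 2c
    |w|^2 <= c^2 |v|^2 + c |w|^2. *)
Lemma opb_tr m n c (M : 'M[R]_(m, n)) : 0 < c -> opb c M -> opb c M^T.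
Proof.
move=> c0 hM v; set w := M^T *m v.
have : sqn w = dot v (M *m w) by rewrite dot_trmx.
have := hM w => h1.
have := dot_young (c *: v) (M *m w); rewrite dotZl sqnZ => h2 h3.
rewrite -(@ler_pM2l _ c)//; nra.
Qed.

Lemma opb_norm m n (M : 'M[R]_(m, n)) a : `|M| <= a ->
  opb (m%:R * (n%:R * a) ^+ 2) M.
Proof.
move=> Ma v; rewrite (le_trans (sqn_le_norm _))// -mulrA ler_wpM2l//.
have a0 : 0 <= a by apply: le_trans Ma.
apply: (@le_trans _ _ ((n%:R * a * `|v|) ^+ 2)); last first.
  by rewrite exprMn ler_wpM2l ?sqr_ge0// norm_le_sqn.
rewrite ler_pXn2r ?nnegrE// ?mulr_ge0//.
rewrite mx_norm_le ?mulr_ge0//; apply/forallP => i; apply/forallP => j.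
rewrite mxE (le_trans (ler_norm_sum _ _ _))//.
apply: (@le_trans _ _ (\sum_(k < n) a * `|v|)); last first.
  by rewrite sumr_const card_ord -mulrA mulr_natl.
apply: ler_sum => k _; rewrite normrM ler_pM//; last exact: mx_norm_entry.
by rewrite (le_trans _ Ma)// mx_norm_entry.
Qed.

Lemma dot_opb n c (M : 'M[R]_n) (v : 'cV[R]_n) : opb c M ->
  2 * dot v (M *m v) <= (1 + c) * sqn v.
Proof. by move=> /(_ v) h; have := dot_young v (M *m v); lra. Qed.

Lemma dot_opbN n c (M : 'M[R]_n) (v : 'cV[R]_n) : opb c M ->
  - ((1 + c) * sqn v) <= 2 * dot v (M *m v).
Proof. by move=> /(_ v) h; have := dot_youngN v (M *m v); lra. Qed.

(** A bound on the form becomes a bound on the operator without diagonalization: with y = S x,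
    expand the nonnegative form at y - b x, whose cross terms are - 2b |y|^2. *)
Lemma psd_opb k (S : 'M[R]_k) (b : R) : 0 < b -> S^T = S ->
  (forall x, 0 <= dot x (S *m x)) -> (forall x, dot x (S *m x) <= b * sqn x) ->
  opb (b ^+ 2) S.
Proof.
move=> b0 sS pS hS x; pose y := S *m x.
have yx : dot y (S *m x) = sqn y by [].
have xy : dot x (S *m y) = sqn y by rewrite dot_trmx sS.
have h := pS (y - b *: x).
have {h} : 0 <= dot y (S *m y) - 2 * b * sqn y + b ^+ 2 * dot x (S *m x).
  apply: (le_trans h); rewrite mulmxBr -scalemxAr dotDl !dotDr !dotNl !dotNr.
  by rewrite !dotZl !dotZr yx xy; lra.
have h1 := hS y; have h2 := ler_wpM2l (sqr_ge0 b) (hS x) => h.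
have : b * sqn y <= b * (b ^+ 2 * sqn x) by lra.
by rewrite ler_pM2l.
Qed.

Lemma inj_unitmx k (M : 'M[R]_k) : (forall v : 'cV[R]_k, M *m v = 0 -> v = 0) ->
  M \in unitmx.
Proof.
move=> h; rewrite -unitmx_tr -row_free_unit -kermx_eq0; apply/eqP/row_matrixP => i.
rewrite row0; apply: (can_inj (@trmxK R 1 k)); rewrite trmx0; apply: h.
by rewrite -{1}[M]trmxK -trmx_mul -row_mul mulmx_ker row0 trmx0.
Qed.

End dot_product.

(** * Calculus on closed time windows *)

Section evol.
Context {R : realType}.

(** The derivative is a prescribed function of time rather than a vector field, so that solutions,
    energies and comparison functions obey one calculus. At the end points only one-sided continuity
    is asked. *)
Definition evol {V : normedModType R} (a b : R) (z dz : R -> V) : Prop :=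
  (forall t, a <= t <= b -> z s @[s --> within `[a, b]%classic (nbhs t)] --> z t)
  /\ (forall t, a < t < b -> is_derive t (1 : R) z (dz t)).

Lemma evol_eq {V : normedModType R} (a b : R) (z dz dz' : R -> V) :
  (forall t, a < t < b -> dz t = dz' t) -> evol a b z dz -> evol a b z dz'.
Proof. by move=> e [h1 h2]; split=> // t tab; rewrite -e//; exact: h2. Qed.

Lemma evol_sub {V : normedModType R} (a b c d : R) (z dz : R -> V) :
  a <= c -> d <= b -> evol a b z dz -> evol c d z dz.
Proof.
move=> ac db [h1 h2]; split=> t /andP[ct td].
  apply: cvg_trans (h1 t _); last by rewrite (le_trans ac)// (le_trans td).
  apply: cvg_app; apply: within_subset => // x /=; rewrite !in_itv/= => /andP[cx xd].
  by rewrite (le_trans ac)// (le_trans xd).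
by apply: h2; rewrite (le_lt_trans ac)// (lt_le_trans td).
Qed.

Lemma evol_within {V : normedModType R} (a b : R) (z dz : R -> V) :
  evol a b z dz -> {within `[a, b], continuous z}.
Proof.
move=> [h1 _]; apply/subspace_continuousP => t /=; rewrite in_itv/= => tab.
exact: h1.
Qed.

Lemma evolD {V : normedModType R} (a b : R) (y dy z dz : R -> V) :
  evol a b y dy -> evol a b z dz -> evol a b (fun t => y t + z t) (fun t => dy t + dz t).
Proof.
move=> [h1 h2] [h3 h4]; split=> t tab; first by apply: cvgD; [exact: h1|exact: h3].
exact: is_deriveD (h2 t tab) (h4 t tab).
Qed.

Lemma evolN {V : normedModType R} (a b : R) (y dy : R -> V) :
  evol a b y dy -> evol a b (fun t => - y t) (fun t => - dy t).
Proof.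
move=> [h1 h2]; split=> t tab; first by apply: cvgN; exact: h1.
exact: is_deriveN (h2 t tab).
Qed.

Lemma evolB {V : normedModType R} (a b : R) (y dy z dz : R -> V) :
  evol a b y dy -> evol a b z dz -> evol a b (fun t => y t - z t) (fun t => dy t - dz t).
Proof. by move=> hy hz; apply: evolD => //; exact: evolN. Qed.

Lemma evol_cst {V : normedModType R} (a b : R) (v : V) :
  evol a b (fun=> v) (fun=> 0).
Proof. by split=> t _; [exact: cvg_cst|exact: is_derive_cst]. Qed.

Lemma evolM (a b : R) (y dy z dz : R -> R) :
  evol a b y dy -> evol a b z dz ->
  evol a b (fun t => y t * z t) (fun t => dy t * z t + y t * dz t).
Proof.
move=> [h1 h2] [h3 h4]; split=> t tab; first by apply: cvgM; [exact: h1|exact: h3].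
have := is_deriveM (h2 t tab) (h4 t tab).
by congr is_derive; rewrite /GRing.scale/=; ring.
Qed.

Lemma evol_derive {V : normedModType R} (a b : R) (z dz : R -> V) :
  (forall t : R, is_derive t (1 : R) z (dz t)) -> evol a b z dz.
Proof.
move=> h; split=> t _; last exact: h.
apply: cvg_within_filter; apply/differentiable_continuous/derivable1_diffP.
by have [] := h t.
Qed.

Lemma evol_mulmx {m n p} (a b : R) (y dy : R -> 'M[R]_(m, n))
    (z dz : R -> 'M[R]_(n, p)) :
  evol a b y dy -> evol a b z dz ->
  evol a b (fun t => y t *m z t) (fun t => dy t *m z t + y t *m dz t).
Proof.
move=> [h1 h2] [h3 h4]; split=> t tab.
  by apply: cvg_mulmx; [exact: h1|exact: h3].
by apply: is_derive_mulmx; [exact: h2|exact: h4].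
Qed.

Lemma evol_trmx {m n} (a b : R) (y dy : R -> 'M[R]_(m, n)) :
  evol a b y dy -> evol a b (fun t => (y t)^T) (fun t => (dy t)^T).
Proof.
move=> [h1 h2]; split=> t tab.
  by apply: cvg_trmx; exact: h1.
by apply: is_derive_trmx; exact: h2.
Qed.

Lemma evol_mulmxr {m n p} (a b : R) (y dy : R -> 'M[R]_(m, n)) (v : 'M[R]_(n, p)) :
  evol a b y dy -> evol a b (fun t => y t *m v) (fun t => dy t *m v).
Proof.
move=> h; apply: evol_eq (evol_mulmx h (evol_cst a b v)) => t _.
by rewrite mulmx0 addr0.
Qed.

Lemma evol_mulmxl {m n p} (a b : R) (y dy : R -> 'M[R]_(n, p)) (v : 'M[R]_(m, n)) :
  evol a b y dy -> evol a b (fun t => v *m y t) (fun t => v *m dy t).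
Proof.
move=> h; apply: evol_eq (evol_mulmx (evol_cst a b v) h) => t _.
by rewrite mul0mx add0r.
Qed.

Lemma evol_mxP {m n} (a b : R) (y dy : R -> 'M[R]_(m, n)) :
  evol a b y dy <-> forall i j, evol a b (fun t => y t i j) (fun t => dy t i j).
Proof.
split=> [[h1 h2] i j|h].
  split=> t tab; first by have /cvg_mxP := h1 t tab; exact.
  by have /is_derive_mxP := h2 t tab; exact.
split=> t tab; first by apply/cvg_mxP => i j; have [] := h i j => /(_ t tab).
by apply/is_derive_mxP => i j; have [_] := h i j => /(_ t tab).
Qed.

Lemma evol_dot n (a b : R) (u du v dv : R -> 'cV[R]_n) :
  evol a b u du -> evol a b v dv ->
  evol a b (fun t => dot (u t) (v t)) (fun t => dot (du t) (v t) + dot (u t) (dv t)).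
Proof.
move=> hu hv; have /evol_mxP /(_ 0 0) := evol_mulmx (evol_trmx hu) hv.
by apply: evol_eq => t _; rewrite mxE.
Qed.

Lemma evol_sqn n (a b : R) (u du : R -> 'cV[R]_n) :
  evol a b u du -> evol a b (fun t => sqn (u t)) (fun t => 2 * dot (u t) (du t)).
Proof.
move=> hu; apply: evol_eq (evol_dot hu hu) => t _; rewrite (dotC (du t)); ring.
Qed.

Lemma evol_expR (a b c d : R) :
  evol a b (fun t => expR (c * (t - d))) (fun t => c * expR (c * (t - d))).
Proof.
apply: evol_derive => t.
have h : is_derive t (1 : R) (fun t : R => c * (t - d)) c.
  have := is_deriveZ c (is_deriveB (is_derive_id t (1 : R)) (is_derive_cst d t (1 : R))).
  by congr is_derive; rewrite subr0 /GRing.scale/= mulr1.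
have := @is_derive1_comp R expR (fun t => c * (t - d)) t _ _ (is_derive_expR _) h.
by rewrite mulrC.
Qed.

Lemma evol_affine (a b c d : R) : evol a b (fun t => c * (t - d)) (fun=> c).
Proof.
apply: evol_derive => t.
have := is_deriveZ c (is_deriveB (is_derive_id t (1 : R)) (is_derive_cst d t (1 : R))).
by congr is_derive; rewrite subr0 /GRing.scale/= mulr1.
Qed.

Lemma evol_ndecr (a b : R) (f df : R -> R) : a <= b -> evol a b f df ->
  (forall t, a < t < b -> 0 <= df t) -> f a <= f b.
Proof.
move=> ab hf df0; apply: (@ger0_derive1_le_cc _ f a b) => //.
- by move=> x; rewrite in_itv/= => xab; have [_ /(_ x xab)[]] := hf.
- move=> x; rewrite in_itv/= => xab; have [_ /(_ x xab)[_ e]] := hf.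
  by rewrite derive1E e df0.
- exact: evol_within hf.
- by rewrite in_itv/= lexx ab.
- by rewrite in_itv/= lexx ab.
Qed.

Lemma evol_cst_eq (a b : R) (f df : R -> R) : a <= b -> evol a b f df ->
  (forall t, a < t < b -> df t = 0) -> f a = f b.
Proof.
move=> ab hf df0; apply/eqP; rewrite eq_le; apply/andP; split.
  by apply: (evol_ndecr ab hf) => t /df0 ->.
rewrite -lerN2; apply: (evol_ndecr ab (evolN hf)) => t /df0 ->.
by rewrite oppr0.
Qed.

Lemma evol_cst_eq_mx m n (a b : R) (f df : R -> 'M[R]_(m, n)) :
  a <= b -> evol a b f df -> (forall t, a < t < b -> df t = 0) -> f a = f b.
Proof.
move=> ab /evol_mxP hf df0; apply/matrixP => i j.
by apply: (evol_cst_eq ab (hf i j)) => t /df0 ->; rewrite mxE.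
Qed.

(** The function d (t - a) - f(t) e^(- c (t - a)) is nondecreasing. Using e^(- c (t - a)) <= 1 on
    the constant term avoids a division by [c], so [c = 0] is allowed. *)
Lemma gronwall (a b c d : R) (f df : R -> R) :
  a <= b -> 0 <= c -> 0 <= d -> evol a b f df ->
  (forall t, a < t < b -> df t <= c * f t + d) ->
  f b <= (f a + d * (b - a)) * expR (c * (b - a)).
Proof.
move=> ab c0 d0 hf hd.
have hg := evolB (evol_affine a b d a) (evolM hf (evol_expR a b (- c) a)).
have := evol_ndecr ab hg => /=.
rewrite subrr !mulr0 expR0 mulr1 sub0r => hgg.
have {hgg} h : - f a <= d * (b - a) - f b * expR (- c * (b - a)).
  apply: hgg => t tab; have := hd t tab; have [ta tb] := andP tab.
  set e := expR _ => hdt; have e1 : e <= 1.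
    by rewrite /e -expR0 ler_expR mulNr oppr_le0 mulr_ge0// subr_ge0 ltW.
  have e0 : 0 < e by exact: expR_gt0.
  have := ler_wpM2r (ltW e0) hdt; have := ler_wpM2l d0 e1; lra.
have := expR_gt0 (c * (b - a)); set E := expR (c * (b - a)) => E0.
have EE : E * expR (- c * (b - a)) = 1 by rewrite /E -expRD mulNr subrr expR0.
move: h EE; set E' := expR (- c * (b - a)) => h EE.
rewrite -[leLHS]mulr1 -EE mulrCA [leRHS]mulrC ler_pM2l//; lra.
Qed.

(** Time-reversed form, with the integrating factor normalized at [b]: the initial value is bounded
    by the final one. *)
Lemma gronwall_back (a b c d : R) (f df : R -> R) :
  a <= b -> 0 <= c -> 0 <= d -> evol a b f df ->
  (forall t, a < t < b -> - (c * f t + d) <= df t) ->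
  f a <= (f b + d * (b - a)) * expR (c * (b - a)).
Proof.
move=> ab c0 d0 hf hd.
have hg := evolD (evol_affine a b d b) (evolM hf (evol_expR a b c b)).
have := evol_ndecr ab hg => /=.
rewrite subrr !mulr0 expR0 mulr1 add0r => hgg.
have {hgg} h : d * (a - b) + f a * expR (c * (a - b)) <= f b.
  apply: hgg => t tab; have := hd t tab; have [ta tb] := andP tab.
  set e := expR _ => hdt; have e1 : e <= 1.
    by rewrite /e -expR0 ler_expR mulr_ge0_le0// subr_le0 ltW.
  have e0 : 0 < e by exact: expR_gt0.
  have := ler_wpM2r (ltW e0) hdt; have := ler_wpM2l d0 e1; lra.
have := expR_gt0 (c * (b - a)); set E := expR (c * (b - a)) => E0.
have EE : E * expR (c * (a - b)) = 1.
  by rewrite /E -expRD -mulrDr addrA subrK subrr mulr0 expR0.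
move: h EE; set E' := expR (c * (a - b)) => h EE.
rewrite -[leLHS]mulr1 -EE mulrCA [leRHS]mulrC ler_pM2l//; lra.
Qed.

End evol.

(** * Linear differential equations *)

Section linear_ode.
Context {R : realType}.

(** A mean value inequality in the sup norm, entry by entry: [g] plus or minus each entry of [M] is
    nondecreasing. *)
Lemma evol_norm_le m n (a b : R) (M dM : R -> 'M[R]_(m, n)) (g dg : R -> R) :
  a <= b -> evol a b M dM -> evol a b g dg ->
  (forall t, a < t < b -> `|dM t| <= dg t) -> `|M a| <= g a -> `|M b| <= g b.
Proof.
move=> ab /evol_mxP hM hg hd ha.
have hgb : g a <= g b.
  by apply: (evol_ndecr ab hg) => t /hd; apply: le_trans.
rewrite mx_norm_le; last by rewrite (le_trans _ hgb)// (le_trans _ ha).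
apply/forallP => i; apply/forallP => j.
have haij := le_trans (mx_norm_entry (M a) i j) ha.
have hdij t : a < t < b -> `|dM t i j| <= dg t.
  by move=> /hd; apply: le_trans; exact: mx_norm_entry.
rewrite ler_norml; move: haij; rewrite ler_norml => /andP[ha1 ha2].
apply/andP; split.
- have h : g a + M a i j <= g b + M b i j.
    apply: (evol_ndecr ab (evolD hg (hM i j))) => t /hdij.
    by rewrite ler_norml => /andP[]; lra.
  lra.
- have h : g a - M a i j <= g b - M b i j.
    apply: (evol_ndecr ab (evolB hg (hM i j))) => t /hdij.
    by rewrite ler_norml => /andP[]; lra.
  lra.
Qed.

Lemma mx_norm_mulmx m n p (M : 'M[R]_(m, n)) (N : 'M[R]_(n, p)) :
  `|M *m N| <= n%:R * `|M| * `|N|.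
Proof.
rewrite mx_norm_le ?mulr_ge0//; apply/forallP => i; apply/forallP => j.
rewrite mxE (le_trans (ler_norm_sum _ _ _))//.
apply: (@le_trans _ _ (\sum_(k < n) `|M| * `|N|)); last first.
  by rewrite sumr_const card_ord -mulrA mulr_natl.
by apply: ler_sum => k _; rewrite normrM ler_pM// mx_norm_entry.
Qed.

Lemma primitive_local (f : R -> R) (a N : R) : continuous f -> 0 <= N ->
  exists F : R -> R, F a = 0 /\
    forall x, `|x - a| < N + 1 -> is_derive x (1 : R) F (f x).
Proof.
move=> cf N0; pose G x := (\int[@lebesgue_measure R]_(t in `[(a - N - 1)%R, x]) f t)%R.
have hG x : `|x - a| < N + 1 -> is_derive x (1 : R) G (f x).
  rewrite ltr_norml => /andP[x1 x2].
  have [||||dG GE] := @continuous_FTC1_closed R f (a - N - 1) x (a + N + 2).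
  - by lra.
  - apply: continuous_compact_integrable; first exact: segment_compact.
    exact: continuous_subspaceT.
  - by lra.
  - exact: cf.
  by apply: DeriveDef; [exact: dG|rewrite -GE derive1E].
exists (fun x => G x - G a); split=> [|x /hG hx]; first exact: subrr.
have := is_deriveB hx (is_derive_cst (G a) x (1 : R)).
by rewrite subr0.
Qed.

(** Local primitives [G N] on the balls of radius [N + 1] all vanish at [a], hence agree where they
    overlap; at [x] the one with [N = |x - a|] is read off. The extra unit of radius leaves room for
    a neighbourhood of [x]. *)
Lemma primitive_exists (f : R -> R) (a : R) : continuous f ->
  exists F : R -> R, F a = 0 /\ forall x, is_derive x (1 : R) F (f x).
Proof.
move=> cf.
have /choice[G hG] : forall N : R, exists F : R -> R, 0 <= N -> F a = 0 /\
    forall x, `|x - a| < N + 1 -> is_derive x (1 : R) F (f x).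
  move=> N; have [N0|N0] := leP 0 N; last by exists (fun=> 0).
  by have [F hF] := primitive_local a cf N0; exists F.
have agree (N : R) x : `|x - a| <= N -> G `|x - a| x = G N x.
  move=> xN; have [G1 dG1] := hG `|x - a| (normr_ge0 _).
  have [G2 dG2] := hG N (le_trans (normr_ge0 _) xN).
  pose D y := G `|x - a| y - G N y.
  have dD y : `|y - a| <= `|x - a| -> is_derive y (1 : R) D 0.
    move=> yx; rewrite -(subrr (f y)).
    by apply: is_deriveB; [apply: dG1|apply: dG2]; lra.
  have cD y : `|y - a| <= `|x - a| -> {for y, continuous D}.
    move=> /dD [h _]; exact/differentiable_continuous/derivable1_diffP.
  have evD c d : (forall y, c <= y <= d -> `|y - a| <= `|x - a|) -> evol c d D (fun=> 0).
    move=> h; split=> t; last by move=> /andP[? ?]; apply/dD/h; rewrite !ltW.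
    by move=> /h /cD; exact: cvg_within_filter.
  suff : D x = D a by rewrite /D G1 G2; lra.
  have [xa|ax] := leP x a.
    apply: (@evol_cst_eq R x a D (fun=> 0)) => //; apply: evD => y /andP[y1 y2].
    by rewrite !ler0_norm; lra.
  apply/esym; apply: (@evol_cst_eq R a x D (fun=> 0)) => //; first exact: ltW.
  apply: evD => y /andP[y1 y2].
  by rewrite !ger0_norm; lra.
exists (fun x => G `|x - a| x); split.
  by rewrite subrr normr0; have [] := hG 0 (lexx _).
move=> x; have xN : 0 <= `|x - a| + 1 by rewrite addr_ge0.
have [_ /(_ x) h] := hG (`|x - a| + 1) xN.
have {}h : is_derive x (1 : R) (G (`|x - a| + 1)) (f x).
  apply: h; lra.
suff e : \forall y \near x, G (`|x - a| + 1) y = G `|y - a| y.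
  exact: near_eq_is_derive e h.
near=> y; apply/esym/agree.
have : `|y - x| < 1.
  by rewrite distrC; near: y; exact: cvgr_dist_lt.
have := ler_normD (y - x) (x - a); rewrite addrA subrK; lra.
Unshelve. all: by end_near. Qed.

Lemma primitive_mx m n (f : R -> 'M[R]_(m, n)) (a : R) (V : 'M[R]_(m, n)) :
  continuous f ->
  exists F : R -> 'M[R]_(m, n), F a = V /\ forall x, is_derive x (1 : R) F (f x).
Proof.
move=> cf.
have h i j : exists F : R -> R, F a = 0 /\ forall x, is_derive x (1 : R) F (f x i j).
  apply: (primitive_exists a (f := fun x => f x i j)) => x.
  by have /cvg_mxP := cf x; exact.
have /choice[F1] : forall i, exists F : 'I_n -> R -> R,
    forall j, F j a = 0 /\ forall x, is_derive x (1 : R) (F j) (f x i j).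
  by move=> i; have /choice[F hF] := h i; exists F.
move=> hF; exists (fun x => \matrix_(i, j) F1 i j x + V); split.
  by apply/matrixP => i j; rewrite !mxE (hF i j).1 add0r.
move=> x; rewrite -[f x]addr0; apply: is_deriveD.
by apply/is_derive_mxP => i j; under eq_fun do rewrite mxE; exact: (hF i j).2.
Qed.

(** The sequences [v] and [w] are nondecreasing and nonincreasing with [v] below [w], so the
    supremum of [v] lies between them at every index. This yields the limit together with its
    rate. *)
Lemma geometric_limit (u : nat -> R) (C : R) :
  (forall k, `|u k.+1 - u k| <= C / 2 ^+ k) ->
  exists l, forall k, `|u k - l| <= 2 * C / 2 ^+ k.
Proof.
move=> hu.
have C0 : 0 <= C by have := hu 0; rewrite expr0 divr1; apply: le_trans.
pose v k := u k - 2 * C / 2 ^+ k; pose w k := u k + 2 * C / 2 ^+ k.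
have half k : 2 * C / 2 ^+ k.+1 = C / 2 ^+ k.
  rewrite exprS; field; rewrite expf_neq0//.
have two k : 2 * C / 2 ^+ k = 2 * (C / 2 ^+ k) by rewrite mulrA.
have v1 k : v k <= v k.+1.
  have := hu k; rewrite ler_norml /v half two => /andP[]; lra.
have w1 k : w k.+1 <= w k.
  have := hu k; rewrite ler_norml /w half two => /andP[]; lra.
have vm j k : (j <= k)%N -> v j <= v k.
  by apply: (homo_leq (@lexx _ _) (@le_trans _ _)) => i; exact: v1.
have wm j k : (j <= k)%N -> w k <= w j.
  elim: k => [|k IH]; first by rewrite leqn0 => /eqP ->.
  by rewrite leq_eqVlt => /predU1P[->//|/IH]; exact: le_trans.
have vw k : v k <= w k.
  by rewrite /v /w lerBlDr -addrA lerDl addr_ge0// divr_ge0// ?mulr_ge0// exprn_ge0.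
have vwjk j k : v j <= w k.
  have := vm j (maxn j k) (leq_maxl _ _); have := wm k (maxn j k) (leq_maxr _ _).
  by have := vw (maxn j k); lra.
have ub k : ubound (range v) (w k) by move=> _ [j _ <-].
have hs : has_sup (range v) by split; [exists (v 0), 0 | exists (w 0)].
exists (sup (range v)) => k.
have h1 : v k <= sup (range v) by apply: ub_le_sup; [exists (w 0)|exists k].
have h2 : sup (range v) <= w k by apply: ge_sup => //; exists (v 0), 0.
by move: h1 h2; rewrite /v /w ler_norml => *; apply/andP; split; lra.
Qed.

Lemma le0_of_geometric (x c : R) : (forall k, x <= c / 2 ^+ k) -> x <= 0.
Proof.
move=> h; rewrite leNgt; apply/negP => x0.
have [k hk] : exists k : nat, c / x < k%:R.
  by exists (Num.truncn (c / x)).+1; exact: truncnS_gt.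
have := h k; rewrite leNgt => /negP; apply.
rewrite ltr_pdivrMr ?exprn_gt0// mulrC -ltr_pdivrMr//.
apply: (lt_trans hk); rewrite -natrX ltr_nat; exact: ltn_expl.
Qed.

End linear_ode.

(** * Picard iteration and fundamental matrices *)

Section picard.
Context {R : realType}.

Lemma continuous_of_derive (V : normedModType R) (f df : R -> V) :
  (forall t : R, is_derive t (1 : R) f (df t)) -> continuous f.
Proof.
by move=> h t; apply/differentiable_continuous/derivable1_diffP; have [] := h t.
Qed.

Lemma small_geometric (c e : R) : 0 < e -> exists k : nat, c / 2 ^+ k <= e.
Proof.
move=> e0; apply: contrapT => /forallNP h.
suff : e <= 0 by rewrite leNgt e0.
apply: (@le0_of_geometric _ _ c) => k; rewrite leNgt; apply/negP => hk.
by apply: (h k); exact: ltW.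
Qed.

Lemma exp_small (r e : R) : 0 <= r -> r < 1 -> 0 < e -> exists m : nat, r ^+ m <= e.
Proof.
move=> r0 r1 e0; have : `|r| < 1 by rewrite ger0_norm.
move=> /cvg_expr /cvgrPdist_le /(_ e e0) [m _ hm]; exists m.
by have := hm m (leqnn m); rewrite sub0r normrN ger0_norm// exprn_ge0.
Qed.

(** Precomposition with this retraction onto [a, b] extends a function continuous on the window to
    one continuous on the whole line, where primitives are available. *)
Definition clamp (a b t : R) : R := Num.max a (Num.min b t).

Lemma clamp_continuous a b : continuous (clamp a b).
Proof.
move=> t; apply: (@continuous_max R R (cst a) (fun t => Num.min b t)).
  exact: cvg_cst.
by apply: (@continuous_min R R (cst b) id); [exact: cvg_cst|exact: cvg_id].
Qed.

Lemma clamp_in a b t : a <= b -> a <= clamp a b t <= b.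
Proof. by move=> ab; rewrite /clamp le_max lexx/= ge_max ab ge_min lexx. Qed.

Lemma clamp_id a b t : a <= t <= b -> clamp a b t = t.
Proof. by move=> /andP[at1 tb]; rewrite /clamp min_r// max_r. Qed.

Lemma clamp_continuousW {T : topologicalType} (a b : R) (f : R -> T) : a <= b ->
  {within `[a, b], continuous f} -> continuous (f \o clamp a b).
Proof.
move=> ab /subspace_continuousP cf t.
have := cf (clamp a b t); rewrite /= in_itv/= clamp_in// => /(_ isT) h.
apply: cvg_comp h => U hU.
have := @clamp_continuous a b t _ hU.
by apply: (@filterS _ (nbhs t)) => s /=; apply; rewrite in_itv/= clamp_in.
Qed.

(** Picard iteration in an exponentially weighted norm: relative to [E], with rate twice the
    Lipschitz constant [al], each increment is at most half the preceding one, whatever the length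
    of the window. *)
Lemma picard n m (A : R -> 'M[R]_n) (V : 'M[R]_(n, m)) (a b K : R) :
  a <= b -> continuous A -> (forall t, `|A t| <= K) ->
  exists Y : R -> 'M[R]_(n, m), Y a = V /\ evol a b Y (fun t => A t *m Y t).
Proof.
move=> ab cA AK.
have K0 : 0 <= K by apply: le_trans (AK a).
(* The factor [n] comes from the sup norm of a matrix product; [+ 1] keeps [al] positive. *)
pose al : R := n%:R * K + 1; have al0 : 0 < al by rewrite ltr_wpDl ?mulr_ge0.
have hal t (M : 'M[R]_(n, m)) : `|A t *m M| <= al * `|M|.
  rewrite (le_trans (mx_norm_mulmx _ _))// ler_wpM2r//.
  by rewrite /al (@le_trans _ _ (n%:R * K)) ?lerDl// ler_wpM2l.
have cAM (Z : R -> 'M[R]_(n, m)) : continuous Z -> continuous (fun t => A t *m Z t).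
  by move=> cZ t; apply: cvg_mulmx; [exact: cA|exact: cZ].
(* One primitive with value [V] at [a] is chosen for each continuous [f], so that the iteration is a
   plain function; discontinuous [f] get a dummy value. *)
have /choice[prim hprim] : forall f : R -> 'M[R]_(n, m), exists F, continuous f ->
    F a = V /\ forall x, is_derive x (1 : R) F (f x).
  move=> f; have [cf|ncf] := pselect (continuous f); last by exists f.
  by have [F hF] := primitive_mx a V cf; exists F.
pose Z k := iter k (fun Z => prim (fun t => A t *m Z t)) (fun=> 0).
have cZ k : continuous (Z k).
  elim: k => [|k IH]; first by move=> t; exact: cvg_cst.
  by have [_ h] := hprim _ (cAM _ IH); exact: continuous_of_derive h.
have Za k : Z k.+1 a = V by have [] := hprim _ (cAM _ (cZ k)).
have dZ k x : is_derive x (1 : R) (Z k.+1) (A x *m Z k x).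
  by have [_] := hprim _ (cAM _ (cZ k)).
pose E t : R := expR (2 * al * (t - a)).
have hZ k t : a <= t -> `|Z k.+1 t - Z k t| <= `|V| / 2 ^+ k * E t.
  elim: k t => [|k IH] t at1.
    have hg := evolM (evol_cst a t (`|V| / 2 ^+ 0)) (evol_expR a t (2 * al) a).
    have hM := evol_derive a t (dZ 0).
    rewrite subr0; apply: (evol_norm_le at1 hM hg) => [s _|].
      rewrite /= mulmx0 normr0 mul0r add0r !mulr_ge0 ?invr_ge0 ?exprn_ge0 ?expR_ge0//.
      exact: ltW.
    by rewrite Za subrr mulr0 expR0 expr0 divr1 mulr1.
  have hg := evolM (evol_cst a t (`|V| / 2 ^+ k.+1)) (evol_expR a t (2 * al) a).
  have hM := evolB (evol_derive a t (dZ k.+1)) (evol_derive a t (dZ k)).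
  apply: (evol_norm_le at1 hM hg) => [s /andP[sa st]|].
    rewrite -mulmxBr (le_trans (hal _ _))// mul0r add0r.
    have := IH s (ltW sa); rewrite -(ler_pM2l al0) => /le_trans; apply.
    rewrite exprS le_eqVlt; apply/orP; left; apply/eqP.
    by rewrite /E; field; rewrite expf_neq0.
  by rewrite !Za subrr normr0 mulr_ge0 ?expR_ge0// divr_ge0// exprn_ge0.
pose c : R := 2 * (`|V| * E b).
have hE t : a <= t <= b -> E t <= E b.
  by move=> /andP[at1 tb]; rewrite ler_expR ler_wpM2l ?lerD2r// mulr_ge0// ltW.
have Eb0 : 0 <= E b by exact: expR_ge0.
have c0 : 0 <= c by rewrite /c !mulr_ge0.
have /choice[L hL] : forall t, exists L : 'M[R]_(n, m), a <= t <= b ->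
    forall k, `|Z k t - L| <= c / 2 ^+ k.
  move=> t; have [tab|tab] := boolP (a <= t <= b); last by exists 0.
  have h i j : exists l, forall k, `|Z k t i j - l| <= c / 2 ^+ k.
    apply: geometric_limit => k; have /andP[at1 tb] := tab.
    have := mx_norm_entry (Z k.+1 t - Z k t) i j; rewrite !mxE => /le_trans; apply.
    rewrite (le_trans (hZ k t at1))// mulrAC ler_wpM2r ?invr_ge0 ?exprn_ge0//.
    by rewrite ler_wpM2l// hE.
  have /choice[L hL] : forall i, exists f : 'I_m -> R,
      forall j k, `|Z k t i j - f j| <= c / 2 ^+ k.
    by move=> i; have /choice[f hf] := h i; exists f.
  exists (\matrix_(i, j) L i j) => _ k.
  rewrite mx_norm_le ?divr_ge0 ?exprn_ge0//.
  by apply/forallP => i; apply/forallP => j; rewrite !mxE.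
pose Lc t := L (clamp a b t).
have cL : continuous Lc.
  move=> t; apply/cvgrPdist_le => e e0.
  have e3 : 0 < e / 3 by rewrite divr_gt0.
  have [k hk] := small_geometric c e3.
  have : (Z k \o clamp a b) s @[s --> t] --> (Z k \o clamp a b) t.
    by apply: continuous_comp; [exact: clamp_continuous|exact: cZ].
  move=> /cvgrPdist_le /(_ _ e3); apply: filterS => s /= hs.
  have h1 := le_trans (hL _ (clamp_in t ab) k) hk.
  have h2 := le_trans (hL _ (clamp_in s ab) k) hk.
  rewrite distrC in h1.
  have -> : Lc t - Lc s = (Lc t - Z k (clamp a b t)) +
     (Z k (clamp a b t) - Z k (clamp a b s)) + (Z k (clamp a b s) - Lc s).
    by rewrite !subrKA.
  apply: (le_trans (ler_normD _ _)).
  have := ler_normD (Lc t - Z k (clamp a b t)) (Z k (clamp a b t) - Z k (clamp a b s)).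
  by move: h1 h2 hs; rewrite /Lc; lra.
(* The limit [L] is known only pointwise on [a, b]. A primitive of [A Lc] is differentiable by
   construction, and it coincides with [L] on the window. *)
have [Y [Ya dY]] := primitive_mx a V (cAM _ cL).
have LY t : a <= t <= b -> L t = Y t.
  move=> /[dup] tab /andP[at1 tb]; apply/eqP; rewrite -subr_eq0 -normr_le0.
  apply: (@le0_of_geometric _ _ (c + al * c * (b - a))) => k.
  have hg := evol_affine a t (al * (c / 2 ^+ k)) a.
  have hM := evolB (evol_derive a t (dZ k)) (evol_derive a t dY).
  have h := evol_norm_le at1 hM hg.
  have {}h : `|Z k.+1 t - Y t| <= al * (c / 2 ^+ k) * (t - a).
    apply: h => [s /andP[sa st]|]; last by rewrite Za Ya !subrr normr0 mulr0.
    have sab : a <= s <= b by rewrite ltW//= (le_trans (ltW st)).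
    by rewrite -mulmxBr (le_trans (hal _ _))// ler_pM2l// /Lc clamp_id// hL.
  rewrite (_ : L t - Y t = (L t - Z k.+1 t) + (Z k.+1 t - Y t)); last first.
    by rewrite addrA subrK.
  rewrite (le_trans (ler_normD _ _))//.
  have h1 : `|L t - Z k.+1 t| <= c / 2 ^+ k.
    rewrite distrC (le_trans (hL t tab k.+1))// ler_wpM2l//.
    by rewrite lef_pV2 ?posrE ?exprn_gt0// ler_eXn2l// ltr1n.
  have h2 : al * (c / 2 ^+ k) * (t - a) <= al * c * (b - a) / 2 ^+ k.
    rewrite mulrA mulrAC ler_wpM2r ?invr_ge0 ?exprn_ge0// ler_wpM2l// ?mulr_ge0 ?(ltW al0)//.
    by rewrite lerD2r.
  by rewrite mulrDl; lra.
exists Y; split=> //; apply: evol_eq (evol_derive a b dY) => t /andP[ta tb].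
by rewrite /Lc clamp_id ?ltW// LY ?ltW.
Qed.

Lemma within_continuous_bounded m n (A : R -> 'M[R]_(m, n)) (a b : R) : a <= b ->
  {within `[a, b], continuous A} -> exists K, forall t, a <= t <= b -> `|A t| <= K.
Proof.
move=> ab cA.
have : {within `[a, b], continuous (fun t => `|A t|)}.
  by move=> t; apply: cvg_norm; exact: cA.
move=> /(EVT_max ab)[c _ h]; exists `|A c| => t tab; apply: h.
by rewrite in_itv.
Qed.

Lemma linear_ode_exists n m (A : R -> 'M[R]_n) (V : 'M[R]_(n, m)) (a b : R) :
  a <= b -> {within `[a, b], continuous A} ->
  exists Y : R -> 'M[R]_(n, m), Y a = V /\ evol a b Y (fun t => A t *m Y t).
Proof.
move=> ab cA; have [K hK] := within_continuous_bounded ab cA.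
have [|Y [Ya dY]] := picard V ab (clamp_continuousW ab cA) (K := K).
  by move=> t; exact/hK/clamp_in.
exists Y; split=> //; apply: evol_eq dY => t /andP[ta tb] /=.
by rewrite clamp_id// !ltW.
Qed.

(** [G] is the transpose of a solution of the adjoint equation, so [G Z] is constant and equal to 1:
    the inverse is obtained together with its own differential equation. *)
Lemma fundamental_matrix n (A : R -> 'M[R]_n) (a b : R) :
  a <= b -> {within `[a, b], continuous A} ->
  exists Z G : R -> 'M[R]_n, [/\ evol a b Z (fun t => A t *m Z t),
    evol a b G (fun t => - (G t *m A t)) &
    forall t, a <= t <= b -> G t *m Z t = 1%:M].
Proof.
move=> ab cA; have [Z [Za dZ]] := linear_ode_exists (1%:M : 'M[R]_n) ab cA.
have cA' : {within `[a, b], continuous (fun t => - (A t)^T)}.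
  by move=> t; apply: cvgN; apply: cvg_trmx; exact: cA.
have [H [Ha dH]] := linear_ode_exists (1%:M : 'M[R]_n) ab cA'.
have dG : evol a b (fun t => (H t)^T) (fun t => - ((H t)^T *m A t)).
  apply: evol_eq (evol_trmx dH) => t _.
  by rewrite trmx_mul linearN/= trmxK mulmxN.
exists Z, (fun t => (H t)^T); split=> // t /andP[at1 tb].
have := evol_mulmx (evol_sub (lexx a) tb dG) (evol_sub (lexx a) tb dZ).
move=> /(evol_cst_eq_mx at1) <- => [|s _].
  by rewrite Ha Za trmx1 mulmx1.
by rewrite mulNmx mulmxA addNr.
Qed.

End picard.

(** * Perturbed and nonlinear equations *)

Section perturbation.
Context {R : realType}.

(** In the rate [2 + a], Young's inequality gives [1 + a] for the linear term, and the remaining 1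
    together with [c] for the forcing. *)
Lemma linear_growth n (S : R -> 'M[R]_n) (x g : R -> 'cV[R]_n) (s t a c : R) :
  s <= t -> 0 <= a -> 0 <= c -> (forall r, s < r < t -> opb a (S r)) ->
  evol s t x (fun r => S r *m x r + g r) ->
  (forall r, s < r < t -> sqn (g r) <= c) ->
  sqn (x t) <= (sqn (x s) + c * (t - s)) * expR ((2 + a) * (t - s)).
Proof.
move=> st a0 c0 hS hx hg; apply: (gronwall st _ c0 (evol_sqn hx)).
  by rewrite addr_ge0.
move=> r rst; rewrite dotDr mulrDr.
have := dot_opb (x r) (hS r rst); have := dot_young (x r) (g r).
have := hg r rst; lra.
Qed.

Lemma linear_growth_back n (S : R -> 'M[R]_n) (x : R -> 'cV[R]_n) (s t a : R) :
  s <= t -> 0 <= a -> (forall r, s < r < t -> opb a (S r)) ->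
  evol s t x (fun r => S r *m x r) ->
  sqn (x s) <= sqn (x t) * expR ((1 + a) * (t - s)).
Proof.
move=> st a0 hS hx.
have := @gronwall_back R s t (1 + a) 0 _ _ st _ (lexx _) (evol_sqn hx).
rewrite mul0r addr0; apply; first by rewrite addr_ge0.
by move=> r rst; rewrite addr0; apply/dot_opbN/hS.
Qed.

(** The solution is compared with the unperturbed one from the same state. Their difference starts
    at 0 and is driven by [g] alone; the factors 2 come from splitting the squared norm of a sum. *)
Lemma perturbed_contraction n (S : R -> 'M[R]_n) (x g : R -> 'cV[R]_n)
    (s t a c k : R) :
  s <= t -> 0 <= a -> 0 <= c -> (forall r, s < r < t -> opb a (S r)) ->
  {within `[s, t], continuous S} ->
  (forall y : R -> 'cV[R]_n, evol s t y (fun r => S r *m y r) ->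
     sqn (y t) <= k * sqn (y s)) ->
  evol s t x (fun r => S r *m x r + g r) ->
  (forall r, s < r < t -> sqn (g r) <= c) ->
  sqn (x t) <= 2 * k * sqn (x s) + 2 * (c * (t - s)) * expR ((2 + a) * (t - s)).
Proof.
move=> st a0 c0 hS cS hk hx hg.
have [y [ys dy]] := linear_ode_exists (x s) st cS.
have dd : evol s t (fun r => x r - y r) (fun r => S r *m (x r - y r) + g r).
  by apply: evol_eq (evolB hx dy) => r _; rewrite mulmxBr addrAC.
have := linear_growth st a0 c0 hS dd hg.
rewrite ys subrr sqn0 add0r => h1.
have := hk y dy; rewrite ys => h2.
have := sqnD_le (y t) (x t - y t); rewrite addrC subrK; lra.
Qed.

(** Continuous induction: at the infimum of the times where [f >= r], the hypothesis gives [f < r],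
    and continuity extends this to the right, against the definition of the infimum. *)
Lemma first_exit (f df : R -> R) (s t r : R) : s <= t -> evol s t f df ->
  (forall x, s <= x <= t -> (forall y, s <= y < x -> f y < r) -> f x < r) ->
  f t < r.
Proof.
move=> st [cf _] hP; rewrite ltNge; apply/negP => ft.
pose A := [set x | s <= x <= t /\ r <= f x].
have A0 : A !=set0 by exists t; split=> //; rewrite st lexx.
have Alb : has_lbound A by exists s => x [/andP[]].
have Ainf : has_inf A by [].
have ub : inf A <= t by apply: ge_inf => //; split=> //; rewrite st lexx.
have lb : s <= inf A by apply: lb_le_inf => // x [/andP[]].
have finf : f (inf A) < r.
  apply: hP => [|y /andP[sy yA]]; first by rewrite lb.
  rewrite ltNge; apply/negP => ry.
  have : inf A <= y.
    by apply: ge_inf => //; split=> //; rewrite sy/= (le_trans (ltW yA)).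
  by rewrite leNgt yA.
have := cf (inf A); rewrite lb ub => /(_ isT) /cvgrPdist_lt /(_ (r - f (inf A))).
rewrite subr_gt0 => /(_ finf); rewrite /prop_near1 /within/= => -[e /= e0 he].
have [x [/andP[sx xt] rx] xe] := inf_adherent e0 Ainf.
have Ax : inf A <= x by apply: ge_inf => //; split=> //; rewrite sx.
have := he x; rewrite /ball/= ltr_distlC in_itv/= sx xt => /(_ _ isT) h.
have : `|f (inf A) - f x| < r - f (inf A).
  by apply: h; apply/andP; split; lra.
by rewrite ltr_norml => /andP[]; lra.
Qed.

(** Rounding the exponent down costs one factor 2. *)
Lemma half_power_le (x : R) : 0 <= x ->
  (1 / 2) ^+ (Num.truncn x) <= 2 * expR (- ln 2 * x).
Proof.
move=> x0; have /andP[j1 j2] := truncn_itv x0.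
have l2 : 0 < ln (2 : R) by rewrite ln_gt0// ltr1n.
apply: (@le_trans _ _ (2 * expR (- ln 2 * (Num.truncn x).+1%:R))); last first.
  by rewrite ler_pM2l// ler_expR !mulNr lerN2 ler_pM2l// ltW.
rewrite mulNr expRN expRM_natr lnK ?posrE// exprS.
rewrite le_eqVlt; apply/orP; left; apply/eqP.
by rewrite div1r exprVn; field; rewrite expf_neq0.
Qed.

(** Halving of [W] starts after one window, since [s0 <= T], and keeps [q] below [th] at the grid
    points. In [4 * mu * G ^+ 2], the first window costs [mu * G] and the last incomplete one [G];
    one 2 comes from the index shift, the other from rounding the number of windows down. *)
Lemma discrete_decay (q W : R -> R) (t0 Te T s0 th G mu : R) :
  0 <= t0 -> 0 < T -> s0 <= T -> 1 <= G -> 1 <= mu ->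
  (forall t, 0 <= q t) -> (forall t, q t <= W t) -> (forall t, W t <= mu * q t) ->
  (forall s t, t0 <= s -> s <= t -> t <= s + T -> t < Te -> q s <= th ->
     q t <= G * q s) ->
  (forall s, t0 <= s -> s0 <= s -> s + T < Te -> q s <= th ->
     W (s + T) <= 1 / 2 * W s) ->
  mu * G * q t0 <= th ->
  forall t, t0 <= t < Te ->
    q t <= 4 * mu * G ^+ 2 * q t0 * expR (- (ln 2 / T) * (t - t0)).
Proof.
move=> t00 T0 s0T G1 mu1 q0 qW Wq hG hW hth t /andP[tt tTe].
have muG1 : 1 <= mu * G by nra.
have q0th : q t0 <= th.
  by apply: le_trans hth; rewrite ler_peMl.
pose s j := t0 + j%:R * T.
have sS j : s j.+1 = s j + T by rewrite /s -addn1 natrD; ring.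
have s0E : s 0 = t0 by rewrite /s mul0r addr0.
have st0 j : t0 <= s j by rewrite /s lerDl mulr_ge0// ltW.
have step1 : s 1 < Te -> W (s 1) <= mu * G * q t0.
  move=> s1; rewrite (le_trans (Wq _))// -mulrA ler_wpM2l ?(le_trans _ mu1)//.
  apply: hG => //; first by rewrite sS s0E.
have claim j : s j.+1 < Te -> W (s j.+1) <= (1 / 2) ^+ j * (mu * G * q t0).
  elim: j => [|j IH] hj; first by rewrite expr0 mul1r; exact: step1.
  have hj' : s j.+1 < Te by apply: lt_trans hj; rewrite (sS j.+1) ltrDl.
  have h := IH hj'.
  have hp : (1 / 2 : R) ^+ j <= 1 by rewrite exprn_ile1//; lra.
  have hW1 : W (s j.+1) <= th.
    apply: (le_trans h); apply: le_trans hth.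
    by rewrite ler_piMl// mulr_ge0//; lra.
  rewrite (sS j.+1) (le_trans (hW _ _ _ _ _))//.
  - by rewrite (sS j) /s; have := mulr_ge0 (ler0n R j) (ltW T0); lra.
  - by rewrite -sS.
  - exact: le_trans (qW _) hW1.
  - by rewrite exprS -[leRHS]mulrA ler_pM2l//.
have claim' j : s j < Te -> q (s j) <= 2 * (1 / 2) ^+ j * (mu * G * q t0).
  case: j => [|j] hj.
    have := ler_peMl (q0 t0) muG1; rewrite s0E expr0; have := q0 t0; nra.
  apply: (le_trans (qW _)); apply: (le_trans (claim j hj)).
  by rewrite exprS le_eqVlt; apply/orP; left; apply/eqP; field.
pose x := (t - t0) / T; pose j := Num.truncn x.
have x0 : 0 <= x by rewrite divr_ge0 ?subr_ge0// ltW.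
have /andP[j1 j2] := truncn_itv x0.
have sjt : s j <= t.
  by move: j1; rewrite /x ler_pdivlMr// -/j /s; lra.
have tsj : t <= s j + T.
  by rewrite -sS /s; move: j2; rewrite /x ltr_pdivrMr// -/j; lra.
have hj := claim' j (le_lt_trans sjt tTe).
have hq : q (s j) <= th.
  case: (j) sjt => [|i] hi; first by rewrite s0E.
  apply: (le_trans (qW _)); have hi' := le_lt_trans hi tTe.
  apply: (le_trans (claim _ hi')); apply: le_trans hth.
  rewrite ler_piMl ?mulr_ge0//; [lra|lra|].
  by rewrite exprn_ile1//; lra.
apply: (le_trans (hG _ _ (st0 j) sjt tsj tTe hq)).
have hp := half_power_le x0; rewrite -/j in hp.
have -> : - (ln 2 / T) * (t - t0) = - ln 2 * x by rewrite /x; ring.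
set E := expR _ in hp *; set P := (1 / 2) ^+ j in hj hp.
have c0 : 0 <= 2 * (mu * G * q t0) by rewrite !mulr_ge0//; lra.
have := ler_wpM2l c0 hp; have G0 : 0 <= G by lra.
move=> h; apply: (@le_trans _ _ (G * (2 * P * (mu * G * q t0)))).
  by rewrite ler_wpM2l.
rewrite (_ : 4 * mu * G ^+ 2 * q t0 * E = G * (2 * (mu * G * q t0) * (2 * E))); last by ring.
by rewrite ler_wpM2l//; lra.
Qed.

End perturbation.

(** * Stability of the perturbed cascade *)

Section cascade.
Context {R : realType}.

Lemma is_sol_evol {V : normedModType R} (F : R -> V -> V) (t0 Te s t : R) z :
  is_sol F `[t0, Te[ z -> t0 <= s -> t < Te -> evol s t z (fun r => F r (z r)).
Proof.
move=> [cz dz] t0s tTe; split=> r /andP[sr rt].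
  have /subspace_continuousP /(_ r) h := cz.
  apply: cvg_trans (h _); last first.
    by rewrite /= in_itv/= (le_trans t0s)//= (le_lt_trans rt).
  apply: cvg_app; apply: within_subset => x /=; rewrite !in_itv/= => /andP[sx xt].
  by rewrite (le_trans t0s)//= (le_lt_trans xt).
apply: dz; rewrite interior_itv_bnd /= in_itv/=.
by rewrite (le_lt_trans t0s)//= (lt_trans rt).
Qed.

Lemma is_sol_evoly {V : normedModType R} (F : R -> V -> V) (t0 s t : R) z :
  is_sol F `[t0, +oo[ z -> t0 <= s -> evol s t z (fun r => F r (z r)).
Proof.
move=> [cz dz] t0s; split=> r /andP[sr rt].
  have /subspace_continuousP /(_ r) h := cz.
  apply: cvg_trans (h _); last by rewrite /= in_itv/= (le_trans t0s).
  apply: cvg_app; apply: within_subset => x /=; rewrite !in_itv/= => /andP[sx xt].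
  by rewrite (le_trans t0s).
by apply: dz; rewrite interior_itv_bndy /= in_itv/= (le_lt_trans t0s).
Qed.

Lemma within_sub_itvy {T : topologicalType} (f : R -> T) (a s t : R) : a <= s ->
  {within `[a, +oo[, continuous f} -> {within `[s, t], continuous f}.
Proof.
move=> as0; apply: continuous_subspaceW => x /=; rewrite !in_itv/= => /andP[sx _].
by rewrite (le_trans as0).
Qed.

Lemma evol_usubmx m n (a b : R) (z dz : R -> 'cV[R]_(m + n)) :
  evol a b z dz -> evol a b (fun t => usubmx (z t)) (fun t => usubmx (dz t)).
Proof.
move=> /evol_mxP h; apply/evol_mxP => i j.
have := h (lshift n i) j; congr evol; by apply/funext => t; rewrite mxE.
Qed.

Lemma evol_dsubmx m n (a b : R) (z dz : R -> 'cV[R]_(m + n)) :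
  evol a b z dz -> evol a b (fun t => dsubmx (z t)) (fun t => dsubmx (dz t)).
Proof.
move=> /evol_mxP h; apply/evol_mxP => i j.
have := h (rshift m i) j; congr evol; by apply/funext => t; rewrite mxE.
Qed.

(* Exponential stability of [y' = S y] in discrete form, for initial times at least [s0]. *)
Definition contracts {n} (S : R -> 'M[R]_n) (s0 : R) : Prop :=
  forall k : R, 0 < k -> exists2 T0, 0 < T0 & forall T s (y : R -> 'cV[R]_n),
    T0 <= T -> s0 <= s -> evol s (s + T) y (fun r => S r *m y r) ->
    sqn (y (s + T)) <= k * sqn (y s).

Lemma sqn_split m n (z : 'cV[R]_(m + n)) : sqn z = sqn (usubmx z) + sqn (dsubmx z).
Proof. by rewrite -[in LHS](vsubmxK z) sqn_col_mx. Qed.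

(** [1 + c * m] stands in for the square root of [c * m], and the rate is halved. *)
Lemma decay_of_sqr n (u v : 'cV[R]_n) (m c l x : R) : 0 <= m -> 0 <= c ->
  sqn v <= m * `|v| ^+ 2 -> sqn u <= c * sqn v * expR (- l * x) ->
  `|u| <= (1 + c * m) * `|v| * expR (- (l / 2) * x).
Proof.
move=> m0 c0 hv hu; have cm0 := mulr_ge0 c0 m0.
rewrite -ler_sqr ?nnegrE//; last first.
  by rewrite !mulr_ge0 ?expR_ge0//; lra.
apply: (le_trans (norm_le_sqn _)); apply: (le_trans hu).
rewrite !exprMn -expRM_natr; set e1 := expR _; set e2 := expR _.
have -> : e1 = e2 by rewrite /e1 /e2; congr expR; field.
have e20 : 0 <= e2 by exact: expR_ge0.
rewrite ler_wpM2r//.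
apply: (@le_trans _ _ (c * (m * `|v| ^+ 2))); first by rewrite ler_wpM2l.
rewrite mulrA ler_wpM2r ?sqr_ge0//.
apply: (@le_trans _ _ (1 + c * m)); first by lra.
by rewrite expr2 ler_peMl//; lra.
Qed.

Lemma decay_of_window n (F : R -> 'cV[R]_(n + n) -> 'cV[R]_(n + n))
    (T s0 G r2 c5 c8 c9 : R) :
  0 < T -> s0 <= T -> 1 <= G -> 0 < r2 -> 0 <= c5 -> 0 <= c8 -> 0 <= c9 ->
  (forall (z : R -> 'cV[R]_(n + n)) s t, 0 <= s -> s <= t -> t <= s + T ->
    evol s t z (fun r => F r (z r)) -> G * sqn (z s) < r2 -> sqn (z t) <= G * sqn (z s)) ->
  (forall (z : R -> 'cV[R]_(n + n)) s, 0 <= s -> s0 <= s ->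
    evol s (s + T) z (fun r => F r (z r)) -> G * sqn (z s) < r2 ->
    sqn (usubmx (z (s + T))) <= 1 / 8 * sqn (usubmx (z s)) + c8 * sqn (dsubmx (z s))
       + c9 * sqn (z s) ^+ 2 /\
    sqn (dsubmx (z (s + T))) <= 1 / 8 * sqn (dsubmx (z s)) + c5 * sqn (z s) ^+ 2) ->
  exists delta kappa lambda : R,
    [/\ 0 < delta, 0 < kappa & 0 < lambda] /\
    forall (t0 Te : R) (z : R -> 'cV[R]_(n + n)),
      0 <= t0 -> is_sol F `[t0, Te[ z -> `|z t0| < delta ->
      forall t, t0 <= t < Te -> `|z t| <= kappa * `|z t0| * expR (- lambda * (t - t0)).
Proof.
move=> T0 s0T G1 r20 c50 c80 c90 growth' window.
have G0 : 0 < G by lra.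
(* With this weight the coupling costs at most [mu / 8] of the second component. The two contraction
   factors [1 / 8] and a quarter for the remainder then make [W] halve over a window. *)
pose mu : R := 1 + 8 * c8.
have mu1 : 1 <= mu by rewrite /mu; lra.
have mu0 : 0 < mu by lra.
pose c10 : R := c9 + mu * c5.
have c100 : 0 <= c10 by rewrite addr_ge0// mulr_ge0//; lra.
(* Below [th] the growth bound cannot leave the region [r2], and the quadratic remainder is at most
   a quarter of [q]. *)
pose th : R := Num.min (r2 / (2 * G)) (1 / (4 * (c10 + 1))).
have th0 : 0 < th by rewrite lt_min !divr_gt0 ?mulr_gt0//; lra.
have thG q : q <= th -> G * q < r2.
  by rewrite le_min => /andP[]; rewrite ler_pdivlMr ?mulr_gt0//; lra.
have thc q : 0 <= q -> q <= th -> c10 * q <= 1 / 4.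
  move=> q0; rewrite le_min => /andP[_]; rewrite ler_pdivlMr ?mulr_gt0//; last by lra.
  nra.
pose m : R := (n + n)%:R.
have m0 : 0 <= m by [].
(* Where [z t0] has norm at most 1, its square is at most the norm itself, so a linear smallness
   condition suffices for [mu * G * q t0 <= th]. *)
pose dl : R := Num.min 1 (th / (mu * G * (m + 1))).
have muG : 0 < mu * G by rewrite mulr_gt0.
have dl0 : 0 < dl by rewrite lt_min ltr01 divr_gt0// mulr_gt0//; lra.
pose kp : R := 1 + 4 * mu * G ^+ 2 * m.
have kp1 : 1 <= kp by rewrite /kp lerDl !mulr_ge0 ?sqr_ge0//; lra.
exists dl, kp, (ln 2 / T / 2); split.
  by rewrite dl0 !divr_gt0 ?ln_gt0 ?ltr1n//; split=> //; lra.
move=> t0 Te z t00 hz zdl t tTe.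
pose q r := sqn (z r); pose W r := sqn (usubmx (z r)) + mu * sqn (dsubmx (z r)).
have qm : q t0 <= m * `|z t0| ^+ 2 by exact: sqn_le_norm.
have main : q t <= 4 * mu * G ^+ 2 * q t0 * expR (- (ln 2 / T) * (t - t0)).
  apply: (@discrete_decay R q W t0 Te T s0 th G mu) => //.
  - by move=> r; exact: sqn_ge0.
  - move=> r; rewrite /q /W sqn_split lerD2l ler_peMl//; exact: sqn_ge0.
  - move=> r; rewrite /q /W sqn_split mulrDr lerD2r ler_peMl//; exact: sqn_ge0.
  - move=> s r t0s sr rT rTe qs; apply: growth' => //; first exact: le_trans t0s.
      exact: is_sol_evol hz t0s rTe.
    exact: thG.
  - move=> s t0s s0s sTe qs.
    have [||h1 h2] := window z s (le_trans t00 t0s) s0s.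
    + exact: is_sol_evol hz t0s sTe.
    + exact: thG.
    have := thc _ (sqn_ge0 (z s)) qs; rewrite -/(q s) in h1 h2 *.
    move=> h3; have h4 : c10 * q s ^+ 2 <= 1 / 4 * W s.
      rewrite expr2 mulrA ler_pM//; first by rewrite mulr_ge0// sqn_ge0.
        exact: sqn_ge0.
      rewrite /q /W sqn_split lerD2l ler_peMl//; exact: sqn_ge0.
    have u0 := sqn_ge0 (usubmx (z s)); have v0 := sqn_ge0 (dsubmx (z s)).
    have h5 := ler_wpM2l (le_trans ler01 mu1) h2.
    have h6 : c8 * sqn (dsubmx (z s)) <= mu / 8 * sqn (dsubmx (z s)).
      by rewrite ler_wpM2r// /mu; lra.
    move: h4; rewrite /W /c10 mulrDl; move: h1 h5 h6.
    lra.
  - have zt0 : `|z t0| <= 1 by move: zdl; rewrite lt_min => /andP[/ltW].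
    have h1 : q t0 <= m * `|z t0|.
      apply: (le_trans qm); rewrite ler_wpM2l// expr2 ler_piMl//.
    have h2 : `|z t0| * (mu * G * (m + 1)) <= th.
      rewrite -ler_pdivlMr ?mulr_gt0//; last by lra.
      by move: zdl; rewrite lt_min => /andP[_ /ltW].
    have h3 := ler_wpM2l (ltW muG) h1.
    have h4 := mulr_ge0 (ltW muG) (normr_ge0 (z t0)).
    lra.
have muG2 : 0 <= 4 * mu * G ^+ 2 by rewrite mulr_ge0 ?sqr_ge0//; lra.
exact: decay_of_sqr m0 muG2 qm main.
Qed.

(** The coupling [N] needs only a bound: over a window it acts on the first block as a forcing whose
    size is controlled by the second block. *)
Theorem cascade_exp_stable n (S1 N S2 : R -> 'M[R]_n) F (a s0 : R) :
  0 <= a -> (forall t, 0 <= t -> [/\ opb a (S1 t), opb a (N t) & opb a (S2 t)]) ->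
  {within `[0, +oo[, continuous S1} -> {within `[0, +oo[, continuous S2} ->
  contracts S1 s0 -> contracts S2 s0 ->
  (forall t, 0 <= t -> F t 0 = 0) ->
  second_order_remainder F (fun t => block_mx (S1 t) (N t) 0 (S2 t)) ->
  exp_stable F.
Proof.
move=> a0 hop cS1 cS2 con1 con2 F0 [c [d [d0 hrem]]]; split=> //.
(* [perturbed_contraction] doubles the factor, so 1/16 becomes the 1/8 of [decay_of_window]. *)
have [T1 T10 hc1] := con1 (1 / 16) ltac:(lra).
have [T2 T20 hc2] := con2 (1 / 16) ltac:(lra).
(* The sum dominates both contraction times and [s0]. *)
pose T := T1 + T2 + `|s0|.
have s0n : s0 <= `|s0| by exact: ler_norm.
have T0 : 0 < T by rewrite /T; have := normr_ge0 s0; lra.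
pose S t := block_mx (S1 t) (N t) 0 (S2 t).
pose g t z := F t z - S t *m z.
pose c2 : R := (n + n)%:R * c ^+ 2.
have c20 : 0 <= c2 by rewrite mulr_ge0// sqr_ge0.
(* Inside this region both blocks have norm below [d], so the remainder estimate applies, and the
   squared norm is below 1, so the quadratic remainder is also linearly bounded. *)
pose r2 : R := Num.min (d ^+ 2) 1.
have r20 : 0 < r2 by rewrite lt_min exprn_gt0//= ltr01.
have hg t z : 0 <= t -> sqn z < r2 -> sqn (g t z) <= c2 * sqn z ^+ 2.
  move=> t0; rewrite lt_min => /andP[zd _].
  have su := norm_le_sqn (usubmx z); have sd := norm_le_sqn (dsubmx z).
  have := sqn_split z => zE.
  have u0 := sqn_ge0 (usubmx z); have d0' := sqn_ge0 (dsubmx z).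
  have hu : `|usubmx z| < d.
    by rewrite -(@ltr_pXn2r _ 2)// ?nnegrE// ?ltW//; lra.
  have hd : `|dsubmx z| < d.
    by rewrite -(@ltr_pXn2r _ 2)// ?nnegrE// ?ltW//; lra.
  have := hrem t _ _ t0 hu hd; rewrite vsubmxK -/(S t) -/(g t z) => h.
  apply: (le_trans (sqn_le_norm _)); rewrite /c2 -mulrA ler_wpM2l// -exprMn.
  have h' : `|g t z| <= `|c| * sqn z.
    apply: (le_trans h); apply: (@le_trans _ _ (`|c| * (`|usubmx z| ^+ 2 + `|dsubmx z| ^+ 2))).
      by rewrite ler_wpM2r ?ler_norm// addr_ge0// sqr_ge0.
    by rewrite ler_wpM2l//; lra.
  rewrite -[leRHS]real_normK ?num_real// normrM (ger0_norm (sqn_ge0 z)).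
  by rewrite ler_pXn2r ?nnegrE// mulr_ge0// sqn_ge0.
have hgl t z : 0 <= t -> sqn z < r2 -> sqn (g t z) <= c2 * sqn z.
  move=> t0 /[dup] zr /(hg t z t0) /le_trans; apply.
  rewrite ler_wpM2l// expr2 ler_piMl ?sqn_ge0// ltW// (lt_le_trans zr)//.
  by rewrite ge_min lexx orbT.
have hSz t z : S t *m z =
    col_mx (S1 t *m usubmx z + N t *m dsubmx z) (S2 t *m dsubmx z).
  by rewrite -[in LHS](vsubmxK z) mul_block_col mul0mx add0r.
have hSop t : 0 <= t -> opb (5 * a) (S t).
  move=> /hop[h1 h2 h3] z; rewrite hSz sqn_col_mx sqn_split.
  have := sqnD_le (S1 t *m usubmx z) (N t *m dsubmx z).
  have := h1 (usubmx z); have := h2 (dsubmx z); have := h3 (dsubmx z).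
  have := mulr_ge0 a0 (sqn_ge0 (usubmx z)); have := mulr_ge0 a0 (sqn_ge0 (dsubmx z)).
  lra.
(* The linear part contributes [1 + 5 * a], the remainder [1 + c2]. *)
pose b : R := 2 + 5 * a + c2.
have b0 : 0 <= b by rewrite /b; lra.
pose G : R := expR (b * T).
have G1 : 1 <= G by rewrite -[leLHS]expR0 ler_expR mulr_ge0// ltW.
have growth (z : R -> 'cV[R]_(n + n)) s t : 0 <= s -> s <= t -> t <= s + T ->
    evol s t z (fun r => F r (z r)) ->
    (forall r, s <= r < t -> sqn (z r) < r2) -> sqn (z t) <= G * sqn (z s).
  move=> s0' st tT hz hr.
  have := @gronwall R s t b 0 _ _ st b0 (lexx _) (evol_sqn hz).
  rewrite mul0r addr0 => h; apply: le_trans (h _) _ => [r /andP[sr rt]|].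
    have r0 : 0 <= r by apply: le_trans s0' (ltW sr).
    have zr : sqn (z r) < r2 by apply: hr; rewrite ltW.
    have -> : F r (z r) = S r *m z r + g r (z r) by rewrite /g addrC subrK.
    rewrite dotDr; have := dot_opb (z r) (hSop r r0); have := hgl r _ r0 zr.
    have := dot_young (z r) (g r (z r)).
    rewrite addr0 /b; lra.
  rewrite mulrC ler_wpM2r ?sqn_ge0// ler_expR ler_wpM2l//; lra.
(* Bootstrap: [growth] presupposes that the solution remains in the region and in turn implies it;
   [first_exit] breaks the circle. *)
have stay (z : R -> 'cV[R]_(n + n)) s t : 0 <= s -> s <= t -> t <= s + T ->
    evol s t z (fun r => F r (z r)) -> G * sqn (z s) < r2 -> sqn (z t) < r2.
  move=> s0' st tT hz hG; apply: (first_exit st (evol_sqn hz)) => x /andP[sx xt] hx.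
  apply: le_lt_trans hG; apply: growth => //; first exact: le_trans tT.
  exact: evol_sub (lexx _) xt hz.
have growth' (z : R -> 'cV[R]_(n + n)) s t : 0 <= s -> s <= t -> t <= s + T ->
    evol s t z (fun r => F r (z r)) -> G * sqn (z s) < r2 -> sqn (z t) <= G * sqn (z s).
  move=> s0' st tT hz hG; apply: growth => // r /andP[sr rt].
  apply: (stay z s) => //; first by apply: le_trans tT; exact: ltW.
  by apply: evol_sub (lexx _) (ltW rt) hz.
pose c3 : R := c2 * G ^+ 2.
have c30 : 0 <= c3 by rewrite mulr_ge0// sqr_ge0.
pose E : R := expR ((2 + a) * T).
have E0 : 0 <= E by exact: expR_ge0.
pose c8 : R := 4 * a * E * T * E.
have c80 : 0 <= c8 by rewrite !mulr_ge0// ltW.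
pose c9 : R := 4 * (a * c3 * T * E + c3) * T * E.
have T0' := ltW T0.
have c90 : 0 <= c9.
  apply: mulr_ge0 => //; apply: mulr_ge0 => //; apply: mulr_ge0 => //.
  apply: addr_ge0 => //; apply: mulr_ge0 => //; apply: mulr_ge0 => //.
  exact: mulr_ge0.
pose c5 : R := 2 * (c3 * T) * E.
have c50 : 0 <= c5.
  by apply: mulr_ge0 => //; apply: mulr_ge0 => //; exact: mulr_ge0.
have window (z : R -> 'cV[R]_(n + n)) s : 0 <= s -> s0 <= s ->
    evol s (s + T) z (fun r => F r (z r)) -> G * sqn (z s) < r2 ->
    sqn (usubmx (z (s + T))) <= 1 / 8 * sqn (usubmx (z s)) + c8 * sqn (dsubmx (z s))
       + c9 * sqn (z s) ^+ 2 /\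
    sqn (dsubmx (z (s + T))) <= 1 / 8 * sqn (dsubmx (z s)) + c5 * sqn (z s) ^+ 2.
  move=> sge s0s hz hG.
  have sT : s <= s + T by rewrite lerDl ltW.
  have pos r : s < r < s + T -> 0 <= r by move=> /andP[sr _]; rewrite (le_trans sge)// ltW.
  have gb r : s < r < s + T -> sqn (g r (z r)) <= c3 * sqn (z s) ^+ 2.
    move=> /[dup] srT /andP[sr rT]; have hzr := evol_sub (lexx s) (ltW rT) hz.
    have h1 := stay z s r sge (ltW sr) (ltW rT) hzr hG.
    have h2 := growth' z s r sge (ltW sr) (ltW rT) hzr hG.
    apply: (le_trans (hg r _ (pos r srT) h1)).
    rewrite /c3 -mulrA ler_wpM2l// -exprMn ler_pXn2r ?nnegrE ?sqn_ge0//.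
    by rewrite mulr_ge0 ?sqn_ge0//; lra.
  have Fz r : F r (z r) = S r *m z r + g r (z r) by rewrite /g addrC subrK.
  have du : evol s (s + T) (fun r => usubmx (z r)) (fun r => S1 r *m usubmx (z r) +
      (N r *m dsubmx (z r) + usubmx (g r (z r)))).
    apply: evol_eq (evol_usubmx hz) => r _.
    by rewrite Fz linearD/= hSz col_mxKu addrA.
  have de : evol s (s + T) (fun r => dsubmx (z r)) (fun r => S2 r *m dsubmx (z r) +
      dsubmx (g r (z r))).
    apply: evol_eq (evol_dsubmx hz) => r _.
    by rewrite Fz linearD/= hSz col_mxKd.
  have q0 : 0 <= c3 * sqn (z s) ^+ 2 by rewrite mulr_ge0// sqr_ge0.
  have gu r : s < r < s + T -> sqn (usubmx (g r (z r))) <= c3 * sqn (z s) ^+ 2.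
    by move=> /gb; rewrite sqn_split; have := sqn_ge0 (dsubmx (g r (z r))); lra.
  have gd r : s < r < s + T -> sqn (dsubmx (g r (z r))) <= c3 * sqn (z s) ^+ 2.
    by move=> /gb; rewrite sqn_split; have := sqn_ge0 (usubmx (g r (z r))); lra.
  have op1 r : s < r < s + T -> opb a (S1 r) by move=> /pos /hop[].
  have op2 r : s < r < s + T -> opb a (N r) by move=> /pos /hop[].
  have op3 r : s < r < s + T -> opb a (S2 r) by move=> /pos /hop[].
  have sTT : s + T - s = T by rewrite addrC addKr.
  have n0 : 0 <= `|s0| by [].
  (* The second block is driven by the remainder alone. Its bound [eb] within the window then enters
     the forcing of the first block. *)
  split; last first.
    have := perturbed_contraction sT a0 q0 op3 (within_sub_itvy sge cS2) _ de gd.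
    move=> /(_ (1 / 16)); rewrite sTT -/E => h.
    apply: le_trans (h _) _ => [y hy|]; first by apply: hc2 => //; rewrite /T; lra.
    by rewrite /c5 le_eqVlt; apply/orP; left; apply/eqP; field.
  have eb r : s < r < s + T ->
      sqn (dsubmx (z r)) <= (sqn (dsubmx (z s)) + c3 * sqn (z s) ^+ 2 * T) * E.
    move=> /[dup] srT /andP[sr rT].
    have der := evol_sub (lexx s) (ltW rT) de.
    have := linear_growth (ltW sr) a0 q0 _ der => h.
    apply: le_trans (h _ _) _.
    - by move=> x /andP[sx xr]; apply: op3; rewrite sx (lt_trans xr).
    - by move=> x /andP[sx xr]; apply: gd; rewrite sx (lt_trans xr).
    have rs : r - s <= T by lra.
    have rs0 : 0 <= r - s by lra.
    apply: ler_pM.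
    - by apply: addr_ge0; [exact: sqn_ge0|exact: mulr_ge0].
    - exact: expR_ge0.
    - by rewrite lerD2l ler_wpM2l.
    - by rewrite ler_expR ler_wpM2l// addr_ge0.
  pose q := 2 * (a * ((sqn (dsubmx (z s)) + c3 * sqn (z s) ^+ 2 * T) * E))
      + 2 * (c3 * sqn (z s) ^+ 2).
  have qq0 : 0 <= q.
    apply: addr_ge0; last exact: mulr_ge0.
    apply: mulr_ge0 => //; apply: mulr_ge0 => //; apply: mulr_ge0 => //.
    by apply: addr_ge0; [exact: sqn_ge0|exact: mulr_ge0].
  have gu' r : s < r < s + T ->
      sqn (N r *m dsubmx (z r) + usubmx (g r (z r))) <= q.
    move=> srT; apply: (le_trans (sqnD_le _ _)); apply: lerD.
      rewrite ler_pM2l//; apply: (le_trans (op2 r srT _)).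
      by rewrite ler_wpM2l// eb.
    by rewrite ler_pM2l// gu.
  have := perturbed_contraction sT a0 qq0 op1 (within_sub_itvy sge cS1) _ du gu'.
  move=> /(_ (1 / 16)); rewrite sTT -/E => h.
  apply: le_trans (h _) _ => [y hy|]; first by apply: hc1 => //; rewrite /T; lra.
  by rewrite /c8 /c9 /q le_eqVlt; apply/orP; left; apply/eqP; field.
have s0T : s0 <= T by rewrite /T; lra.
exact: (decay_of_window T0 s0T G1 r20 c50 c80 c90 growth' window).
Qed.

End cascade.

(** * Lebesgue integrals compared with antiderivatives *)

Section integral_comparison.
Context {R : realType}.
Notation mu := (@lebesgue_measure R).

Lemma within_primitive (g : R -> R) (a b : R) : a < b ->
  {within `[a, b], continuous g} ->
  exists V : R -> R, evol a b V g /\ \int[mu]_(t in `[a, b]) g t = V b - V a.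
Proof.
move=> ab cg.
have [V [_ dV]] := primitive_exists a (clamp_continuousW (ltW ab) cg).
have gE t : a <= t <= b -> (g \o clamp a b) t = g t by move=> h; rewrite /= clamp_id.
exists V; split.
  apply: evol_eq (evol_derive a b dV) => t /andP[t1 t2].
  by rewrite gE// !ltW.
have cV : continuous V by exact: continuous_of_derive dV.
rewrite /Rintegral (@continuous_FTC2 _ g V)//; last first.
- move=> t; rewrite in_itv/= => /andP[t1 t2].
  by have [_] := dV t; rewrite derive1E => ->; rewrite gE// !ltW.
- split.
  + by move=> t _; have [] := dV t.
  + by apply: cvg_at_right_filter; exact: cV.
  + by apply: cvg_at_left_filter; exact: cV.
Qed.

Lemma within_integrable (g : R -> R) (a b : R) :
  {within `[a, b], continuous g} -> mu.-integrable `[a, b] (EFin \o g).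
Proof.
by move=> cg; apply: continuous_compact_integrable => //; exact: segment_compact.
Qed.

(** The Gramian integrands may be discontinuous, hence are merely integrable, while energies are
    differentiable; the continuous [g] mediates between the two. *)
Lemma integral_le_evol (a b : R) (f g U dU : R -> R) : a < b ->
  mu.-integrable `[a, b] (EFin \o f) -> {within `[a, b], continuous g} ->
  (forall t, a <= t <= b -> f t <= g t) ->
  evol a b U dU -> (forall t, a < t < b -> g t <= dU t) ->
  \int[mu]_(t in `[a, b]) f t <= U b - U a.
Proof.
move=> ab fi cg fg hU gU; have [V [dV VE]] := within_primitive ab cg.
apply: (@le_trans _ _ (\int[mu]_(t in `[a, b]) g t)).
  by apply: le_Rintegral => //; exact: within_integrable.
rewrite VE; have := evol_ndecr (ltW ab) (evolB hU dV) => h.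
have {}h : U a - V a <= U b - V b by apply: h => t /gU; rewrite subr_ge0.
lra.
Qed.

Lemma integral_ge_evol (a b : R) (f g U dU : R -> R) : a < b ->
  mu.-integrable `[a, b] (EFin \o f) -> {within `[a, b], continuous g} ->
  (forall t, a <= t <= b -> g t <= f t) ->
  evol a b U dU -> (forall t, a < t < b -> dU t <= g t) ->
  U b - U a <= \int[mu]_(t in `[a, b]) f t.
Proof.
move=> ab fi cg gf hU gU; have [V [dV VE]] := within_primitive ab cg.
apply: (@le_trans _ _ (\int[mu]_(t in `[a, b]) g t)); last first.
  by apply: le_Rintegral => //; exact: within_integrable.
rewrite VE; have := evol_ndecr (ltW ab) (evolB dV hU) => h.
have {}h : V a - U a <= V b - U b by apply: h => t /gU; rewrite subr_ge0.
lra.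
Qed.

Lemma Rintegral_sum_ord n (a b : R) (f : 'I_n -> R -> R) :
  (forall i, mu.-integrable `[a, b] (EFin \o f i)) ->
  mu.-integrable `[a, b] (EFin \o (fun t => \sum_i f i t)) /\
  \int[mu]_(t in `[a, b]) (\sum_i f i t) = \sum_i \int[mu]_(t in `[a, b]) f i t.
Proof.
elim: n f => [|n IH] f hf.
  under [X in EFin \o X]eq_fun do rewrite big_ord0.
  under eq_Rintegral do rewrite big_ord0.
  rewrite big_ord0; split; first exact: integrable0.
  by rewrite Rintegral_cst// mul0r.
have [h1 h2] := IH (fun i => f (lift ord0 i)) (fun i => hf (lift ord0 i)).
under [X in EFin \o X]eq_fun do rewrite big_ord_recl.
under eq_Rintegral do rewrite big_ord_recl.
rewrite big_ord_recl; split.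
  exact: (@integrableD _ (measurableTypeR R) R mu _ (measurable_itv `[a, b]) _ _
    (hf ord0) h1).
by rewrite RintegralD// h2.
Qed.

Lemma quad_integral n (a b : R) (G : R -> 'M[R]_n) (v : 'cV[R]_n) :
  mx_integrable a b G ->
  mu.-integrable `[a, b] (EFin \o (fun t => dot v (G t *m v))) /\
  \int[mu]_(t in `[a, b]) dot v (G t *m v) = dot v (mx_integral a b G *m v).
Proof.
move=> hG.
have E (M : 'M[R]_n) : dot v (M *m v) = \sum_i \sum_j v i 0 * v j 0 * M i j.
  rewrite dotE; apply: eq_bigr => i _; rewrite mxE big_distrr/=.
  by apply: eq_bigr => j _; ring.
have h1 i j : mu.-integrable `[a, b] (EFin \o (fun t => v i 0 * v j 0 * G t i j)).
  exact: (@integrableZl _ (measurableTypeR R) R mu _ (measurable_itv `[a, b])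
    (v i 0 * v j 0) _ (hG i j)).
have h2 i := Rintegral_sum_ord (h1 i).
have [h3 h4] := Rintegral_sum_ord (fun i => (h2 i).1).
rewrite E; under [X in EFin \o X]eq_fun do rewrite E.
under eq_Rintegral do rewrite E.
split=> //; rewrite h4; apply: eq_bigr => i _; rewrite (h2 i).2.
apply: eq_bigr => j _; rewrite mxE RintegralZl//; exact: hG.
Qed.

End integral_comparison.

(** * Gramians *)

Section gramians.
Context {R : realType}.
Notation mu := (@lebesgue_measure R).

Lemma within_mulmx {m n p} (I : interval R) (M : R -> 'M[R]_(m, n)) (N : R -> 'M[R]_(n, p)) :
  {within [set` I], continuous M} -> {within [set` I], continuous N} ->
  {within [set` I], continuous (fun t => M t *m N t)}.
Proof. by move=> cM cN t; apply: cvg_mulmx; [exact: cM|exact: cN]. Qed.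

Lemma within_trmx {m n} (I : interval R) (M : R -> 'M[R]_(m, n)) :
  {within [set` I], continuous M} -> {within [set` I], continuous (fun t => (M t)^T)}.
Proof. by move=> cM t; apply: cvg_trmx; exact: cM. Qed.

Lemma within_oppmx {m n} (I : interval R) (M : R -> 'M[R]_(m, n)) :
  {within [set` I], continuous M} -> {within [set` I], continuous (fun t => - M t)}.
Proof. by move=> cM t; apply: cvgN; exact: cM. Qed.

Lemma within_addmx {m n} (I : interval R) (M N : R -> 'M[R]_(m, n)) :
  {within [set` I], continuous M} -> {within [set` I], continuous N} ->
  {within [set` I], continuous (fun t => M t + N t)}.
Proof. by move=> cM cN t; apply: cvgD; [exact: cM|exact: cN]. Qed.

Lemma within_dot {n} (I : interval R) (u v : R -> 'cV[R]_n) :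
  {within [set` I], continuous u} -> {within [set` I], continuous v} ->
  {within [set` I], continuous (fun t => dot (u t) (v t))}.
Proof.
move=> cu cv t; have := within_mulmx (within_trmx cu) cv.
by move=> /(_ t) /cvg_mxP /(_ 0 0).
Qed.

Lemma final_value n (S : R -> 'M[R]_n) (v : 'cV[R]_n) (a b : R) :
  a <= b -> {within `[a, b], continuous S} ->
  exists y : R -> 'cV[R]_n, y b = v /\ evol a b y (fun t => S t *m y t).
Proof.
move=> ab cS; have [Z [G [dZ _ GZ]]] := fundamental_matrix ab cS.
exists (fun t => Z t *m (G b *m v)); split.
  by rewrite mulmxA (mulmx1C (GZ b _)) ?mul1mx// ab lexx.
apply: evol_eq (evol_mulmxr (G b *m v) dZ) => t _.
by rewrite -mulmxA.
Qed.

Section transition.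
Variables (n : nat) (A : R -> 'M[R]_n) (Phi : R -> R -> 'M[R]_n).
Hypothesis hPhi : transition_matrix A Phi.

Lemma transition_evol (tau t b : R) : 0 <= tau -> 0 <= t ->
  evol t b (Phi ^~ tau) (fun s => A s *m Phi s tau).
Proof. by move=> tau0 t0; have [h _] := hPhi tau0; exact: is_sol_evoly h t0. Qed.

(** The row a^T Phi(., s) is constant, so the derivative of [Phi] in its first argument suffices,
    and [r] may lie on either side of [s]. *)
Lemma transition_dual (a : R -> 'cV[R]_n) (t b : R) : 0 <= t ->
  evol t b a (fun s => - ((A s)^T *m a s)) ->
  forall r s, t <= r <= b -> t <= s <= b -> a s = (Phi r s)^T *m a r.
Proof.
move=> t0 da r s /andP[tr rb] /andP[ts sb].
have s0 : 0 <= s by apply: le_trans ts.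
have cst x y : t <= x -> x <= y -> y <= b ->
    (a x)^T *m Phi x s = (a y)^T *m Phi y s.
  move=> tx xy yb; have dax := evol_trmx (evol_sub tx yb da).
  have := evol_mulmx dax (transition_evol y s0 (le_trans t0 tx)).
  move=> /(evol_cst_eq_mx xy); apply=> z _.
  by rewrite linearN/= trmx_mul trmxK mulNmx mulmxA addNr.
have Phi1 : Phi s s = 1%:M by have [_] := hPhi s0.
apply: trmx_inj; rewrite trmx_mul trmxK.
have [rs|sr] := leP r s.
  by rewrite (cst r s tr rs sb) Phi1 mulmx1.
by rewrite -(cst s r ts (ltW sr) rb) Phi1 mulmx1.
Qed.

(** Uniqueness: multiplied by the inverse [G] of a fundamental matrix, the difference of the two
    solutions becomes constant. *)
Lemma transition_primal (y : R -> 'cV[R]_n) (t b : R) : 0 <= t ->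
  {within `[0, +oo[, continuous A} ->
  evol t b y (fun s => A s *m y s) ->
  forall s, t <= s <= b -> y s = Phi s t *m y t.
Proof.
move=> t0 cA dy s /andP[ts sb].
have [Z [G [dZ dG GZ]]] := fundamental_matrix ts (within_sub_itvy t0 cA).
have dd := evolB (evol_sub (lexx t) sb dy)
  (evol_mulmxr (y t) (transition_evol s t0 t0)).
have := evol_cst_eq_mx ts (evol_mulmx dG dd) => h.
have : G t *m (y t - Phi t t *m y t) = G s *m (y s - Phi s t *m y t).
  by apply: h => r _; rewrite mulNmx -!mulmxA !mulmxBr !mulmxA addNr.
have [_ ->] := hPhi t0; rewrite mul1mx subrr mulmx0 => /(congr1 (mulmx (Z s))).
rewrite mulmx0 mulmxA (mulmx1C (GZ s _)) ?ts ?lexx// mul1mx => /esym/eqP.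
by rewrite subr_eq0 => /eqP.
Qed.

End transition.

(** Convexity of the form: semidefiniteness at [v i - v j] bounds each cross term by the mean of two
    diagonal ones. *)
Lemma quad_sum n m (Q : 'M[R]_n) (v : 'I_m -> 'cV[R]_n) :
  Q^T = Q -> (forall x, 0 <= dot x (Q *m x)) ->
  dot (\sum_i v i) (Q *m \sum_i v i) <= m%:R * \sum_i dot (v i) (Q *m v i).
Proof.
move=> sQ pQ.
have dsum (x : 'cV[R]_n) : dot x (Q *m \sum_i v i) = \sum_i dot x (Q *m v i).
  rewrite mulmx_sumr; elim/big_ind2 : _ => // [|a b c d <- <-]; first exact: dot0r.
  by rewrite dotDr.
have dsuml (x : 'cV[R]_n) : dot (\sum_i v i) x = \sum_i dot (v i) x.
  elim/big_ind2 : _ => // [|c d y z <- <-]; first by rewrite dotC dot0r.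
  by rewrite dotDl.
have B i j : dot (v i) (Q *m v j) <= (dot (v i) (Q *m v i) + dot (v j) (Q *m v j)) / 2.
  have sym : dot (v j) (Q *m v i) = dot (v i) (Q *m v j).
    by rewrite dot_trmx sQ dotC.
  have := pQ (v i - v j); rewrite mulmxBr dotDl !dotDr !dotNl !dotNr sym; lra.
have -> : dot (\sum_i v i) (Q *m \sum_i v i) = \sum_i \sum_j dot (v i) (Q *m v j).
  transitivity (\sum_i dot (v i) (Q *m \sum_i v i)); last by apply: eq_bigr => i _.
  exact: dsuml.
apply: (@le_trans _ _ (\sum_(i < m) \sum_(j < m)
   (dot (v i) (Q *m v i) + dot (v j) (Q *m v j)) / 2)).
  by apply: ler_sum => i _; apply: ler_sum => j _.
rewrite le_eqVlt; apply/orP; left; apply/eqP.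
under eq_bigr do rewrite -mulr_suml big_split/= sumr_const card_ord.
rewrite -mulr_suml big_split/= sumr_const card_ord sumrMnl.
by set q := \sum_i _; rewrite -(mulr_natl q); field.
Qed.

Lemma evol_sum n (a b : R) (f df : 'I_n -> R -> R) :
  (forall i, evol a b (f i) (df i)) ->
  evol a b (fun t => \sum_i f i t) (fun t => \sum_i df i t).
Proof.
move=> h; split=> t tab; first by apply: cvg_sum_ord => i; exact: (h i).1.
by apply: is_derive_sum_ord => i; exact: (h i).2.
Qed.

Lemma evolZ (a b c : R) (f df : R -> R) :
  evol a b f df -> evol a b (fun t => c * f t) (fun t => c * df t).
Proof.
move=> h; apply: evol_eq (evolM (evol_cst a b c) h) => t _.
by rewrite mul0r add0r.
Qed.

Lemma dot_scalar n (c : R) (v : 'cV[R]_n) : dot v (c%:M *m v) = c * sqn v.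
Proof. by rewrite mul_scalar_mx dotZr. Qed.

Section controllability.
Variables (n q : nat) (A Q : R -> 'M[R]_n) (D : R -> 'M[R]_(n, q)) (Qt : R -> 'M[R]_q).
Variables (a g1 g2 : R).
Hypothesis cA : {within `[0, +oo[, continuous A}.
Hypothesis cQ : {within `[0, +oo[, continuous Q}.
Hypothesis a0 : 0 < a.
Hypothesis opA : forall t : R, 0 <= t -> opb a (A t).
Hypothesis g10 : 0 < g1.
Hypothesis g20 : 0 < g2.
Hypothesis QE : forall t : R, 0 <= t -> Q t = D t *m Qt t *m (D t)^T.
Hypothesis sQ : forall t : R, 0 <= t -> (Q t)^T = Q t.
Hypothesis hQt : forall (t : R) v, 0 <= t -> g1 * sqn v <= dot v (Qt t *m v) <= g2 * sqn v.

Let dQ (t : R) x : 0 <= t -> dot x (Q t *m x) = dot ((D t)^T *m x) (Qt t *m ((D t)^T *m x)).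
Proof. by move=> t0; rewrite QE// -!mulmxA dot_trmx. Qed.

Lemma noise_psd (t : R) x : 0 <= t -> 0 <= dot x (Q t *m x).
Proof.
move=> t0; rewrite dQ//; have /andP[h _] := hQt ((D t)^T *m x) t0.
by apply: le_trans h; rewrite mulr_ge0 ?sqn_ge0// ltW.
Qed.

Let ctrlE Phi t tau (v : 'cV[R]_n) : dot v (ctrl_integrand Phi D t tau *m v) =
  sqn ((D tau)^T *m ((Phi t tau)^T *m v)).
Proof.
by rewrite /ctrl_integrand -!mulmxA dot_trmx dot_trmx.
Qed.

(* [Q] is only bounded in the mean; the last clause says that its integral over a window, tested
   against bounded functions [x], is bounded. *)
Lemma controllability_bounds : uniformly_completely_controllable A D ->
  exists sg al q2 : R, [/\ 0 < sg, 0 < al, 0 <= q2,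
    forall t (y : R -> 'cV[R]_n) (U dU : R -> R), 0 <= t ->
      evol t (t + sg) y (fun s => - ((A s)^T *m y s)) -> evol t (t + sg) U dU ->
      (forall s, t < s < t + sg -> dot (y s) (Q s *m y s) <= dU s) ->
      al * sqn (y (t + sg)) <= U (t + sg) - U t &
    forall t r (x : R -> 'cV[R]_n) (f df : R -> R) K, 0 <= t -> t <= r -> r <= t + sg ->
      0 <= K -> evol t r f df ->
      (forall s, t < s < r -> df s <= dot (x s) (Q s *m x s) /\ sqn (x s) <= K) ->
      f r - f t <= K * q2].
Proof.
move=> [Phi hPhi [sg [b1 [b2 [b3 [b4 [[sg0 b10 b20 b30 b40] hW]]]]]]].
have cAT : {within `[0, +oo[, continuous (fun t => - (A t)^T)}.
  exact/within_oppmx/within_trmx.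
have cq t (y dy : R -> 'cV[R]_n) : 0 <= t -> evol t (t + sg) y dy ->
    {within `[t, t + sg], continuous (fun s => dot (y s) (Q s *m y s))}.
  move=> t0 dy'; have cy := evol_within dy'.
  by apply: within_dot => //; apply: within_mulmx => //; exact: within_sub_itvy cQ.
(* [b3] is the lower bound of the transported Gramian. In the last constant, [n] comes from
   [quad_sum], the exponential from the growth of adjoint solutions, and the sum from one upper
   Gramian bound per basis vector. *)
exists sg, (g1 * b3), (n%:R * expR ((1 + a) * sg) * \sum_(i < n) (g2 * b2)); split=> //.
- exact: mulr_gt0.
- rewrite !mulr_ge0 ?expR_ge0//; apply: sumr_ge0 => i _.
  by rewrite mulr_ge0 ?ltW.
- move=> t y U dU t0 dy hU hq.
  have tb : t < t + sg by rewrite ltrDl.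
  have [iW _ _ hb3 _] := hW t t0.
  have [iq qE] := quad_integral (y t) iW.
  have yE := transition_dual hPhi t0 dy.
  have ty : t <= t <= t + sg by rewrite lexx ltW.
  have by' : t <= t + sg <= t + sg by rewrite lexx ltW.
  (* Transporting [y (t + sg)] back to [t] turns the form of [W'] there into that of [W] at [y t],
     which is the integral of |D^T y|^2. *)
  have := hb3 (y (t + sg)); rewrite !qformE dot_scalar.
  rewrite -!mulmxA dot_trmx -(yE _ _ by' ty) -qE => h.
  have cg : {within `[t, t + sg], continuous (fun s => g1^-1 * dot (y s) (Q s *m y s))}.
    by move=> s; apply: cvgM; [exact: cvg_cst|exact: (cq t y _ t0 dy)].
  have := integral_le_evol tb iq cg _ (evolZ g1^-1 hU) => h2.
  rewrite -mulrA -ler_pdivlMl// mulrBr; apply: (le_trans h).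
  apply: h2 => s /andP[ts sb]; last by rewrite ler_pM2l ?invr_gt0// hq// ts.
  have s0 : 0 <= s by apply: le_trans ts.
  rewrite ctrlE -(yE t s) ?ts// ler_pdivlMl// dQ//.
  by have /andP[] := hQt ((D s)^T *m y s) s0.
- move=> t r x f df K t0 tr rb K0 hf hd.
  have tb : t < t + sg by rewrite ltrDl.
  have cT : {within `[t, t + sg], continuous (fun s => - (A s)^T)}.
    exact: within_sub_itvy cAT.
  have [Y [Yt dY]] := linear_ode_exists (1%:M : 'M[R]_n) (ltW tb) cT.
  have dY' : evol t (t + sg) Y (fun s => - ((A s)^T *m Y s)).
    by apply: evol_eq dY => s _; rewrite mulNmx.
  (* Adjoint solutions issued from the standard basis at [t]; along each of them the upper Gramian
     bound controls the integral of the [Q]-form. *)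
  pose y i s := Y s *m delta_mx i 0 : 'cV[R]_n.
  have dy i : evol t (t + sg) (y i) (fun s => - ((A s)^T *m y i s)).
    by apply: evol_eq (evol_mulmxr _ dY') => s _; rewrite mulNmx mulmxA.
  have /choice[V hV] : forall i, exists V : R -> R,
      evol t (t + sg) V (fun s => dot (y i s) (Q s *m y i s)) /\
      V (t + sg) - V t <= g2 * b2.
    move=> i; have [V [dV VE]] := within_primitive tb (cq t _ _ t0 (dy i)).
    exists V; split=> //.
    have [iW _ hb2 _ _] := hW t t0.
    have [iq qE] := quad_integral (y i t) iW.
    have yE := transition_dual hPhi t0 (dy i).
    have := hb2 (y i t); rewrite !qformE dot_scalar -qE.
    have -> : sqn (y i t) = 1.
      rewrite /y Yt mul1mx sqnE (bigD1 i)//= mxE !eqxx expr1n big1 ?addr0// => j ji.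
      by rewrite mxE (negbTE ji) expr0n.
    rewrite mulr1 => h.
    have cg : {within `[t, t + sg],
        continuous (fun s => g2^-1 * dot (y i s) (Q s *m y i s))}.
      by move=> s; apply: cvgM; [exact: cvg_cst|exact: (cq t _ _ t0 (dy i))].
    rewrite -ler_pdivrMl// mulrBr; apply: le_trans h.
    apply: (integral_ge_evol tb iq cg _ (evolZ g2^-1 dV)) => s //.
    move=> /andP[ts sb]; have s0 : 0 <= s by apply: le_trans ts.
    rewrite ctrlE -(yE t s) ?ts ?lexx ?(ltW tb)// ler_pdivrMl// dQ//.
    by have /andP[] := hQt ((D s)^T *m y i s) s0.
  pose e := expR ((1 + a) * sg).
  have dU := evolZ (n%:R * e * K) (evol_sum (fun i => (hV i).1)).
  (* The right side does not involve [x]. This is what admits test functions that solve no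
     equation. *)
  have key s : t < s < r -> dot (x s) (Q s *m x s) <=
      n%:R * e * K * \sum_i dot (y i s) (Q s *m y i s).
    move=> /[dup] tsr /andP[ts sr].
    have s0 : 0 <= s by apply: le_trans (ltW ts).
    have sb : s <= t + sg by rewrite (le_trans (ltW sr)).
    (* write [x s] as the value at [s] of the adjoint solution with value [c] at [t] *)
    have [w [ws dw]] := final_value (x s) (ltW ts) (within_sub_itvy t0 cAT).
    pose c := w t.
    have cE : x s = \sum_i c i 0 *: y i s.
      have [Z [G [dZ dG GZ]]] := fundamental_matrix (ltW ts) (within_sub_itvy t0 cAT).
      have dd := evolB dw (evol_mulmxr c (evol_sub (lexx t) sb dY)).
      have := evol_cst_eq_mx (ltW ts) (evol_mulmx dG dd) => h.
      have : G t *m (w t - Y t *m c) = G s *m (w s - Y s *m c).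
        by apply: h => z _; rewrite mulNmx -!mulmxA !mulmxBr !mulmxA addNr.
      rewrite Yt mul1mx subrr mulmx0 => /(congr1 (mulmx (Z s))).
      rewrite mulmx0 mulmxA (mulmx1C (GZ s _)) ?lexx ?ltW// mul1mx => /esym/eqP.
      rewrite subr_eq0 ws => /eqP ->.
      have cs : c = \sum_i c i 0 *: delta_mx i 0.
        rewrite {1}[c]matrix_sum_delta; apply: eq_bigr => i _.
        by rewrite big_ord1.
      by rewrite {1}cs mulmx_sumr; apply: eq_bigr => i _; rewrite -scalemxAr.
    have := linear_growth_back (ltW ts) (ltW a0) _ dw => hb.
    have {}hb : sqn c <= e * K.
      rewrite mulrC; apply: (le_trans (hb _)) => [z /andP[tz zs]|].
        apply/opbN/opb_tr => //; apply: opA; exact: le_trans (ltW tz).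
      apply: ler_pM.
      - exact: sqn_ge0.
      - exact: expR_ge0.
      - by rewrite ws; have [] := hd s tsr.
      - by rewrite ler_expR ler_wpM2l ?lerBlDl// addr_ge0// ltW.
    rewrite cE; apply: (le_trans (quad_sum _ (sQ s0) _)) => [z|].
      exact: noise_psd.
    rewrite -!mulrA ler_wpM2l// mulrA big_distrr/=; apply: ler_sum => i _.
    rewrite -scalemxAr dotZl dotZr mulrA ler_wpM2r ?noise_psd//.
    apply: le_trans hb; rewrite sqnE (bigD1 i)//= lerDl.
    by apply: sumr_ge0 => j _; exact: sqr_ge0.
  have h1 := evol_ndecr tr (evolB (evol_sub (lexx t) rb dU) hf).
  have {}h1 : n%:R * e * K * (\sum_i V i t) - f t <= n%:R * e * K * (\sum_i V i r) - f r.
    apply: h1 => s tsr; rewrite subr_ge0; have [h _] := hd s tsr.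
    by apply: (le_trans h); exact: key.
  have cK : 0 <= n%:R * e * K by rewrite !mulr_ge0 ?expR_ge0.
  have h2 : \sum_i V i r - \sum_i V i t <= \sum_(i < n) (g2 * b2).
    rewrite -sumrB; apply: ler_sum => i _; have [dV hVi] := hV i.
    apply: le_trans hVi; rewrite lerD2r.
    apply: (evol_ndecr rb (evol_sub tr (lexx _) dV)) => s /andP[rs _].
    by apply: noise_psd; rewrite (le_trans t0)// (le_trans tr)// ltW.
  have := ler_wpM2l cK h2; rewrite mulrBr.
  rewrite (_ : K * _ = n%:R * e * K * \sum_(i < n) (g2 * b2)); last by rewrite /e; ring.
  move: h1; lra.
Qed.

End controllability.
End gramians.

(** * Riccati equation and the observer error *)

Section riccati.
Context {R : realType}.
Variables (n p : nat) (A P Q : R -> 'M[R]_n) (C : R -> 'M[R]_(p, n)) (Ri : R -> 'M[R]_p).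
Variables (a c r3 r4 : R).
Hypothesis cA : {within `[0, +oo[, continuous A}.
Hypothesis cQ : {within `[0, +oo[, continuous Q}.
Hypothesis cC : {within `[0, +oo[, continuous C}.
Hypothesis cRi : {within `[0, +oo[, continuous Ri}.
Hypothesis a0 : 0 < a.
Hypothesis opA : forall t : R, 0 <= t -> opb a (A t).
Hypothesis c0 : 0 < c.
Hypothesis opC : forall t : R, 0 <= t -> opb c (C t).
Hypothesis sQ : forall t : R, 0 <= t -> (Q t)^T = Q t.
Hypothesis pQ : forall (t : R) x, 0 <= t -> 0 <= dot x (Q t *m x).
Hypothesis sRi : forall t : R, 0 <= t -> (Ri t)^T = Ri t.
Hypothesis r30 : 0 < r3.
Hypothesis hr3 : forall (t : R) u, 0 <= t -> r3 * sqn (Ri t *m u) <= dot u (Ri t *m u).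
Hypothesis r40 : 0 < r4.
(** The supremum over [u] of the left side is v^T R v when [Ri] is the inverse of R: an upper bound
    on R stated through its inverse. *)
Hypothesis hr4 : forall (t : R) u v, 0 <= t ->
  - 2 * dot v u - dot u (Ri t *m u) <= r4 * sqn v.
Hypothesis sP0 : (P 0)^T = P 0.
Hypothesis pP0 : forall x, 0 <= dot x (P 0 *m x).
Hypothesis dP : is_sol (fun t (S : 'M[R]_n) => S *m (A t)^T + A t *m S
  - S *m (C t)^T *m Ri t *m C t *m S + Q t) `[0, +oo[ P.

Let dPE s t : 0 <= s -> evol s t P (fun r => P r *m (A r)^T + A r *m P r
  - P r *m (C r)^T *m Ri r *m C r *m P r + Q r).
Proof. by move=> s0; exact: is_sol_evoly dP s0. Qed.

Let cP : {within `[0, +oo[, continuous P}.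
Proof. by have [h _] := dP. Qed.

Let N t := (C t)^T *m Ri t *m C t.

Let cN : {within `[0, +oo[, continuous N}.
Proof. by apply: within_mulmx => //; apply: within_mulmx => //; exact: within_trmx. Qed.

(* [P^T - P] solves a linear homogeneous equation and vanishes at 0. *)
Lemma riccati_sym (t : R) : 0 <= t -> (P t)^T = P t.
Proof.
move=> t0.
have sN r : 0 <= r -> (N r)^T = N r.
  by move=> r0; rewrite /N !trmx_mul trmxK sRi// mulmxA.
pose M1 r := A r - (P r)^T *m N r; pose M2 r := (A r)^T - N r *m P r.
have cM1 : {within `[0, +oo[, continuous M1}.
  exact: within_addmx cA (within_oppmx (within_mulmx (within_trmx cP) cN)).
have cM2 : {within `[0, +oo[, continuous (fun r => - M2 r)}.
  exact: within_oppmx (within_addmx (within_trmx cA) (within_oppmx (within_mulmx cN cP))).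
have [Z1 [G1 [_ dG1 GZ1]]] := fundamental_matrix t0 (within_sub_itvy (lexx _) cM1).
have [Z2 [G2 [dZ2 _ GZ2]]] := fundamental_matrix t0 (within_sub_itvy (lexx _) cM2).
have dD : evol 0 t (fun r => (P r)^T - P r)
    (fun r => M1 r *m ((P r)^T - P r) + ((P r)^T - P r) *m M2 r).
  apply: evol_eq (evolB (evol_trmx (dPE t (lexx 0))) (dPE t (lexx 0))) => r /andP[r0 _].
  rewrite !linearD/= linearN/= !trmx_mul !trmxK sQ ?sRi ?ltW//.
  have -> : (P r)^T *m ((C r)^T *m (Ri r *m (C r *m (P r)^T))) = (P r)^T *m N r *m (P r)^T.
    by rewrite /N !mulmxA.
  have -> : P r *m (C r)^T *m Ri r *m C r *m P r = P r *m N r *m P r.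
    by rewrite /N !mulmxA.
  rewrite /M1 /M2 !(mulmxBl, mulmxN, mulNmx, mulmxA).
  move: (A r *m (P r)^T) ((P r)^T *m (A r)^T) ((P r)^T *m N r *m (P r)^T).
  move: (P r *m (A r)^T) (A r *m P r) (P r *m N r *m P r) ((P r)^T *m N r *m P r).
  move=> x1 x2 x3 x4 x5 x6 x7.
  by apply/matrixP => i j; rewrite !mxE; ring.
have := evol_mulmx (evol_mulmx dG1 dD) dZ2 => /(evol_cst_eq_mx t0) h.
have : G1 0 *m ((P 0)^T - P 0) *m Z2 0 = G1 t *m ((P t)^T - P t) *m Z2 t.
  apply: h => r _; move: ((P r)^T - P r) (M1 r) (M2 r) => X1 X2 X3.
  by rewrite !(mulmxDl, mulmxDr, mulNmx, mulmxN, mulmxA) addKr subrr.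
rewrite sP0 subrr mulmx0 mul0mx => /esym h2.
have tt : 0 <= t <= t by rewrite t0 lexx.
have := congr1 (fun X => Z1 t *m X *m G2 t) h2.
rewrite mulmx0 mul0mx !mulmxA (mulmx1C (GZ1 t tt)) mul1mx -mulmxA.
by rewrite (mulmx1C (GZ2 t tt)) mulmx1 => /eqP; rewrite subr_eq0 => /eqP.
Qed.

(* [P] is the cost-to-go of the dual regulator: the energy balance of [l' = - A^T l + f]. *)
Lemma riccati_energy (s t : R) (l f : R -> 'cV[R]_n) : 0 <= s ->
  evol s t l (fun r => - ((A r)^T *m l r) + f r) ->
  evol s t (fun r => dot (l r) (P r *m l r)) (fun r =>
    dot (l r) (Q r *m l r)
    - dot (C r *m (P r *m l r)) (Ri r *m (C r *m (P r *m l r)))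
    + 2 * dot (f r) (P r *m l r)).
Proof.
move=> s0 dl; apply: evol_eq (evol_dot dl (evol_mulmx (dPE t s0) dl)) => r /andP[sr _].
have r0 : 0 <= r by apply: le_trans s0 (ltW sr).
have sP := riccati_sym r0.
have PP x y : dot x (P r *m y) = dot (P r *m x) y by rewrite dot_trmx sP.
rewrite !mulmxDl mulNmx !dotDr dotDl mulmxDr dotDr !dotNr dotNl mulmxN dotNr -!mulmxA.
rewrite (PP (l r) ((A r)^T *m l r)) (PP (l r) (f r)).
rewrite (PP (l r) ((C r)^T *m _)) (dot_trmx (A r)).
rewrite (dot_trmx (C r)^T) trmxK.
rewrite (dotC (P r *m l r) ((A r)^T *m l r)) (dotC (P r *m l r) (f r)).
ring.
Qed.

(* [adj]: [l] solves the adjoint [l' = - (A - L C)^T l] of the observer error equation. *)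
Let adj s t (l : R -> 'cV[R]_n) := evol s t l
  (fun r => - ((A r)^T *m l r) + (C r)^T *m (Ri r *m (C r *m (P r *m l r)))).

Let E (l : R -> 'cV[R]_n) r := dot (l r) (P r *m l r).

(** The feedback [f] contributes twice the output term of [riccati_energy], which reverses its sign:
    both terms of the rate are nonnegative. *)
Let adj_energy s t l : 0 <= s -> adj s t l ->
  evol s t (E l) (fun r => dot (l r) (Q r *m l r) +
    dot (C r *m (P r *m l r)) (Ri r *m (C r *m (P r *m l r)))).
Proof.
move=> s0 dl; apply: evol_eq (riccati_energy s0 dl) => r _.
rewrite -dot_trmx; set u := C r *m _; rewrite (dotC (Ri r *m u)); ring.
Qed.

Let Ri_ge0 t u : 0 <= t -> 0 <= dot u (Ri t *m u).
Proof.
by move=> t0; apply: le_trans (hr3 u t0); rewrite mulr_ge0 ?sqn_ge0// ltW.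
Qed.

Let adj_mono s t l : 0 <= s -> s <= t -> adj s t l -> E l s <= E l t.
Proof.
move=> s0 st dl; apply: (evol_ndecr st (adj_energy s0 dl)) => r /andP[sr _].
have r0 : 0 <= r by apply: le_trans s0 (ltW sr).
by rewrite addr_ge0 ?pQ ?Ri_ge0.
Qed.

Let adj_final s t v : 0 <= s -> s <= t -> exists l, l t = v /\ adj s t l.
Proof.
move=> s0 st.
have cS : {within `[s, t], continuous (fun r => - (A r)^T + N r *m P r)}.
  apply: (@within_sub_itvy R _ _ 0) => //; apply: within_addmx; last exact: within_mulmx.
  exact/within_oppmx/within_trmx.
have [l [lt dl]] := final_value v st cS; exists l; split=> //.
by apply: evol_eq dl => r _; rewrite mulmxDl mulNmx /N !mulmxA.
Qed.

(** Semidefiniteness is carried over from time 0, since [E] is nondecreasing along the adjoint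
    solution that ends at [x]. *)
Lemma riccati_psd (t : R) x : 0 <= t -> 0 <= dot x (P t *m x).
Proof.
move=> t0; have [l [<- dl]] := adj_final x (lexx 0) t0.
by apply: le_trans (adj_mono (lexx 0) t0 dl); exact: pP0.
Qed.

(** * Dissipation, bounds on P and contraction of the observer error *)

Section bounds.
Variables (sg al q2 : R).
Hypothesis sg0 : 0 < sg.
Hypothesis al0 : 0 < al.
Hypothesis q20 : 0 <= q2.
Hypothesis ctrl_lower : forall (t : R) (y : R -> 'cV[R]_n) (U dU : R -> R), 0 <= t ->
  evol t (t + sg) y (fun s => - ((A s)^T *m y s)) -> evol t (t + sg) U dU ->
  (forall s, t < s < t + sg -> dot (y s) (Q s *m y s) <= dU s) ->
  al * sqn (y (t + sg)) <= U (t + sg) - U t.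
Hypothesis ctrl_upper : forall (t r : R) (x : R -> 'cV[R]_n) (f df : R -> R) K,
  0 <= t -> t <= r -> r <= t + sg -> 0 <= K -> evol t r f df ->
  (forall s, t < s < r -> df s <= dot (x s) (Q s *m x s) /\ sqn (x s) <= K) ->
  f r - f t <= K * q2.

(* [l = y + w] with [y' = - A^T y] and [y = l] at the right end of the window: a small energy
   increment forces [w] to be small, whereas controllability bounds the energy along [y] from below. *)
Lemma riccati_dissipation : exists2 c1 : R, 0 < c1 & forall t l, 0 <= t ->
  adj t (t + sg) l -> c1 * sqn (l (t + sg)) <= E l (t + sg) - E l t.
Proof.
(* [w] vanishes at the right end, and [k] will bound its square by the energy increment; [kp] is its
   backward growth rate, one unit of which pays for the forcing. *)
pose kp := 2 + a; pose k := c / r3 * expR (kp * sg).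
have k0 : 0 <= k by rewrite mulr_ge0 ?expR_ge0// divr_ge0 ?ltW.
have D0 : 0 < 2 + 2 * (k * q2) by have := mulr_ge0 k0 q20; lra.
(* With [J] the energy increment, al |l|^2 <= 2 J + 2 k J q2, the last term being due to [w]. *)
exists (al / (2 + 2 * (k * q2))); first exact: divr_gt0.
move=> t l t0 dl; pose b := t + sg.
have tb : t < b by rewrite ltrDl.
have cAT : {within `[t, b], continuous (fun r => - (A r)^T)}.
  exact: within_sub_itvy t0 (within_oppmx (within_trmx cA)).
have [y [yb dy]] := final_value (l b) (ltW tb) cAT.
have dy' : evol t b y (fun s => - ((A s)^T *m y s)).
  by apply: evol_eq dy => s _; rewrite mulNmx.
pose w r := l r - y r; pose y' r := Ri r *m (C r *m (P r *m l r)).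
have dw : evol t b w (fun r => - ((A r)^T *m w r) + (C r)^T *m y' r).
  by apply: evol_eq (evolB dl dy') => r _; rewrite /w mulmxBr opprB opprK addrAC [in LHS](addrC (- _)).
have dE := adj_energy t0 dl.
pose J := E l b - E l t.
have J0 : 0 <= J by rewrite subr_ge0 adj_mono// ltW.
have wJ r : t <= r -> r <= b -> sqn (w r) <= k * J.
  move=> tr rb; have r0 := le_trans t0 tr.
  (* Gronwall with the energy in place of the integrated forcing: C^T y' has no pointwise bound at
     this stage, but its square is at most [c / r3] times the energy rate. *)
  have hw := evolM (evol_sqn (evol_sub tr (lexx b) dw)) (evol_expR r b kp b).
  have hE := evolZ (c / r3) (evol_sub tr (lexx b) dE).
  have h := evol_ndecr rb (evolD hw hE).
  have {}h : sqn (w r) * expR (kp * (r - b)) + c / r3 * E l r <=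
             sqn (w b) * expR (kp * (b - b)) + c / r3 * E l b.
    apply: h => x /andP[rx xb]; have x0 : 0 <= x by apply: le_trans r0 (ltW rx).
    have e1 : expR (kp * (x - b)) <= 1.
      by rewrite -expR0 ler_expR mulr_ge0_le0 ?addr_ge0 ?(ltW a0)// subr_le0 ltW.
    have e0 : 0 <= expR (kp * (x - b)) by exact: expR_ge0.
    rewrite dotDr dotNr; set e := expR _ in e1 e0 *.
    have h1 := dot_opb (w x) (opb_tr a0 (opA x0)).
    have h2 := dot_youngN (w x) ((C x)^T *m y' x).
    have h3 := opb_tr c0 (opC x0) (y' x).
    have h4 := hr3 (C x *m (P x *m l x)) x0.
    have h5 := pQ (l x) x0.
    have h6 := sqn_ge0 (w x).
    set dEx := _ + dot (C x *m _) _.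
    have h7 : c * sqn (y' x) <= c / r3 * dEx.
      rewrite -mulrA ler_pM2l// ler_pdivlMl// /dEx /y'; lra.
    have h8 : 0 <= c / r3 * dEx.
      by apply: le_trans h7; rewrite mulr_ge0 ?sqn_ge0// ltW.
    have h9 := ler_wpM2r h8 e1.
    have h10 : - (c / r3 * dEx) <= 2 * (- dot (w x) ((A x)^T *m w x) +
       dot (w x) ((C x)^T *m y' x)) + kp * sqn (w x) by rewrite /kp; lra.
    have := ler_wpM2r e0 h10; lra.
  have wb : w b = 0 by rewrite /w yb subrr.
  move: h; rewrite wb sqn0 mul0r add0r => h.
  have Er : E l t <= E l r by apply: adj_mono => //; exact: evol_sub (lexx _) rb dl.
  have cr : 0 <= c / r3 by rewrite divr_ge0 ?ltW.
  have {}h : sqn (w r) * expR (kp * (r - b)) <= c / r3 * J.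
    have := ler_wpM2l cr Er; rewrite /J; lra.
  have -> : sqn (w r) = sqn (w r) * expR (kp * (r - b)) * expR (kp * (b - r)).
    by rewrite -mulrA -expRD -mulrDr addrA subrK subrr mulr0 expR0 mulr1.
  rewrite /k [leRHS]mulrAC; apply: ler_pM => //.
  - by rewrite mulr_ge0 ?sqn_ge0 ?expR_ge0.
  - rewrite ler_expR ler_wpM2l ?addr_ge0 ?(ltW a0)//.
    by rewrite lerBlDr /b; lra.
have cw : {within `[t, b], continuous (fun r => dot (w r) (Q r *m w r))}.
  have cw := evol_within dw.
  by apply: within_dot => //; apply: within_mulmx => //; exact: within_sub_itvy cQ.
have [W [dW _]] := within_primitive tb cw.
have hW : W b - W t <= k * J * q2.
  apply: (ctrl_upper (x := w) t0 (ltW tb) (lexx _) _ dW); first exact: mulr_ge0.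
  by move=> s /andP[ts sb]; split=> //; apply: wJ; exact: ltW.
(* As [y = l - w], the [Q]-form at [y] is at most twice the one at [l] plus twice the one at [w]. *)
have dU := evolD (evolZ 2 dE) (evolZ 2 dW).
have := ctrl_lower t0 dy' dU; rewrite -/b yb => h.
have {}h : al * sqn (l b) <= 2 * E l b + 2 * W b - (2 * E l t + 2 * W t).
  apply: h => s /andP[ts sb]; have s0 : 0 <= s by apply: le_trans t0 (ltW ts).
  have := pQ (l s + w s) s0.
  have -> : y s = l s - w s by rewrite /w opprB addrC subrK.
  have := Ri_ge0 (C s *m (P s *m l s)) s0; cbv beta; move: (w s) => x.
  rewrite mulmxBr mulmxDr !dotDl !dotDr !dotNl !dotNr opprK; lra.
rewrite mulrAC ler_pdivrMr// -/b -/J; move: h hW; rewrite /J; lra.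
Qed.

(** The observability window may be longer than the controllability window, so the mean bound on [Q]
    is applied [m] times. *)
Let ctrl_upper_chain (m : nat) (t r : R) (x : R -> 'cV[R]_n) (f df : R -> R) K :
  0 <= t -> t <= r -> r <= t + m%:R * sg -> 0 <= K -> evol t r f df ->
  (forall s, t < s < r -> df s <= dot (x s) (Q s *m x s) /\ sqn (x s) <= K) ->
  f r - f t <= m%:R * (K * q2).
Proof.
elim: m t => [|m IH] t t0 tr rm K0 hf hd.
  have -> : r = t by apply/eqP; rewrite eq_le tr andbT; move: rm; rewrite mul0r addr0.
  by rewrite subrr mul0r.
have Kq : 0 <= K * q2 by rewrite mulr_ge0.
have [rt|tr'] := leP r (t + sg).
  apply: (le_trans (ctrl_upper t0 tr rt K0 hf hd)).
  by rewrite ler_peMl// ler1n.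
have tts : t <= t + sg by rewrite lerDl ltW.
have h1 : f (t + sg) - f t <= K * q2.
  apply: (ctrl_upper t0 tts (lexx _) K0 (evol_sub (lexx _) (ltW tr') hf)).
  by move=> s /andP[ts st]; apply: hd; rewrite ts (lt_trans st).
have h2 : f r - f (t + sg) <= m%:R * (K * q2).
  apply: IH => //; [exact: le_trans tts|exact: ltW| | exact: evol_sub hf|].
    by move: rm; rewrite -addn1 natrD; lra.
  by move=> s /andP[ts st]; apply: hd; rewrite (le_lt_trans tts).
rewrite -addn1 natrD; lra.
Qed.

(* Observability provides a control steering the dual state from 0 to [x] over a window of
   length [ell]; its cost bounds [x^T P x], whatever [P] is at the start of the window. *)
Lemma riccati_upper : uniformly_completely_observable A C ->
  exists ell p2 : R, [/\ 0 < ell, 0 < p2 & forall t x, 0 <= t ->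
    dot x (P (t + ell) *m x) <= p2 * sqn x].
Proof.
move=> [Phi hPhi [ell [b1 [b2 [b3 [b4 [[ell0 b10 _ _ _] hV]]]]]]].
pose m := (Num.truncn (ell / sg)).+1.
have hm : ell <= m%:R * sg.
  by rewrite -ler_pdivrMr// ltW// /m; exact: truncnS_gt.
pose e1 := expR ((2 + a) * ell).
have e10 : 0 < e1 by exact: expR_gt0.
(* [e1] bounds the square of the transition matrix; relative to |x|^2, [z1], [v1] and [k1] bound the
   squares of the parameter [zt], the control [w] and the trajectory [l]. *)
pose z1 := e1 / b1 ^+ 2; pose v1 := c * e1 * z1; pose k1 := c * v1 * ell * e1.
have z10 : 0 < z1 by rewrite divr_gt0 ?exprn_gt0.
have v10 : 0 < v1 by apply: mulr_gt0 => //; exact: mulr_gt0.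
have k10 : 0 < k1 by do 2!(apply: mulr_gt0 => //); exact: mulr_gt0.
exists ell, (m%:R * (k1 * q2) + r4 * v1 * ell); split=> //.
  have := mulr_gt0 (mulr_gt0 r40 v10) ell0.
  by have := mulr_ge0 (ler0n R m) (mulr_ge0 (ltW k10) q20); lra.
move=> t x t0; pose b := t + ell.
have tb : t < b by rewrite ltrDl.
have tt : t <= t <= b by rewrite lexx ltW.
have bb : t <= b <= b by rewrite lexx ltW.
have [Z [G [dZ dG GZ]]] := fundamental_matrix (ltW tb) (within_sub_itvy t0 cA).
have ZG r : t <= r <= b -> Z r *m G r = 1%:M by move=> h; exact/mulmx1C/GZ.
(* [Y1] is the transition matrix from time [t] and [X] its inverse, both with known derivatives. *)
pose Y1 r := Z r *m G t; pose X r := Z t *m G r.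
have dY1 : evol t b Y1 (fun r => A r *m Y1 r).
  by apply: evol_eq (evol_mulmxr (G t) dZ) => r _; rewrite mulmxA.
have dX : evol t b X (fun r => - (X r *m A r)).
  by apply: evol_eq (evol_mulmxl (Z t) dG) => r _; rewrite mulmxN mulmxA.
have Y1X r : t <= r <= b -> Y1 r *m X r = 1%:M.
  move=> h; rewrite /Y1 /X mulmxA -(mulmxA (Z r)) (GZ t)// mulmx1; exact: ZG.
have Y1t : Y1 t = 1%:M by rewrite /Y1 ZG.
have dX' : evol t b (fun r => (X r)^T) (fun r => - ((A r)^T *m (X r)^T)).
  by apply: evol_eq (evol_trmx dX) => r _; rewrite linearN/= trmx_mul.
have opY r : t <= r <= b -> opb e1 (Y1 r).
  move=> /andP[tr rb] v.
  have dYv := evol_mulmxr v (evol_sub (lexx t) rb dY1).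
  have dYv' : evol t r (fun s => Y1 s *m v) (fun s => A s *m (Y1 s *m v) + 0).
    by apply: evol_eq dYv => s _; rewrite mulmxA addr0.
  have := linear_growth tr (ltW a0) (lexx 0) _ dYv' => h.
  apply: le_trans (h _ _) _.
  - by move=> s /andP[ts _]; apply: opA; rewrite (le_trans t0)// ltW.
  - by move=> s _; rewrite sqn0.
  rewrite mul0r addr0 Y1t mul1mx mulrC ler_wpM2r ?sqn_ge0//.
  by rewrite ler_expR ler_wpM2l ?addr_ge0 ?(ltW a0)// lerBlDl.
clearbody Y1 X.
pose M r := (Y1 r)^T *m ((C r)^T *m (C r *m Y1 r)).
have cY1 := evol_within dY1; have cCb := @within_sub_itvy R _ _ 0 t b t0 cC.
have cM : {within `[t, b], continuous M}.
  apply: within_mulmx; first exact: within_trmx.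
  by apply: within_mulmx; [exact: within_trmx|exact: within_mulmx].
have [Ob [Obt dOb]] := primitive_mx t (0 : 'M[R]_n) (clamp_continuousW (ltW tb) cM).
have {}dOb : evol t b Ob M.
  apply: evol_eq (evol_derive t b dOb) => r /andP[tr rb] /=.
  by rewrite clamp_id// !ltW.
have Mq r v : dot v (M r *m v) = sqn (C r *m (Y1 r *m v)).
  by rewrite /M -!mulmxA dot_trmx trmxK dot_trmx trmxK.
have Ob_lower v : b1 * sqn v <= dot v (Ob b *m v).
  have [iV hb1 _ _ _] := hV t t0.
  have [iq qE] := quad_integral v iV.
  have := hb1 v; rewrite !qformE dot_scalar -qE => /le_trans; apply.
  have cg : {within `[t, b], continuous (fun s => sqn (C s *m (Y1 s *m v)))}.
    have cYv : {within `[t, b], continuous (fun s => C s *m (Y1 s *m v))}.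
      apply: within_mulmx => //; apply: within_mulmx => // s; exact: cvg_cst.
    exact: within_dot.
  have dU := evol_dot (evol_cst t b v) (evol_mulmxr v dOb).
  have := integral_le_evol tb iq cg _ dU; rewrite Obt mul0mx dot0r subr0; apply.
  - move=> s tsb; rewrite /obs_integrand -!mulmxA dot_trmx trmxK dot_trmx trmxK.
    have dYv : evol t b (fun s => Y1 s *m v) (fun s => A s *m (Y1 s *m v)).
      by apply: evol_eq (evol_mulmxr v dY1) => z _; rewrite mulmxA.
    by rewrite (transition_primal hPhi t0 cA dYv tsb) Y1t mul1mx.
  - by move=> s _; rewrite /dot trmx0 mul0mx mxE add0r -[leRHS]/(dot v (M s *m v)) Mq.
have Ob_sqn v : b1 ^+ 2 * sqn v <= sqn (Ob b *m v).
  have := dot_young (b1 *: v) (Ob b *m v); rewrite dotZl sqnZ.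
  have := ler_wpM2l (ltW b10) (Ob_lower v); rewrite expr2 mulrA; lra.
have uOb : Ob b \in unitmx.
  apply: inj_unitmx => v Ov; apply/sqn_eq0/eqP; rewrite eq_le sqn_ge0 andbT.
  by have := Ob_sqn v; rewrite Ov sqn0 pmulr_rle0// exprn_gt0.
(* Minimum-energy control: [Ob b] is the observability Gramian of the window, and with this
   parameter the control [w = C Y1 zt] brings [l] to [x] at time [b]. *)
pose zt := invmx (Ob b) *m ((Y1 b)^T *m x).
have Obz : Ob b *m zt = (Y1 b)^T *m x by rewrite /zt mulKVmx.
have zE : sqn zt <= z1 * sqn x.
  have := Ob_sqn zt; rewrite Obz => h.
  rewrite /z1 mulrAC ler_pdivlMr ?exprn_gt0// mulrC (le_trans h)//.
  exact: opb_tr e10 (opY b bb) x.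
pose l r := (X r)^T *m (Ob r *m zt).
pose w r := C r *m (Y1 r *m zt).
have dl : evol t b l (fun r => - ((A r)^T *m l r) + (C r)^T *m w r).
  apply: evol_eq (evol_mulmx dX' (evol_mulmxr zt dOb)) => r /andP[tr rb].
  rewrite /l /w /M mulNmx -!mulmxA; congr (_ + _).
  by rewrite (mulmxA (X r)^T) -trmx_mul Y1X ?ltW// trmx1 mul1mx.
have wE r : t <= r <= b -> sqn (w r) <= v1 * sqn x.
  move=> /[dup] trb /andP[tr _]; have r0 := le_trans t0 tr.
  have h1 := opC r0 (Y1 r *m zt); have h2 := opY r trb zt.
  have h3 := le_trans h2 (ler_wpM2l (ltW e10) zE).
  by apply: (le_trans h1); rewrite /v1 -2!mulrA ler_wpM2l// ltW.
have lt : l t = 0 by rewrite /l Obt mul0mx mulmx0.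
have lb : l b = x.
  by rewrite /l Obz mulmxA -trmx_mul Y1X// trmx1 mul1mx.
have lE r : t < r < b -> sqn (l r) <= k1 * sqn x.
  move=> /andP[tr rb].
  have dl' : evol t r l (fun s => - (A s)^T *m l s + (C s)^T *m w s).
    by apply: evol_eq (evol_sub (lexx _) (ltW rb) dl) => s _; rewrite mulNmx.
  have cv0 : 0 <= c * (v1 * sqn x).
    by apply: mulr_ge0 (ltW c0) (mulr_ge0 (ltW v10) (sqn_ge0 x)).
  have h := linear_growth (ltW tr) (ltW a0) cv0 _ dl'.
  apply: le_trans (h _ _) _.
  - move=> s /andP[ts _]; apply/opbN/opb_tr => //; apply: opA.
    by rewrite (le_trans t0)// ltW.
  - move=> s /andP[ts sr]; have s0 : 0 <= s by apply: le_trans t0 (ltW ts).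
    apply: (le_trans (opb_tr c0 (opC s0) _)); rewrite ler_pM2l//; apply: wE.
    by rewrite (ltW ts) ltW// (lt_trans sr).
  rewrite lt sqn0 add0r (_ : k1 * sqn x = c * (v1 * sqn x) * ell * e1); last first.
    by rewrite /k1; ring.
  have rl : r - t <= ell by rewrite lerBlDl ltW.
  apply: ler_pM.
  - by rewrite mulr_ge0// subr_ge0 ltW.
  - exact: expR_ge0.
  - by rewrite ler_wpM2l.
  - by rewrite ler_expR ler_wpM2l// addr_ge0// ltW.
have dE := riccati_energy t0 dl.
(* By completing the square ([hr4]), the control and output terms add at most [r4] |w|^2 to the
   energy rate. Once this cost is subtracted, the rate is at most the [Q]-form at [l]. *)
have df := evolB dE (evol_affine t b (r4 * (v1 * sqn x)) t).
have := ctrl_upper_chain (m := m) (x := l) (K := k1 * sqn x) t0 (ltW tb) _ _ df.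
rewrite lb lt mulmx0 dot0r !subrr mulr0 subr0 => h.
have {}h : dot x (P b *m x) - r4 * (v1 * sqn x) * (b - t) <= m%:R * (k1 * sqn x * q2).
  rewrite -[leLHS]subr0; apply: h => [||s tsb].
  - by rewrite /b lerD2l.
  - by rewrite mulr_ge0 ?sqn_ge0// ltW.
  - split; last exact: lE.
    have /andP[ts sb] := tsb; have s0 : 0 <= s by apply: le_trans t0 (ltW ts).
    have := hr4 (C s *m (P s *m l s)) (- w s) s0; rewrite dotNl sqnN.
    rewrite -dot_trmx; have := wE s; rewrite (ltW ts) (ltW sb) => /(_ isT).
    by rewrite -(ler_pM2l r40); lra.
have bt : b - t = ell by rewrite /b; ring.
move: h; rewrite bt; lra.
Qed.

(** Before time [ell], [P] is bounded by continuity on a compact interval; after it, by [hp2] and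
    semidefiniteness through [psd_opb]. *)
Lemma riccati_bounded (ell p2 : R) : 0 <= ell -> 0 < p2 ->
  (forall t x, 0 <= t -> dot x (P (t + ell) *m x) <= p2 * sqn x) ->
  exists2 pb : R, 0 < pb & forall t, 0 <= t -> opb pb (P t).
Proof.
move=> ell0 p20 hp2.
have [K hK] := within_continuous_bounded ell0 (within_sub_itvy (lexx 0) cP).
exists (n%:R * (n%:R * K) ^+ 2 + p2 ^+ 2).
  by rewrite ltr_wpDl ?exprn_gt0// mulr_ge0 ?sqr_ge0.
move=> t t0; have [tl|lt] := leP t ell.
  apply: opb_le (opb_norm (hK t _)); first by rewrite lerDl sqr_ge0.
  by rewrite t0.
apply: (@opb_le _ _ _ (p2 ^+ 2)); first by rewrite lerDr mulr_ge0 ?sqr_ge0.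
apply: psd_opb => //; [exact: riccati_sym|by move=> x; exact: riccati_psd|].
by move=> x; rewrite -(subrK ell t); apply: hp2; rewrite subr_ge0 ltW.
Qed.

(* The energy decays geometrically backward in time along the adjoint equation, and the pairing
   with a solution of the observer error equation is constant. *)
Lemma observer_contracts (ell p2 : R) : 0 < ell -> 0 < p2 ->
  (forall t x, 0 <= t -> dot x (P (t + ell) *m x) <= p2 * sqn x) ->
  contracts (fun t => A t - P t *m (C t)^T *m Ri t *m C t) (sg + ell).
Proof.
move=> ell0 p20 hp2 k k0.
have [c1 c10 hc1] := riccati_dissipation.
(* Enlarging [p2] by [c1] makes [rho] nonnegative. *)
pose pm := p2 + c1; have pm0 : 0 < pm by rewrite addr_gt0.
pose rho := 1 - c1 / pm.
have rho0 : 0 <= rho by rewrite subr_ge0 ler_pdivrMr// mul1r lerDr ltW.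
have rho1 : rho < 1 by rewrite gtrBl divr_gt0.
have hE s l : sg + ell <= s -> adj s (s + sg) l -> E l s <= rho * E l (s + sg).
  move=> hs dl; have s0 : 0 <= s by apply: le_trans hs; rewrite addr_ge0// ltW.
  have h1 := hc1 s l s0 dl.
  have h2 : E l (s + sg) <= pm * sqn (l (s + sg)).
    have := hp2 (s + sg - ell) (l (s + sg)); rewrite subrK => h.
    apply: (le_trans (h _)); first by have := ltW sg0; have := ltW ell0; lra.
    by rewrite ler_wpM2r ?sqn_ge0// lerDl ltW.
  have h3 : c1 / pm * E l (s + sg) <= c1 * sqn (l (s + sg)).
    by rewrite -mulrA ler_pM2l// ler_pdivrMl.
  rewrite /rho mulrBl mul1r; lra.
(* Dissipation over the preceding window, which starts with nonnegative energy, makes [P] uniformly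
   positive from time [sg] on, however degenerate [P 0] is. *)
have hlow s x : sg <= s -> c1 * sqn x <= dot x (P s *m x).
  move=> hs; have s0 : 0 <= s - sg by rewrite subr_ge0.
  have [|l [ls dl]] := @adj_final (s - sg) s x s0; first by rewrite gerBl ltW.
  have := hc1 (s - sg) l s0; rewrite subrK => /(_ dl).
  have := riccati_psd (l (s - sg)) s0; rewrite /E ls; lra.
have hEm m s l : sg + ell <= s -> adj s (s + m%:R * sg) l ->
    E l s <= rho ^+ m * E l (s + m%:R * sg).
  elim: m s => [|m IH] s hs dl; first by rewrite mul0r addr0 expr0 mul1r.
  have ssg : s <= s + sg by rewrite lerDl ltW.
  have mS : s + m.+1%:R * sg = s + sg + m%:R * sg by rewrite -addn1 natrD; ring.
  rewrite mS in dl *; have msg : 0 <= m%:R * sg by rewrite mulr_ge0// ltW.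
  have ssm : s + sg <= s + sg + m%:R * sg by rewrite lerDl.
  have h1 := hE s l hs (evol_sub (lexx _) ssm dl).
  have h2 := IH (s + sg) (le_trans hs ssg) (evol_sub ssg (lexx _) dl).
  by apply: (le_trans h1); rewrite exprS -mulrA ler_wpM2l.
have [m hm] := exp_small rho0 rho1 (divr_gt0 (mulr_gt0 k0 c10) pm0).
(* The successor keeps this length positive when [m = 0]. *)
exists (m.+1%:R * sg); first by rewrite mulr_gt0.
move=> T s y hT hs dy.
have mT : m%:R * sg <= T.
  by apply: le_trans hT; rewrite ler_pM2r// ler_nat.
have sgT : sg <= T.
  by apply: le_trans hT; rewrite ler_peMl ?ler1n// ltW.
have T0 : 0 <= T by apply: le_trans sgT; exact: ltW.
have s0 : 0 <= s by apply: le_trans hs; rewrite addr_ge0// ltW.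
have sT : s <= s + T by rewrite lerDl.
have msg : 0 <= m%:R * sg by rewrite mulr_ge0// ltW.
(* With this final value, the constant pairing of [l] with [y] equals the squared norm of
   [y (s + T)]. *)
have [l [lT dl]] := adj_final (y (s + T)) s0 sT.
have smT : s + m%:R * sg <= s + T by rewrite lerD2l.
have h1 := hEm m s l hs (evol_sub (lexx _) smT dl).
have h2 : E l (s + m%:R * sg) <= E l (s + T).
  apply: adj_mono => //; first by rewrite addr_ge0.
  by apply: evol_sub dl => //; rewrite lerDl.
have h3 : E l (s + T) <= pm * sqn (l (s + T)).
  have := hp2 (s + T - ell) (l (s + T)); rewrite subrK => h.
  apply: (le_trans (h _)); first by have := ltW sg0; lra.
  by rewrite ler_wpM2r ?sqn_ge0// lerDl ltW.
have h4 : c1 * sqn (l s) <= E l s.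
  by apply: hlow; apply: le_trans hs; rewrite lerDl ltW.
have h5 : sqn (l s) <= k * sqn (y (s + T)).
  rewrite -(ler_pM2l c10); apply: (le_trans h4); apply: (le_trans h1).
  have rm0 : 0 <= rho ^+ m by exact: exprn_ge0.
  apply: (le_trans (ler_wpM2l rm0 (le_trans h2 h3))); rewrite lT mulrA.
  have := ler_wpM2r (ltW pm0) hm; rewrite divfK ?gt_eqF// => h6.
  by rewrite [leRHS]mulrA (mulrC c1) ler_wpM2r ?sqn_ge0.
have dual : dot (l s) (y s) = dot (l (s + T)) (y (s + T)).
  apply: (evol_cst_eq sT (evol_dot dl dy)) => r /andP[sr _].
  have r0 : 0 <= r by apply: le_trans s0 (ltW sr).
  rewrite mulmxBl dotDl dotDr dotNl dotNr -!mulmxA.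
  rewrite (dot_trmx (A r)) (dot_trmx (P r)) (riccati_sym r0).
  rewrite (dot_trmx (C r)^T) trmxK (dot_trmx (Ri r)) (sRi r0) (dot_trmx (C r)).
  ring.
rewrite lT -/(sqn _) in dual.
(* Writing Y for the squared norm of [y (s + T)], Young's inequality gives 2k Y <= k Y + k^2
   |y(s)|^2. *)
have := dot_young (l s) (k *: y s); rewrite dotZr sqnZ dual => h6.
rewrite -(ler_pM2l k0) -(ler_pM2l (ltr0Sn R 1)); move: h5 h6; rewrite expr2 /sqn; lra.
Qed.

Lemma observer_stability : uniformly_completely_observable A C ->
  (exists2 pb : R, 0 < pb & forall t, 0 <= t -> opb pb (P t)) /\
  exists2 s0 : R, 0 <= s0 &
    contracts (fun t => A t - P t *m (C t)^T *m Ri t *m C t) s0.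
Proof.
move=> /riccati_upper[ell [p2 [ell0 p20 hp2]]]; split.
  exact: riccati_bounded (ltW ell0) p20 hp2.
exists (sg + ell); first by rewrite addr_ge0// ltW.
exact: observer_contracts ell0 p20 hp2.
Qed.

End bounds.
End riccati.

(** * Data along the reference *)

Section boundedness.
Context {R : realType}.

Lemma cV_ball_compact n (K : R) : compact [set v : 'cV[R]_n | `|v| <= K].
Proof.
have [K0|K0] := ltP K 0.
  rewrite (_ : [set v | _] = set0); first exact: compact0.
  rewrite -subset0 => v /= h; have := normr_ge0 v; lra.
have -> : [set v : 'cV[R]_n | `|v| <= K] = trmx @`
    [set v : 'rV[R]_n | forall i, v ord0 i \in `[- K, K]].
  apply/seteqP; split=> [v /= vK|_ [v /= hv <-]].
    exists v^T; last by rewrite trmxK.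
    by move=> i /=; rewrite mxE in_itv/= -ler_norml (le_trans (mx_norm_entry v i 0)).
  rewrite mx_norm_le//; apply/forallP => i; apply/forallP => j.
  by rewrite (ord1 j) mxE ler_norml; have := hv i; rewrite in_itv.
apply: continuous_compact.
  by apply: continuous_subspaceT => v; exact: (@cvg_trmx _ _ (nbhs v) _ _ _ id v cvg_id).
apply: (@rV_compact _ _ (fun=> `[(- K), K]%classic)).
by move=> _; exact: segment_compact.
Qed.

Lemma bounded_nearP {V : normedModType R} (f : R -> V) :
  [bounded f t | t in `[0, +oo[%classic] -> exists K, forall t, 0 <= t -> `|f t| <= K.
Proof.
move=> /pinfty_ex_gt0[K K0 h]; exists K => t t0; apply: h.
by rewrite /= in_itv/= t0.
Qed.

Lemma continuous_bounded_on {V W : normedModType R} (f : V -> W) (S : set V) :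
  continuous f -> compact S -> exists K, forall x, S x -> `|f x| <= K.
Proof.
move=> cf cS.
have /compact_bounded/pinfty_ex_gt0[K K0 h] : compact (f @` S).
  by apply: continuous_compact => //; exact: continuous_subspaceT.
by exists K => x Sx; apply: h; exists x.
Qed.

Lemma bounded_mx_of_cols m n (T : Type) (M : T -> 'M[R]_(m, n)) (S : set T)
    (f : 'I_n -> T -> 'cV[R]_m) :
  (forall t i j, S t -> M t i j = f j t i 0) ->
  (forall j, exists K, forall t, S t -> `|f j t| <= K) ->
  exists K, forall t, S t -> `|M t| <= K.
Proof.
move=> Mf /choice[K hK]; exists (\sum_j `|K j|) => t St.
rewrite mx_norm_le ?sumr_ge0//; apply/forallP => i; apply/forallP => j.
rewrite Mf// (le_trans (mx_norm_entry _ _ _))// (le_trans (hK j t St))//.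
rewrite (le_trans (ler_norm _))// (bigD1 j)//= lerDl.
by apply: sumr_ge0.
Qed.

(** A zero of a nonnegative function is a minimum along every coordinate line. This makes the
    transversal correction vanish on the manifold. *)
Lemma grad_min n (V : 'cV[R]_n -> R) x : (forall y, differentiable V y) ->
  (forall y, 0 <= V y) -> V x = 0 -> grad V x = 0.
Proof.
move=> dV V0 Vx; apply/colP => i; rewrite !mxE; set v := delta_mx i 0.
pose phi (s : R) := V (s *: v + x).
have dphi (s : R) : derivable phi s 1.
  apply/derivable1_diffP.
  by apply: (@differentiable_comp _ _ _ _ (fun s : R => s *: v + x) V).
have phi0 : phi 0 = 0 by rewrite /phi scale0r add0r.
have h11 : (-1 : R) <= 1 by lra.
have h0 : (0 : R) \in `]-1, 1[%R by rewrite in_itv/=; apply/andP; split; lra.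
have hmin (t : R) : t \in `](-1), 1[%R -> phi 0 <= phi t by rewrite phi0 => _; exact: V0.
have [] := derive1_at_min h11 (fun s _ => dphi s) h0 hmin.
have E : (fun s : R => s^-1 *: ((phi \o shift 0) (s *: 1) - phi 0)) =
         (fun s : R => s^-1 *: ((V \o shift x) (s *: v) - V x)).
  apply/funext => s; rewrite /phi /= scale0r add0r.
  by rewrite [s *: 1]mulr1 addr0.
by move=> _; rewrite /derive E.
Qed.

Section linearization_bounds.
Variables (n k p : nat) (Xe : 'cV[R]_n -> 'cV[R]_k -> 'cV[R]_n) (Vt : 'cV[R]_n -> R).
Variables (h : 'cV[R]_n -> 'cV[R]_p) (x0 : R -> 'cV[R]_n) (u0 : R -> 'cV[R]_k).
Hypothesis dXe : C1_on setT (fun z : 'cV[R]_n * 'cV[R]_k => Xe z.1 z.2).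
Hypothesis dVt : C1_on setT (grad Vt).
Hypothesis dh : C1_on setT h.
Hypothesis bx0 : exists K, forall t : R, 0 <= t -> `|x0 t| <= K.
Hypothesis bu0 : exists K, forall t : R, 0 <= t -> `|u0 t| <= K.

Lemma output_jacobian_bounded :
  exists K, forall t, 0 <= t -> `|partial_mx h (x0 t)| <= K.
Proof.
have [K hK] := bx0.
apply: (@bounded_mx_of_cols _ _ R (fun t => partial_mx h (x0 t)) [set t | 0 <= t]
  (fun j t => 'D_(delta_mx j 0) h (x0 t))) => [t i j _|j]; first by rewrite mxE.
have [|K' hK'] := @continuous_bounded_on _ _ (fun y => 'D_(delta_mx j 0) h y) _ _
    (@cV_ball_compact n K).
  by move=> y; exact: dh.2.
by exists K' => t t0; apply: hK'; exact: hK.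
Qed.

(** Regularity is assumed jointly in state and control, so the state derivative is expressed by the
    joint map, whose derivatives are bounded on a compact product of balls. *)
Lemma derive_partial (x v : 'cV[R]_n) (u : 'cV[R]_k) :
  'D_v (fun y => transversal_ext Xe Vt y u) x =
  'D_(v, 0 : 'cV[R]_k) (fun z : 'cV[R]_n * 'cV[R]_k => Xe z.1 z.2) (x, u)
   - 'D_v (grad Vt) x.
Proof.
have E : (fun s : R => s^-1 *: (((fun y => Xe y u) \o shift x) (s *: v) - Xe x u)) =
  (fun s : R => s^-1 *: (((fun z : 'cV[R]_n * 'cV[R]_k => Xe z.1 z.2) \o shift (x, u))
     (s *: (v, 0 : 'cV[R]_k)) - Xe x u)).
  by apply/funext => s /=; rewrite scaler0 add0r.
have [dX _] := dXe; have [dV _] := dVt.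
have hX := @diff_derivable _ _ _ _ (x, u) (v, 0 : 'cV[R]_k) (dX (x, u) I).
have hX' : derivable (fun y => Xe y u) x v by rewrite /derivable E.
have hV := @diff_derivable _ _ _ _ x v (dV x I).
have := deriveB hX' hV; rewrite /transversal_ext => ->.
by congr (_ - _); rewrite /derive E.
Qed.

Lemma state_jacobian_bounded : exists K, forall t, 0 <= t ->
  `|partial_mx (fun x => transversal_ext Xe Vt x (u0 t)) (x0 t)| <= K.
Proof.
have [K hK] := bx0; have [K1 hK1] := bu0.
apply: (@bounded_mx_of_cols _ _ R _ [set t | 0 <= t]
  (fun j t => 'D_(delta_mx j 0) (fun x => transversal_ext Xe Vt x (u0 t)) (x0 t)))
   => [t i j _|j]; first by rewrite mxE.
have [|K2 hK2] := @continuous_bounded_on _ _ (fun y => 'D_(delta_mx j 0) (grad Vt) y) _ _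
    (@cV_ball_compact n K).
  by move=> y; exact: dVt.2.
have [|K3 hK3] := @continuous_bounded_on _ _
    (fun z => 'D_(delta_mx j 0, 0 : 'cV[R]_k) (fun z : 'cV[R]_n * 'cV[R]_k => Xe z.1 z.2) z) _ _
    (compact_setX (@cV_ball_compact n K) (@cV_ball_compact k K1)).
  by move=> y; exact: dXe.2.
exists (K3 + K2) => t t0; rewrite derive_partial (le_trans (ler_normB _ _))//.
apply: lerD; last by apply: hK2; exact: hK.
by apply: hK3; split; [exact: hK|exact: hK1].
Qed.

End linearization_bounds.

(** * The inverse of the measurement noise matrix *)

Section noise_inverse.
Variables (p : nat) (Rm : R -> 'M[R]_p) (g3 g4 : R).
Hypothesis cRm : {within `[0, +oo[, continuous Rm}.
Hypothesis sRm : forall t : R, 0 <= t -> (Rm t)^T = Rm t.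
Hypothesis g30 : 0 < g3.
Hypothesis hRm : forall (t : R) v, 0 <= t -> g3 * sqn v <= dot v (Rm t *m v) <= g4 * sqn v.

Lemma noise_unit t : 0 <= t -> Rm t \in unitmx.
Proof.
move=> t0; apply: inj_unitmx => v Rv; apply: sqn_eq0; apply/eqP.
rewrite eq_le sqn_ge0 andbT; have /andP[] := hRm v t0.
by rewrite Rv dot0r pmulr_rle0.
Qed.

Lemma noise_inv_sym t : 0 <= t -> (invmx (Rm t))^T = invmx (Rm t).
Proof. by move=> t0; rewrite trmx_inv sRm. Qed.

Lemma noise_inv_lower t u : 0 <= t ->
  g3 * sqn (invmx (Rm t) *m u) <= dot u (invmx (Rm t) *m u).
Proof.
move=> t0; have /andP[+ _] := hRm (invmx (Rm t) *m u) t0.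
by rewrite mulKVmx ?noise_unit// (dotC u).
Qed.

(** Expand the nonnegative form of R at [v + w], where [w] is R^-1 u. *)
Lemma noise_inv_upper t u v : 0 <= t ->
  - 2 * dot v u - dot u (invmx (Rm t) *m u) <= g4 * sqn v.
Proof.
move=> t0; have /andP[_] := hRm v t0; set w := invmx (Rm t) *m u.
have wE : Rm t *m w = u by rewrite mulKVmx ?noise_unit.
have /andP[+ _] := hRm (v + w) t0.
have h : 0 <= g3 * sqn (v + w) by rewrite mulr_ge0 ?sqn_ge0// ltW.
rewrite mulmxDr dotDl !dotDr wE.
have -> : dot w (Rm t *m v) = dot v u by rewrite dot_trmx sRm// wE dotC.
rewrite (dotC w); move: h; lra.
Qed.

Lemma noise_inv_opb t : 0 <= t -> opb (1 / g3 ^+ 2) (invmx (Rm t)).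
Proof.
move=> t0 u; set w := invmx (Rm t) *m u.
have := noise_inv_lower u t0; rewrite -/w => h1.
have := dot_young u (g3 *: w); rewrite dotZr sqnZ => h2.
rewrite mulrC mul1r ler_pdivlMr ?exprn_gt0//.
have := ler_wpM2l (ltW g30) h1; lra.
Qed.

(** Resolvent identity R_t^-1 - R_s^-1 = R_s^-1 (R_s - R_t) R_t^-1, combined with the uniform bound
    on the inverses. *)
Lemma noise_inv_continuous : {within `[0, +oo[, continuous (fun t => invmx (Rm t))}.
Proof.
apply/subspace_continuousP => t; rewrite /= in_itv/= andbT => t0.
pose c : R := (1 / g3 ^+ 2) + 1.
have c0 : 0 <= 1 / g3 ^+ 2 by rewrite divr_ge0// exprn_ge0// ltW.
have nc s : 0 <= s -> `|invmx (Rm s)| <= c.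
  move=> s0; have c00 : 0 <= c by rewrite /c; lra.
  rewrite mx_norm_le//; apply/forallP => i; apply/forallP => j.
  have := noise_inv_opb s0 (delta_mx j 0); rewrite -colE.
  have -> : sqn (delta_mx j 0 : 'cV[R]_p) = 1.
    rewrite sqnE (bigD1 j)//= mxE !eqxx expr1n big1 ?addr0// => l lj.
    by rewrite mxE (negbTE lj) expr0n.
  rewrite mulr1 => h1; have h2 := norm_le_sqn (col j (invmx (Rm s))).
  have := mx_norm_entry (col j (invmx (Rm s))) i 0; rewrite mxE => /le_trans; apply.
  rewrite -ler_sqr ?nnegrE//; apply: (le_trans h2); apply: (le_trans h1).
  rewrite /c; nra.
have := (subspace_continuousP _ _).1 cRm t; rewrite /= in_itv/= andbT => /(_ t0) hR.
apply/cvgrPdist_le => e e0.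
pose K : R := (p%:R * c) * (p%:R * c) + 1.
have K0 : 0 < K by rewrite /K ltr_wpDl// -expr2 sqr_ge0.
have eK : 0 < e / K by rewrite divr_gt0.
move/cvgrPdist_le : hR => /(_ _ eK); rewrite !near_withinE; apply: filterS => s hs s0'.
have s0 : 0 <= s by move: s0'; rewrite /= in_itv/= andbT.
have -> : invmx (Rm t) - invmx (Rm s) =
    invmx (Rm s) *m (- (Rm t - Rm s) *m invmx (Rm t)).
  rewrite opprB mulmxBl mulmxBr mulmxA mulVmx ?noise_unit// mul1mx.
  by rewrite mulmxV ?noise_unit// mulmx1.
apply: (le_trans (mx_norm_mulmx _ _)).
have h1 : `|- (Rm t - Rm s) *m invmx (Rm t)| <= p%:R * (e / K) * c.
  apply: (le_trans (mx_norm_mulmx _ _)); rewrite normrN; apply: ler_pM => //.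
  - by rewrite ler_wpM2l// hs.
  - exact: nc.
have h2 : p%:R * `|invmx (Rm s)| <= p%:R * c by rewrite ler_wpM2l// nc.
apply: (le_trans (ler_pM _ _ h2 h1)) => //.
rewrite [leLHS](_ : _ = (p%:R * c) * (p%:R * c) * (e / K)); last by ring.
rewrite [leLHS]mulrA ler_pdivrMr// mulrC ler_pM2l// /K; lra.
Qed.

End noise_inverse.

(** The bound given by [exp_stable] concerns small initial data only; by linearity, a small multiple
    of any solution qualifies. *)
Lemma exp_stable_contracts n (S : R -> 'M[R]_n) (a : R) : 0 <= a ->
  (forall t, 0 <= t -> opb a (S t)) -> {within `[0, +oo[, continuous S} ->
  exp_stable (fun t (z : 'cV[R]_n) => S t *m z) -> contracts S 0.
Proof.
move=> a0 opS cS [_ [d [kp [la [[d0 kp0 la0] hs]]]]] k k0.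
pose c := n%:R * kp ^+ 2; have c0 : 0 <= c by rewrite mulr_ge0// sqr_ge0.
(* Since e^(2 la T) >= 1 + 2 la T, this length brings c e^(- 2 la T) below [k]. *)
exists (c / k / (2 * la) + 1).
  by rewrite ltr_wpDl// divr_ge0// ?divr_ge0// ?mulr_ge0// ltW.
move=> T s y hT s0 dy.
have T0 : 0 <= T.
  apply: le_trans hT; rewrite addr_ge0// divr_ge0// ?divr_ge0// ?mulr_ge0// ltW//.
have sT : s <= s + T by rewrite lerDl.
(* The stability bound holds on half-open intervals, so [y] is replaced by a solution that continues
   beyond [s + T]. *)
pose Te := s + T + 1.
have [Y [Ys dY]] := linear_ode_exists (y s) (le_trans sT (ltac:(by rewrite lerDl) : s + T <= Te))
  (within_sub_itvy s0 cS).
have yY : y (s + T) = Y (s + T).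
  have sTe : s + T <= Te by rewrite lerDl.
  have dd : evol s (s + T) (fun r => y r - Y r) (fun r => S r *m (y r - Y r) + 0).
    by apply: evol_eq (evolB dy (evol_sub (lexx s) sTe dY)) => r _; rewrite mulmxBr addr0.
  have := linear_growth sT a0 (lexx 0) _ dd; rewrite Ys subrr sqn0 mul0r addr0 mul0r => h.
  apply/eqP; rewrite -subr_eq0; apply/eqP/sqn_eq0/eqP.
  rewrite eq_le sqn_ge0 andbT; apply: h => // r /andP[sr _].
  by apply: opS; rewrite (le_trans s0)// ltW.
pose e := d / (2 * (`|y s| + 1)).
have ys1 : 0 < `|y s| + 1 by rewrite ltr_wpDl.
have e0 : 0 < e by rewrite divr_gt0// mulr_gt0.
have ed : e * `|y s| < d.
  rewrite /e mulrAC ltr_pdivrMr ?mulr_gt0//.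
  by rewrite ltr_pM2l//; have := normr_ge0 (y s); lra.
clearbody e.
have sol : is_sol (fun t (z : 'cV[R]_n) => S t *m z) `[s, Te[ (fun r => e *: Y r).
  split.
    apply/subspace_continuousP => r; rewrite /= in_itv/= => /andP[sr rT].
    apply: cvgZr; have [h _] := dY.
    apply: cvg_trans (h r _); last by rewrite sr ltW.
    apply: cvg_app; apply: within_subset => x /=; rewrite !in_itv/= => /andP[-> xT].
    exact: ltW.
  move=> r; rewrite interior_itv_bnd /= in_itv/= => rT.
  by have [_ /(_ r rT) h] := dY; rewrite -scalemxAr; exact: is_deriveZ.
have := hs s Te _ s0 sol; rewrite Ys => /(_ _ (s + T)) h.
have {}h : `|e *: Y (s + T)| <= kp * `|e *: y s| * expR (- la * (s + T - s)).
  apply: h; last by rewrite sT/= ltrDl.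
  by rewrite normrZ gtr0_norm.
have {}h : `|y (s + T)| <= kp * `|y s| * expR (- la * T).
  rewrite -(ler_pM2l e0); move: h; rewrite -yY !normrZ (gtr0_norm e0).
  by rewrite [s + T - s]addrC addKr mulrCA -!mulrA.
apply: (le_trans (sqn_le_norm _)).
have h2 : `|y (s + T)| ^+ 2 <= (kp * `|y s|) ^+ 2 * expR (- la * T * 2).
  rewrite expRM_natr -exprMn ler_sqr ?nnegrE//.
  by rewrite !mulr_ge0 ?expR_ge0// ltW.
have h3 : c * expR (- la * T * 2) <= k.
  have -> : - la * T * 2 = - (2 * la * T) by ring.
  rewrite expRN ler_pdivrMr ?expR_gt0//.
  have := expR_ge1Dx (2 * la * T).
  have : c / k / (2 * la) <= T by lra.
  rewrite ler_pdivrMr ?mulr_gt0// ler_pdivrMr// => h4 h5.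
  have := ler_wpM2l (ltW k0) h5; lra.
apply: (le_trans (ler_wpM2l (ler0n _ n) h2)); rewrite exprMn.
have := ler_wpM2r (sqr_ge0 `|y s|) h3; rewrite /c => h4.
have := ler_wpM2l (ltW k0) (norm_le_sqn (y s)); lra.
Qed.

End boundedness.

(** * From the error dynamics to tracking on the manifold *)

Section tracking.
Context {R : realType}.

Lemma cvg_col_mx {T : Type} (F : set_system T) {FF : Filter F} {m n p}
  (M : T -> 'M[R]_(m, p)) (N : T -> 'M[R]_(n, p)) (M0 : 'M[R]_(m, p)) (N0 : 'M[R]_(n, p)) :
  M x @[x --> F] --> M0 -> N x @[x --> F] --> N0 ->
  col_mx (M x) (N x) @[x --> F] --> col_mx M0 N0.
Proof.
move=> /cvg_mxP hM /cvg_mxP hN; apply/cvg_mxP => i j.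
case: (split_ordP i) => k ->.
  by under eq_fun do rewrite col_mxEu; rewrite col_mxEu; exact: hM.
by under eq_fun do rewrite col_mxEd; rewrite col_mxEd; exact: hN.
Qed.

Lemma is_derive_col_mx {m n p} (M : R -> 'M[R]_(m, p)) (N : R -> 'M[R]_(n, p)) (t : R)
    (dM : 'M[R]_(m, p)) (dN : 'M[R]_(n, p)) :
  is_derive t (1 : R) M dM -> is_derive t (1 : R) N dN ->
  is_derive t (1 : R) (fun s => col_mx (M s) (N s)) (col_mx dM dN).
Proof.
move=> /is_derive_mxP hM /is_derive_mxP hN; apply/is_derive_mxP => i j.
case: (split_ordP i) => k ->.
  by under eq_fun do rewrite col_mxEu; rewrite col_mxEu; exact: hM.
by under eq_fun do rewrite col_mxEd; rewrite col_mxEd; exact: hN.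
Qed.

Lemma col_mx_norm_le m n (u : 'cV[R]_m) (v : 'cV[R]_n) (e : R) :
  `|u| <= e -> `|v| <= e -> `|col_mx u v| <= e.
Proof.
move=> ue ve; have e0 : 0 <= e by apply: le_trans ue.
rewrite mx_norm_le//; apply/forallP => i; apply/forallP => j.
case: (split_ordP i) => l ->; rewrite ?col_mxEu ?col_mxEd.
  exact: le_trans (mx_norm_entry _ _ _) ue.
exact: le_trans (mx_norm_entry _ _ _) ve.
Qed.

Lemma norm_le_col_mx m n (u : 'cV[R]_m) (v : 'cV[R]_n) : `|u| <= `|col_mx u v|.
Proof.
rewrite mx_norm_le//; apply/forallP => i; apply/forallP => j.
by rewrite -(col_mxEu u v) mx_norm_entry.
Qed.

(** On [M] the fields [tXe] and [X] agree, so the pair of errors of a closed-loop trajectory that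
    stays on [M] solves the error equation on the whole space. *)
Lemma exp_stable_tracks (n k p : nat) (X tXe : 'cV[R]_n -> 'cV[R]_k -> 'cV[R]_n)
    (h : 'cV[R]_n -> 'cV[R]_p) (x0 : R -> 'cV[R]_n) (u0 : R -> 'cV[R]_k)
    (K : R -> 'M[R]_(k, n)) (L : R -> 'M[R]_(n, p)) (M : set 'cV[R]_n) :
  (forall x u, M x -> tXe x u = X x u) ->
  is_sol (fun t x => X x (u0 t)) `[0, +oo[ x0 ->
  exp_stable (error_field X tXe h x0 u0 K L) ->
  exp_tracks_on X tXe h x0 u0 K L M.
Proof.
move=> XM sx0 [_ [d [kp [la [[d0 kp0 la0] hs]]]]].
exists d, kp, la; split=> // t0 T x xh u t00 Mx sx sxh xd xhd t tT.
pose z s := col_mx (x s - x0 s) (x s - xh s).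
have sz : is_sol (error_field X tXe h x0 u0 K L) `[t0, T[ z.
  have [cx dx] := sx; have [cxh dxh] := sxh; have [cx0 dx0] := sx0.
  split.
    have cx0' : {within `[t0, T[, continuous x0}.
      apply: continuous_subspaceW cx0 => s /=; rewrite !in_itv/= => /andP[ts _].
      by rewrite (le_trans t00).
    move=> s; apply: cvg_col_mx.
      by apply: cvgB; [exact: cx|exact: cx0'].
    by apply: cvgB; [exact: cx|exact: cxh].
  move=> s /[dup] sI; rewrite interior_itv_bnd /= in_itv/= => /andP[ts sT].
  have d0s : is_derive s (1 : R) x0 (X (x0 s) (u0 s)).
    by apply: dx0; rewrite interior_itv_bndy /= in_itv/= andbT (le_lt_trans t00).
  have Ms : M (x s) by apply: Mx; rewrite (ltW ts).
  rewrite /error_field /z col_mxKu col_mxKd.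
  rewrite (_ : x0 s + (x s - x0 s) = x s); last by rewrite addrC subrK.
  rewrite (_ : x s - (x s - xh s) = xh s); last by rewrite opprB addrC subrK.
  rewrite (XM (x s) _ Ms); apply: is_derive_col_mx.
    exact: is_deriveB (dx s sI) d0s.
  exact: is_deriveB (dx s sI) (dxh s sI).
have zt0 : `|z t0| < d.
  apply: (@le_lt_trans _ _ (Num.max `|x t0 - x0 t0| `|x t0 - xh t0|)).
    by apply: col_mx_norm_le; rewrite le_max lexx ?orbT.
  by rewrite gt_max xd.
apply: (le_trans (norm_le_col_mx _ (x t - xh t))).
apply: (le_trans (hs t0 T z t00 sz zt0 t tT)).
rewrite ler_wpM2r ?expR_ge0// ler_wpM2l ?(ltW kp0)//.
by apply: col_mx_norm_le; rewrite ?lerDl ?lerDr.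
Qed.

End tracking.

(** The cascade result is applied with diagonal blocks A - B K and A - L C and coupling B K.
    Boundedness of the second block rests on the bounds for [A] and [C] along the reference, for [P]
    and for the inverse of [Rm]. *)
Theorem theorem4 (R : realType) (n k p q : nat)
  (M : set 'cV[R]_n)
  (X Xe : 'cV[R]_n -> 'cV[R]_k -> 'cV[R]_n)
  (h : 'cV[R]_n -> 'cV[R]_p)
  (Vt : 'cV[R]_n -> R)
  (x0 : R -> 'cV[R]_n) (u0 : R -> 'cV[R]_k)
  (A : R -> 'M[R]_n) (B : R -> 'M[R]_(n, k)) (C : R -> 'M[R]_(p, n))
  (K : R -> 'M[R]_(k, n)) (L : R -> 'M[R]_(n, p))
  (P Qm : R -> 'M[R]_n) (Rm : R -> 'M[R]_p)
  (D : R -> 'M[R]_(n, q)) (Qt : R -> 'M[R]_q) :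
  let tXe := transversal_ext Xe Vt in
  (* the system, its extension and the function Vt *)
  regular_manifold M ->
  (forall x u, M x -> tangent_space M x (X x u)) ->
  (forall x u, M x -> Xe x u = X x u) ->
  (forall x, 0 <= Vt x) ->
  M = Vt @^-1` [set 0] ->
  (forall x, differentiable Vt x) ->
  (forall x u, ((grad Vt x)^T *m Xe x u) 0 0 = 0) ->
  C1_on setT (fun z : 'cV[R]_n * 'cV[R]_k => Xe z.1 z.2) ->
  C1_on setT (grad Vt) ->
  C1_on setT h ->
  (* the reference and the linearization along it *)
  (forall t, 0 <= t -> M (x0 t)) ->
  [bounded x0 t | t in `[0, +oo[%classic] ->
  [bounded u0 t | t in `[0, +oo[%classic] ->
  is_sol (fun t x => X x (u0 t)) `[0, +oo[ x0 ->
  (forall t, 0 <= t -> A t = partial_mx (fun x => tXe x (u0 t)) (x0 t)) ->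
  (forall t, 0 <= t -> B t = partial_mx (fun u => tXe (x0 t) u) (u0 t)) ->
  (forall t, 0 <= t -> C t = partial_mx h (x0 t)) ->
  {within `[0, +oo[, continuous A} ->
  {within `[0, +oo[, continuous B} ->
  {within `[0, +oo[, continuous C} ->
  (* the observer gain *)
  {within `[0, +oo[, continuous Qm} ->
  {within `[0, +oo[, continuous Rm} ->
  (forall t, 0 <= t -> sym (Rm t) /\ posdef (Rm t)) ->
  (forall t, 0 <= t -> sym (Qm t) /\ mx_le 0 (Qm t)) ->
  sym (P 0) /\ mx_le 0 (P 0) ->
  is_sol (fun t (S : 'M[R]_n) => S *m (A t)^T + A t *m S
            - S *m (C t)^T *m invmx (Rm t) *m C t *m S + Qm t)
         `[0, +oo[ P ->
  (forall t, 0 <= t -> L t = P t *m (C t)^T *m invmx (Rm t)) ->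
  (* the error dynamics linearize as in the displayed equation *)
  {within `[0, +oo[, continuous K} ->
  second_order_remainder (error_field X tXe h x0 u0 K L)
                         (error_linear_part K L A B C) ->
  (* i *)
  exp_stable (fun t (z : 'cV[R]_n) => (A t - B t *m K t) *m z) ->
  (* ii *)
  [bounded B t *m K t | t in `[0, +oo[%classic] ->
  (* iii *)
  uniformly_completely_observable A C ->
  (* iv *)
  (forall t, 0 <= t -> sym (Qt t) /\ Qm t = D t *m Qt t *m (D t)^T) ->
  uniformly_completely_controllable A D ->
  (exists g1 g2 : R, [/\ 0 < g1, 0 < g2 &
     forall t, 0 <= t -> mx_le g1%:M (Qt t) /\ mx_le (Qt t) g2%:M]) ->
  (* v *)
  (exists g3 g4 : R, [/\ 0 < g3, 0 < g4 &
     forall t, 0 <= t -> mx_le g3%:M (Rm t) /\ mx_le (Rm t) g4%:M]) ->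
  exp_stable (error_field X tXe h x0 u0 K L) /\
  exp_tracks_on X tXe h x0 u0 K L M.
Proof.
move=> tXe _ _ XeX Vt0 MV dVt _ C1X C1V C1h Mx0 bx0 bu0 sx0 AE BE CE cA cB cC cQ cRm.
move=> hRm hQ [sP0 pP0] dP LE cK rem stabK bBK uco hQt ucc [g1 [g2 [g10 g20 bQt]]].
move=> [g3 [g4 [g30 g40 bRm]]].
have tXeM x u : M x -> tXe x u = X x u.
  move=> Mx; rewrite /tXe /transversal_ext XeX// grad_min ?subr0//.
  by move: Mx; rewrite MV.
have bx := bounded_nearP bx0; have bu := bounded_nearP bu0.
have [KA hKA] := state_jacobian_bounded C1X C1V bx bu.
have [KC hKC] := output_jacobian_bounded C1h bx.
have [KB hKB] := bounded_nearP bBK.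
have hRm' (t : R) v : 0 <= t -> g3 * sqn v <= dot v (Rm t *m v) <= g4 * sqn v.
  move=> t0; have [h1 h2] := bRm t t0.
  by have := h1 v; have := h2 v; rewrite !qformE !dot_scalar => -> ->.
have hQt' (t : R) v : 0 <= t -> g1 * sqn v <= dot v (Qt t *m v) <= g2 * sqn v.
  move=> t0; have [h1 h2] := bQt t t0.
  by have := h1 v; have := h2 v; rewrite !qformE !dot_scalar => -> ->.
pose Ri t := invmx (Rm t).
have sRm (t : R) : 0 <= t -> (Rm t)^T = Rm t by move=> /hRm[].
have cRi : {within `[0, +oo[, continuous Ri} := noise_inv_continuous cRm g30 hRm'.
have opRi (t : R) : 0 <= t -> opb (1 / g3 ^+ 2) (Ri t) by move=> t0; apply: noise_inv_opb g30 hRm' _ t0.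
(* The added 1 gives strict positivity, which [opb_tr] requires. *)
pose a := n%:R * (n%:R * KA) ^+ 2 + 1.
have a0 : 0 < a by rewrite ltr_wpDl// mulr_ge0 ?sqr_ge0.
have opA (t : R) : 0 <= t -> opb a (A t).
  by move=> t0; rewrite AE//; apply: opb_le (opb_norm (hKA t t0)); rewrite lerDl.
pose c := p%:R * (n%:R * KC) ^+ 2 + 1.
have c0 : 0 < c by rewrite ltr_wpDl// mulr_ge0 ?sqr_ge0.
have opC (t : R) : 0 <= t -> opb c (C t).
  by move=> t0; rewrite CE//; apply: opb_le (opb_norm (hKC t t0)); rewrite lerDl.
pose b := n%:R * (n%:R * KB) ^+ 2.
have b0 : 0 <= b by rewrite mulr_ge0 ?sqr_ge0.
have opB (t : R) : 0 <= t -> opb b (B t *m K t) by move=> t0; exact: opb_norm (hKB t t0).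
have sQ (t : R) : 0 <= t -> (Qm t)^T = Qm t by move=> /hQ[].
have pQ (t : R) x : 0 <= t -> 0 <= dot x (Qm t *m x).
  by move=> /hQ[_ /(_ x)]; rewrite !qformE mul0mx dot0r.
have QE (t : R) : 0 <= t -> Qm t = D t *m Qt t *m (D t)^T by move=> /hQt[].
have [sg [al [q2 [sg0 al0 q20 cl cu]]]] :=
  controllability_bounds cA cQ a0 opA g10 g20 QE sQ hQt' ucc.
have pP0' x : 0 <= dot x (P 0 *m x).
  by have := pP0 x; rewrite !qformE mul0mx dot0r.
have sRi (t : R) : 0 <= t -> (Ri t)^T = Ri t by move=> t0; exact: noise_inv_sym sRm t t0.
have ri3 (t : R) u : 0 <= t -> g3 * sqn (Ri t *m u) <= dot u (Ri t *m u).
  exact: noise_inv_lower g30 hRm' _ _.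
have ri4 (t : R) u v : 0 <= t -> - 2 * dot v u - dot u (Ri t *m u) <= g4 * sqn v.
  exact: noise_inv_upper sRm g30 hRm' _ _ _.
have [[pb pb0 opP] [s0 s00 con2]] := observer_stability cA cQ cC cRi a0 opA c0 opC sQ pQ sRi
  g30 ri3 g40 ri4 sP0 pP0' dP sg0 al0 q20 cl cu uco.
pose S1 t := A t - B t *m K t; pose S2 t := A t - P t *m (C t)^T *m Ri t *m C t.
have cS1 : {within `[0, +oo[, continuous S1}.
  exact: within_addmx cA (within_oppmx (within_mulmx cB cK)).
have cS2 : {within `[0, +oo[, continuous S2}.
  have cP : {within `[0, +oo[, continuous P} by have [] := dP.
  exact: within_addmx cA (within_oppmx (within_mulmx (within_mulmx
    (within_mulmx cP (within_trmx cC)) cRi) cC)).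
pose e := pb * c * (1 / g3 ^+ 2) * c.
have e0 : 0 <= e.
  by rewrite /e !mulr_ge0// ?(ltW pb0) ?(ltW c0)// invr_ge0 sqr_ge0.
pose d := 2 * (a + b) + b + 2 * (a + e).
have op1 t : 0 <= t -> opb (2 * (a + b)) (S1 t).
  by move=> t0; apply: opbD (opA t t0) (opbN (opB t t0)).
have op2 t : 0 <= t -> opb (2 * (a + e)) (S2 t).
  move=> t0; apply: opbD (opA t t0) (opbN _).
  have g30' : 0 <= 1 / g3 ^+ 2 by rewrite mul1r invr_ge0 sqr_ge0.
  have pc0 : 0 <= pb * c by rewrite mulr_ge0 ?ltW.
  apply: opbM (opC t t0); first exact: mulr_ge0.
  apply: opbM (opRi t t0) => //.
  by apply: opbM (opP t t0) (opb_tr c0 (opC t t0)); exact: ltW.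
have a0' := ltW a0.
have hop t : 0 <= t -> [/\ opb d (S1 t), opb d (B t *m K t) & opb d (S2 t)].
  move=> t0; split.
  - by apply: opb_le (op1 t t0); rewrite /d; lra.
  - by apply: opb_le (opB t t0); rewrite /d; lra.
  - by apply: opb_le (op2 t t0); rewrite /d; lra.
have con1 : contracts S1 s0.
  have ab0 : 0 <= 2 * (a + b) by lra.
  move=> k0 /(exp_stable_contracts ab0 op1 cS1 stabK)[T0 T00 hT]; exists T0 => // T s y TT ss.
  by apply: hT => //; exact: le_trans ss.
have F0 t : 0 <= t -> error_field X tXe h x0 u0 K L t 0 = 0.
  have u0E : usubmx (0 : 'cV[R]_(n + n)) = 0 by apply/matrixP => i j; rewrite !mxE.
  have d0E : dsubmx (0 : 'cV[R]_(n + n)) = 0 by apply/matrixP => i j; rewrite !mxE.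
  move=> t0; rewrite /error_field /= u0E d0E addr0 subr0 /feedback /observer.
  by rewrite !subrr !mulmx0 !subr0 (tXeM _ _ (Mx0 t t0)) !subrr col_mx0.
have rem' : second_order_remainder (error_field X tXe h x0 u0 K L)
    (fun t => block_mx (S1 t) (B t *m K t) 0 (S2 t)).
  have [c' [d' [d'0 hrem]]] := rem; exists c', d'; split=> // t Dx eo t0 hD he.
  by have := hrem t Dx eo t0 hD he; rewrite /error_linear_part LE.
have d0 : 0 <= d by rewrite /d; lra.
have stab := cascade_exp_stable d0 hop cS1 cS2 con1 con2 F0 rem'.
split=> //; exact: exp_stable_tracks tXeM sx0 stab.
Qed.
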